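(* Let $\Gamma$ and $\Gamma'$ be two finite graphs. The following facts are equivalent: (i) $[\Gamma^3]_{\rm cyc}=[\Gamma'^3]_{\rm cyc}$. (ii) $\operatorname{Del}(\Gamma)\cong\operatorname{Del}(\Gamma')$. (iii) $\mathcal{SP}_{\Gamma}\cong\mathcal{SP}_{\Gamma'}$ as posets. (iv) $\mathcal{OP}_{\Gamma}\cong\mathcal{OP}_{\Gamma'}$ as posets. (v) $\overline{\mathcal{OP}_{\Gamma}}\cong\overline{\mathcal{OP}_{\Gamma'}}$ as posets.
   Context: Graphs are finite; loops and multiple edges are allowed; graphs need not be connected. For $S\subset E(\Gamma)$, $\Gamma\smallsetminus S$ is obtained by removing the edges in $S$ and keeping all vertices. An edge is separating if its removal disconnects its connected component. A cycle is a connected graph with no separating edges and first Betti number $1$. Graphs are cyclically equivalent if there is a bijection between their edge sets inducing a bijection between their cycles (subgraphs that are cycles); $[\Gamma]_{\rm cyc}$ is the cyclic equivalence class. For connected $\Gamma$, $\Gamma^2$ is obtained by contracting all separating edges, and a $3$-edge connectivization $\Gamma^3$ is obtained from $\Gamma^2$ by repeatedly contracting one of the two edges of a separating pair of edges (two non-separating edges whose joint removal disconnects the graph), until there is no such pair; for disconnected $\Gamma$ do this on each component. $[\Gamma^3]_{\rm cyc}$ does not depend on the choice of $\Gamma^3$. Delaunay decomposition: fix an orientation of $\Gamma$; $C_1(\Gamma,A)=\bigoplus_{e\in E(\Gamma)}A\cdot e$, $C_0(\Gamma,A)=\bigoplus_{v\in V(\Gamma)}A\cdot v$, $\partial(e)=t(e)-s(e)$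 (target minus source), $H_1(\Gamma,A)=\ker\partial$. On $C_1(\Gamma,\mathbb R)$ take the Euclidean scalar product with orthonormal basis $E(\Gamma)$, restricted to $H_1(\Gamma,\mathbb R)$, with norm $\|\cdot\|$. For $\alpha\in H_1(\Gamma,\mathbb R)$, $x\in H_1(\Gamma,\mathbb Z)$ is $\alpha$-nearest if $\|x-\alpha\|=\min\{\|y-\alpha\|: y\in H_1(\Gamma,\mathbb Z)\}$. A Delaunay cell is the closed convex hull of all $\alpha$-nearest lattice elements for some fixed $\alpha$. The Delaunay cells form the decomposition $\operatorname{Del}(\Gamma)$ of $H_1(\Gamma,\mathbb R)$. $\operatorname{Del}(\Gamma)\cong\operatorname{Del}(\Gamma')$ means that there is a linear isomorphism $H_1(\Gamma,\mathbb R)\to H_1(\Gamma',\mathbb R)$ sending $H_1(\Gamma,\mathbb Z)$ into $H_1(\Gamma',\mathbb Z)$ and mapping each Delaunay cell of $\operatorname{Del}(\Gamma)$ onto a Delaunay cell of $\operatorname{Del}(\Gamma')$. Posets: $\mathcal{SP}_\Gamma$ is the set of all $S\subset E(\Gamma)$ such that $\Gamma\smallsetminus S$ has no separating edges, ordered by $S\ge T\Leftrightarrow S\subseteq T$. An orientation of a connected graph is totally cyclic if there is no proper non-empty subset $W$ of the vertex set such that the edges between $W$ and its complement go all in the same direction (all from $W$ to the complement, or all from the complement to $W$); for a disconnected graph, an orientation is totally cyclic if it is so on each connected component. $\mathcal{OP}_\Gamma$ is the set of pairs $(S,\phi_S)$ with $S\in\mathcal{SP}_\Gamma$ and $\phi_S$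 a totally cyclic orientation of $\Gamma\smallsetminus S$, ordered by $(S,\phi_S)\ge(T,\phi_T)\Leftrightarrow S\subset T$ and $\phi_T=(\phi_S)_{|E(\Gamma\smallsetminus T)}$. For $v\in V(\Gamma)$, $d^+(S,\phi_S)_v$ is the number of edges of $\Gamma\smallsetminus S$ going out of $v$ according to $\phi_S$. Write $(S,\phi_S)\sim(S',\phi_{S'})$ if $S=S'$ and $d^+(S,\phi_S)_v=d^+(S',\phi_{S'})_v$ for all $v\in V(\Gamma)$. $\overline{\mathcal{OP}_\Gamma}=\mathcal{OP}_\Gamma/\sim$, with $[(S,\phi_S)]\ge[(T,\phi_T)]$ iff there are $(S',\phi_{S'})\sim(S,\phi_S)$ and $(T',\phi_{T'})\sim(T,\phi_T)$ with $(S',\phi_{S'})\ge(T',\phi_{T'})$ in $\mathcal{OP}_\Gamma$. *)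

(* Defs.v *)
From HB Require Import structures.
From mathcomp Require Import all_boot all_order all_algebra.
From mathcomp Require Import boolp classical_sets reals.

Set Implicit Arguments.
Unset Strict Implicit.
Unset Printing Implicit Defensive.

Import Order.TTheory GRing.Theory Num.Theory.

Local Open Scope ring_scope.
Local Open Scope classical_set_scope.

(* Finite graph with loops and multiple edges. The ends [src e] and [tgt e]
   also record the fixed reference orientation used for the boundary map;
   connectivity and contraction below ignore which end is which. *)
Record graph := Graph {
  vert : finType;
  edge : finType;
  src : edge -> vert;
  tgt : edge -> vert }.

Section Connectivity.
Variable G : graph.

Definition adj : rel (vert G) := fun u v =>
  [exists e : edge G, ((src e == u) && (tgt e == v)) ||
                      ((src e == v) && (tgt e == u))].

Definition conn : rel (vert G) := connect adj.

Definition component (v : vert G) : {set vert G} := [set w | conn v w]%SET.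

Definition connected : bool :=
  (0 < #|vert G|)%N && [forall u, forall v, conn u v].

Definition delete (S : {set edge G}) : graph :=
  @Graph (vert G) {e : edge G | e \notin S}
    (fun e => src (val e)) (fun e => tgt (val e)).

End Connectivity.

(* Removing the edges in [S] disconnects the vertex set [W]. *)
Definition disconnects (G : graph) (S : {set edge G}) (W : {set vert G}) :=
  [exists u in W, exists v in W, ~~ @conn (delete S) u v].

Definition separating (G : graph) (e : edge G) : bool :=
  disconnects [set e]%SET (component (src e)).

Definition no_separating (G : graph) : bool :=
  [forall e : edge G, ~~ separating e].

(* For a graph that need not be connected, a separating pair is a separating
   pair of one of its connected components. *)
Definition separating_pair (G : graph) (e f : edge G) : bool :=
  [&& e != f, ~~ separating e, ~~ separating f,
      conn (src e) (src f) & disconnects [set e; f]%SET (component (src e))].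

Section Contraction.
Variables (G : graph) (T : {set edge G}).

(* The vertices of the contraction are the connected components of the
   spanning subgraph whose set of edges is [T]. *)
Definition block (v : vert G) : {set vert G} := @component (delete (~: T)%SET) v.

Definition contract_vert := {B : {set vert G} | [exists v, B == block v]}.

Lemma block_subproof v : [exists w, block v == block w].
Proof. by apply/existsP; exists v. Qed.

Definition to_block (v : vert G) : contract_vert :=
  exist _ (block v) (block_subproof v).

Definition contract : graph :=
  @Graph contract_vert {e : edge G | e \notin T}
    (fun e => to_block (src (val e))) (fun e => to_block (tgt (val e))).

End Contraction.

Definition two_conn (G : graph) : graph :=
  contract [set e : edge G | separating e]%SET.

(* [pair_reduces G H]: [H] is a possible end result of contracting one edge of
   a separating pair of [G], as long as there is such a pair. *)
Inductive pair_reduces : graph -> graph -> Prop :=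
| pair_reduces_stop (G : graph) :
    (forall e f : edge G, ~~ separating_pair e f) -> pair_reduces G G
| pair_reduces_step (G H : graph) (e f : edge G) :
    separating_pair e f -> pair_reduces (contract [set e]%SET) H ->
    pair_reduces G H.

Definition three_conn (G H : graph) : Prop := pair_reduces (two_conn G) H.

Section Homology.
Variables (F : fieldType) (G : graph).

Definition chain0 := {ffun vert G -> F^o}.
Definition chain1 := {ffun edge G -> F^o}.

(* The linear map with [e |-> tgt e - src e], in coordinates. *)
Definition boundary (c : chain1) : chain0 :=
  [ffun v => \sum_(e | tgt e == v) c e - \sum_(e | src e == v) c e].

Lemma boundary_is_linear : linear boundary.
Proof.
move=> a c d; apply/ffunP => v; rewrite !ffunE.
under eq_bigr do rewrite !ffunE.
under [X in _ - X]eq_bigr do rewrite !ffunE.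
rewrite !big_split /= -!scaler_sumr scalerBr opprD !addrA.
by congr (_ - _); rewrite addrAC.
Qed.

HB.instance Definition _ :=
  GRing.isLinear.Build F chain1 chain0 _ boundary boundary_is_linear.

Definition cycle_space : {vspace chain1} := lker (linfun boundary).

Definition H1 := subvs_of cycle_space.

End Homology.

Definition betti1 (G : graph) : nat := \dim (cycle_space rat G).

Definition is_cycle (G : graph) : bool :=
  [&& connected G, no_separating G & betti1 G == 1%N].

(* The subgraph with set of vertices [W] and set of edges [A], when all the
   ends of [A] are in [W]; in general, the edges not satisfying this are
   discarded. *)
Section Subgraph.
Variables (G : graph) (W : {set vert G}) (A : {set edge G}).

Definition sub_edge :=
  {e : edge G | [&& e \in A, src e \in W & tgt e \in W]}.

Lemma sub_src_subproof (e : sub_edge) : src (val e) \in W.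
Proof. by case/and3P: (valP e). Qed.

Lemma sub_tgt_subproof (e : sub_edge) : tgt (val e) \in W.
Proof. by case/and3P: (valP e). Qed.

Definition subgraph : graph :=
  @Graph {v : vert G | v \in W} sub_edge
    (fun e => exist _ (src (val e)) (sub_src_subproof e))
    (fun e => exist _ (tgt (val e)) (sub_tgt_subproof e)).

End Subgraph.

(* [A] is the set of edges of a cycle of [G]. A cycle is determined by its
   edges, as all its vertices are ends of some of them. *)
Definition cycle_edges (G : graph) (A : {set edge G}) : bool :=
  [exists W : {set vert G},
    [forall e in A, (src e \in W) && (tgt e \in W)]
    && is_cycle (subgraph W A)].

Definition cyc_equiv (G G' : graph) : Prop :=
  exists2 f : edge G -> edge G', bijective f &
    forall A : {set edge G},
      cycle_edges A = cycle_edges [set f e | e in A]%SET.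

(* [cyc_class3 G] is the cyclic equivalence class of the 3-edge
   connectivizations of [G]. It is a predicate on [graph], and equality of
   classes is stated by [<->], because [graph] is too large a type for [set]. *)
Definition cyc_class3 (G H : graph) : Prop :=
  exists2 G3, three_conn G G3 & cyc_equiv G3 H.

Definition same_cyc_class3 (G G' : graph) : Prop :=
  forall H : graph, cyc_class3 G H <-> cyc_class3 G' H.

Section Delaunay.
Variables (R : realType) (G : graph).

Definition H1Z : set (H1 R G) :=
  [set x | forall e, (val x : chain1 R G) e \is a Num.int].

Definition H1norm (x : H1 R G) : R :=
  Num.sqrt (\sum_e ((val x : chain1 R G) e : R) ^+ 2).

Definition nearest (a : H1 R G) : set (H1 R G) :=
  [set x | H1Z x /\ forall y, H1Z y -> H1norm (x - a) <= H1norm (y - a)].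

Definition convex_hull (A : set (H1 R G)) : set (H1 R G) :=
  [set x | exists (n : nat) (p : 'I_n -> H1 R G) (t : 'I_n -> R),
     [/\ forall i, A (p i), forall i, 0 <= t i,
         \sum_i t i = 1 & x = \sum_i t i *: p i]].

Definition norm_closure (A : set (H1 R G)) : set (H1 R G) :=
  [set x | forall eps : R, 0 < eps -> exists2 y, A y & H1norm (x - y) < eps].

Definition Delaunay_cell (D : set (H1 R G)) : Prop :=
  exists a : H1 R G, D = norm_closure (convex_hull (nearest a)).

End Delaunay.

Definition Del_iso (R : realType) (G G' : graph) : Prop :=
  exists f : {linear H1 R G -> H1 R G'},
    [/\ bijective f,
        forall x, H1Z x -> H1Z (f x) &
        forall D, Delaunay_cell D -> Delaunay_cell (f @` D)].

Definition order_iso (A B : Type) (leA : rel A) (leB : rel B) : Prop :=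
  exists2 f : A -> B, bijective f & {mono f : x y / leA x y >-> leB x y}.

Section SP.
Variable G : graph.

Definition SP := {S : {set edge G} | no_separating (delete S)}.

Definition SP_ge : rel SP := fun S T => val S \subset val T.

End SP.

(* An orientation keeps ([true]) or reverses ([false]) the reference direction
   of each edge; in particular a loop has two orientations. *)
Definition orientation (G : graph) := {ffun edge G -> bool}.

Section Orientation.
Variables (G : graph) (phi : orientation G).

Definition osrc (e : edge G) := if phi e then src e else tgt e.
Definition otgt (e : edge G) := if phi e then tgt e else src e.

(* All the edges between [A] and [B] go from [A] to [B]. *)
Definition one_way (A B : {set vert G}) : bool :=
  [forall e, ~~ ((osrc e \in B) && (otgt e \in A))].

Definition totally_cyclic : bool :=
  [forall v, forall W : {set vert G},
    (W != finset.set0) && (W \proper component v) ==>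
    ~~ one_way W (component v :\: W)%SET && ~~ one_way (component v :\: W)%SET W].

Definition out_degree (v : vert G) : nat := #|[set e | osrc e == v]%SET|.

End Orientation.

Section OP.
Variable G : graph.

Definition OP := {x : {S : {set edge G} & orientation (delete S)} |
  no_separating (delete (tag x)) && totally_cyclic (tagged x)}.

Definition OP_ge : rel OP := fun x y =>
  (tag (val x) \subset tag (val y)) &&
  [forall e : edge (delete (tag (val y))),
   forall e' : edge (delete (tag (val x))),
     (val e == val e') ==> (tagged (val y) e == tagged (val x) e')].

Definition OP_equiv : rel OP := fun x y =>
  (tag (val x) == tag (val y)) &&
  [forall v : vert G, @out_degree (delete (tag (val x))) (tagged (val x)) v
                   == @out_degree (delete (tag (val y))) (tagged (val y)) v].

Definition OPbar :=
  {C : {set OP} | [exists x, C == [set y | OP_equiv x y]%SET]}.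

Definition OPbar_ge : rel OPbar := fun C D =>
  [exists x in val C, exists y in val D, OP_ge x y].

End OP.

(* Main.v *)
(** All five structures are read off the space of flows H_1 inside the space of
  functions on the edges.  The complements of the members of SP are the supports
  of flows, whose minimal elements are the cycles; OP is the poset of the sign
  vectors of flows; in the quotient of OP two sign vectors are equivalent when they
  have the same support and differ by a flow; the Delaunay cells are the boxes
  cut out by the hyperplanes x_e = n with n an integer, because an orthogonal
  projection of the centre of such a box is equidistant from its lattice points,
  and total unimodularity makes the box the hull of these.

  Contracting a bridge, or an edge of a separating pair, does not change the poset
  of supports, whose coatoms are the classes of edges that always occur together
  in cycles: this gives (i) <-> (iii).  As H_1 is a regular space, it is determined
  by its supports up to signs of the coordinates, so that (iii) implies (ii), (iv)
  and (v).  Conversely the supports are recovered from Del by the points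
  t y + s x and t y - s x lying in the box of t y; from OP by the distance in the
  graph of topes, which tells whether two walls lie on one hyperplane; and from
  its quotient by the elements of height two, which are the thetas of cycles: the
  cycles inside a given support are the theta closure of those below any element
  with this support. *)

Require Import Defs.
From HB Require Import structures.
From mathcomp Require Import boolp classical_sets reals.
From mathcomp Require Import all_boot all_order all_algebra.
From mathcomp Require Import ring lra zify.

Set Implicit Arguments.
Unset Strict Implicit.
Unset Printing Implicit Defensive.

Import Order.TTheory GRing.Theory Num.Theory.

Local Open Scope ring_scope.

(** * Circuits of linear spaces *)

(** The edges of the two graphs need not correspond one to one: no flow sees a bridge, and an edge
    of one graph may match several of the other. The linear part therefore treats spaces of
    functions on an arbitrary finite set, given by predicates, so that both flow spaces can be
    pulled back to the set of matched pairs of edges. Uniqueness of signs rests on thetas. On the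
    common part of two circuits of a theta their ratio is constant, as otherwise eliminating a
    common coordinate would give a circuit with one entry twice as large as another. In the quotient
    of OP the obstacle is that only two of the three cycles of a theta conform to a given sign
    vector. However, a circuit is equivalent to its opposite, and reversing one cycle of the theta
    gives an equivalent sign vector to which the third cycle conforms. So one class lies above all
    three cycles, and the order alone records that the support of each is covered by those of the
    other two. *)

Lemma min_measure (T : Type) (Q : T -> Prop) (m : T -> nat) :
  (exists x, Q x) -> exists x, Q x /\ forall y, Q y -> (m x <= m y)%N.
Proof.
move=> [x0 Qx0].
have ex : exists n, (fun n => `[< exists x, Q x /\ m x = n >]) n.
  by exists (m x0); apply/asboolP; exists x0.
case: (ex_minnP ex) => n /asboolP[x [Qx <-]] nmin.
exists x; split=> // y Qy; apply: nmin; apply/asboolP; by exists y.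
Qed.

Section Elementary.
Variables (F : realFieldType) (I : finType).
Implicit Types (P Q : (I -> F) -> Prop) (x y z c d : I -> F).

Definition subspace P :=
  P (fun=> 0) /\
  forall a b x y, P x -> P y -> P (fun i => a * x i + b * y i).

Lemma subspace_lin P a b x y z : subspace P -> P x -> P y ->
  (forall i, z i = a * x i + b * y i) -> P z.
Proof. by move=> [_ clP] Px Py /funext ->; apply: clP. Qed.

Lemma subspace_scale P t x y : subspace P -> P x ->
  (forall i, y i = t * x i) -> P y.
Proof.
by move=> sP Px yx; apply: (subspace_lin (a := t) (b := 0) sP Px Px) => i;
  rewrite yx mul0r addr0.
Qed.

Lemma subspace_sub P t x y z : subspace P -> P x -> P y ->
  (forall i, z i = x i - t * y i) -> P z.
Proof.
by move=> sP Px Py zE; apply: (subspace_lin (a := 1) (b := - t) sP Px Py) => i;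
  rewrite zE mul1r mulNr.
Qed.

Lemma subspace_vanish P (Z : I -> Prop) : subspace P ->
  subspace (fun y => P y /\ forall i, Z i -> y i = 0).
Proof.
move=> [P0 Plin]; split=> [|a b y z [Py yZ] [Pz zZ]]; first by split.
by split=> [|i iZ]; [exact: Plin | rewrite yZ // zZ // !mulr0 addr0].
Qed.

Lemma subspace_vanish1 P e : subspace P -> subspace (fun y => P y /\ y e = 0).
Proof.
move=> [P0 Plin]; split=> [|a b y z [Py ye] [Pz ze]]; first by split.
by split; [exact: Plin | rewrite ye ze !mulr0 addr0].
Qed.

(** Elementary vectors in the sense of Rockafellar. Minimality of the support is stated as
    proportionality, the form in which it is used; for flows these are the nonzero multiples of
    cycles. *)
Definition elem P c :=
  [/\ P c, exists i, c i != 0 &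
      forall y, P y -> (forall i, c i = 0 -> y i = 0) ->
      exists t, forall i, y i = t * c i].

(** With [c] zero this is the support of [d]; in general it is the support of [d] after contraction
    of that of [c]. Its size serves as induction measure. *)
Definition off c d : {set I} := [set i | (c i == 0) && (d i != 0)].

Lemma off_lt c x y j : (forall i, c i = 0 -> y i = 0 -> x i = 0) ->
  c j = 0 -> x j = 0 -> y j != 0 -> (#|off c x| < #|off c y|)%N.
Proof.
move=> sub cj xj yj; apply: proper_card; apply/properP; split.
  apply/subsetP => i; rewrite !inE => /andP[ci]; rewrite ci /=.
  by apply: contraNneq => yi; rewrite sub //; apply/eqP.
by exists j; rewrite !inE ?cj ?xj ?eqxx ?yj.
Qed.

(** It suffices to minimize the support among the vectors that are nonzero at [h]: the corrections
    [z] vanish at [h], so subtracting them never leaves this family. *)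
Lemma elem_exists P x h : subspace P -> P x -> x h != 0 ->
  exists c, [/\ elem P c, forall i, x i = 0 -> c i = 0 & c h != 0].
Proof.
move=> sP Px xh.
have [] := @min_measure _
  (fun c => [/\ P c, forall i, x i = 0 -> c i = 0 & c h != 0])
  (fun c => #|off (fun=> 0) c|); first by exists x.
move=> c [[Pc cx ch] cmin]; exists c; split=> //; split=> //; first by exists h.
move=> y Py yc; exists (y h / c h) => i.
apply/eqP; rewrite -subr_eq0; apply/negPn/negP => zi.
pose z j := y j - y h / c h * c j.
pose w j := c j - c i / z i * z j.
have ci : c i != 0 by apply: contraNneq zi => ci; rewrite ci yc // mulr0 subr0.
have zh : z h = 0 by rewrite /z; field.
have : (#|off (fun=> 0%R) c| <= #|off (fun=> 0%R) w|)%N.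
  apply: cmin; split.
  - apply: (@subspace_sub P (c i / z i) c z) => //.
    exact: (@subspace_sub P (y h / c h) y c).
  - by move=> j xj; rewrite /w /z (yc j) ?(cx j) // !mulr0 subr0 mulr0 subr0.
  - by rewrite /w zh mulr0 subr0.
rewrite leqNgt (off_lt (j := i)) //.
  by move=> j _ cj; rewrite /w /z (yc j) ?cj // !mulr0 subr0 mulr0 subr0.
by rewrite /w divfK ?subrr.
Qed.

(* For circuits of a graph: their union is a theta graph, or they are disjoint
   cycles whose union contains no other cycle. *)
Definition spans P c d := forall y, P y ->
  (forall i, c i = 0 -> d i = 0 -> y i = 0) ->
  exists a b, forall i, y i = a * c i + b * d i.

(** [d1] minimizes the support outside [c], so it becomes a circuit once the support of [c] is
    contracted. The value 0 at [e] removes the freedom of adding multiples of [c]: a vector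
    vanishing at [e] with support inside that of [c] is zero, because [c] is elementary. *)
Lemma spans_exists P c e d h : subspace P -> elem P c -> c e != 0 ->
    P d -> d e = 0 -> d h != 0 ->
  exists d1, [/\ P d1, d1 e = 0, d1 h != 0,
     forall i, c i = 0 -> d i = 0 -> d1 i = 0 &
     spans P c d1 /\ exists2 g, c g = 0 & d1 g != 0].
Proof.
move=> sP [Pc _ elc] ce Pd de dh.
have [] := @min_measure _
  (fun d1 => [/\ P d1, d1 e = 0, d1 h != 0 &
     forall i, c i = 0 -> d i = 0 -> d1 i = 0])
  (fun d1 => #|off c d1|); first by exists d.
move=> d1 [[Pd1 d1e d1h d1c] d1min]; exists d1; split=> //.
have outside z k : P z -> z e = 0 -> z k != 0 -> exists2 g, c g = 0 & z g != 0.
  move=> Pz ze zk; apply: contrapT => no.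
  have [|t zt] := elc z Pz.
    move=> i ci; apply/eqP; apply: contrapT => zi; apply: no.
    by exists i => //; apply/negP.
  have /eqP := zt e; rewrite ze eq_sym mulf_eq0 (negPf ce) orbF => /eqP t0.
  by move: zk; rewrite zt t0 mul0r eqxx.
(* Were [z] nonzero at [h], it would beat [d1] in the minimization, having lost [g]; otherwise
   subtracting a multiple of [z] from [d1] would. *)
have zero z g : P z -> z e = 0 -> (forall i, c i = 0 -> d1 i = 0 -> z i = 0) ->
    c g = 0 -> d1 g != 0 -> z g = 0 -> forall i, z i = 0.
  move=> Pz ze zc cg d1g zg i; apply/eqP; apply/negPn/negP => zi.
  have zh : z h = 0.
    apply/eqP; apply/negPn/negP => zh.
    have : (#|off c d1| <= #|off c z|)%N.
      by apply: d1min; split=> // j cj dj; apply: zc => //; apply: d1c.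
    by rewrite leqNgt (off_lt (j := g)).
  have [k ck zk] := outside z i Pz ze zi.
  pose w j := d1 j - d1 k / z k * z j.
  have : (#|off c d1| <= #|off c w|)%N.
    apply: d1min; split.
    - exact: (@subspace_sub P (d1 k / z k) d1 z).
    - by rewrite /w d1e ze mulr0 subr0.
    - by rewrite /w zh mulr0 subr0.
    - by move=> j cj dj; rewrite /w (d1c j) // (zc j) ?(d1c j) // mulr0 subr0.
  rewrite leqNgt (off_lt (j := k)) //.
  + by move=> j cj dj; rewrite /w dj (zc j) // mulr0 subr0.
  + by rewrite /w divfK ?subrr.
  + by apply: contraNneq zk => dk; rewrite zc.
have [g cg d1g] := outside d1 h Pd1 d1e d1h; split; last by exists g.
move=> y Py yc.
pose b := y g / d1 g; pose a := y e / c e.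
exists a, b => i.
have := zero (fun j => y j - (a * c j + b * d1 j)) g.
move=> /(_ _ _ _ cg d1g _ i) H; apply/eqP; rewrite -subr_eq0; apply/eqP.
apply: H.
- apply: (@subspace_lin P 1 (-1) y (fun j => a * c j + b * d1 j)) => //.
    exact: sP.2.
  by move=> j; ring.
- by rewrite d1e /a; field.
- by move=> j cj dj; rewrite yc // cj dj !mulr0 addr0 subr0.
- by rewrite cg /b; field.
Qed.

Lemma spans_elem_r P c d e h : P d -> spans P c d -> c e != 0 -> d e = 0 ->
  d h != 0 -> elem P d.
Proof.
move=> Pd sp ce de dh; split=> //; first by exists h.
move=> y Py yd; have [i _ di|a [b yab]] := sp y Py; first exact: yd.
exists b => i; have /eqP := yab e.
rewrite de yd // mulr0 addr0 eq_sym mulf_eq0 (negPf ce) orbF => /eqP a0.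
by rewrite yab a0 mul0r add0r.
Qed.

(** The third cycle of a theta. A vector supported there is a combination of [c] and [d], and its
    vanishing at [f] leaves only one ratio of the coefficients. *)
Lemma spans_elem_sub P c d e f : subspace P -> P c -> P d -> spans P c d ->
  c e != 0 -> d e = 0 -> d f != 0 -> elem P (fun i => c i - c f / d f * d i).
Proof.
move=> sP Pc Pd sp ce de df; split.
- exact: (@subspace_sub P (c f / d f) c d).
- by exists e; rewrite de mulr0 subr0.
move=> y Py yu; have [i ci di|a [b yab]] := sp y Py.
  by apply: yu; rewrite ci di mulr0 subr0.
exists a => i; rewrite yab.
have yf : a * c f + b * d f = 0 by rewrite -yab yu // divfK ?subrr.
have -> : b = - (a * c f / d f).
  apply: (mulIf df); rewrite mulNr divfK //; apply/eqP.
  by rewrite -addr_eq0 addrC yf.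
ring.
Qed.

Lemma elem_decomp P x : subspace P -> P x -> (exists i, x i != 0) ->
  exists d t y, [/\ elem P d, P y, forall i, x i = t * d i + y i,
    forall i, x i = 0 -> d i = 0 /\ y i = 0 &
    (#|off (fun=> 0%R) y| < #|off (fun=> 0%R) x|)%N].
Proof.
move=> sP Px [h xh]; have [d [eld dx dh]] := elem_exists sP Px xh.
have [Pd _ _] := eld.
exists d, (x h / d h), (fun i => x i - x h / d h * d i); split=> //.
- exact: (@subspace_sub P (x h / d h) x d).
- by move=> i; ring.
- by move=> i xi; rewrite xi (dx i) // mulr0 subr0.
apply: (off_lt (j := h)) => //.
  by move=> i _ xi; rewrite xi (dx i) // mulr0 subr0.
by rewrite divfK ?subrr.
Qed.

(* Over the reals, these are the spaces spanned by the circuits of a regular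
   matroid: up to scaling, each circuit has coordinates in {0, 1, -1}. *)
Definition regular P := forall c, elem P c ->
  forall i j, c i != 0 -> c j != 0 -> c j = c i \/ c j = - c i.

(** Otherwise the circuit [u], which agrees with [c] at [e], has at [f2] a nonzero difference of two
    numbers of absolute value [|c e|], hence an entry of twice that size, against regularity. *)
Lemma regular_ratio P c d e f1 f2 : subspace P -> regular P -> elem P c ->
    P d -> spans P c d -> c e != 0 -> d e = 0 ->
    c f1 != 0 -> d f1 != 0 -> c f2 != 0 -> d f2 != 0 ->
  c f2 * d f1 = c f1 * d f2.
Proof.
move=> sP rP elc Pd sp ce de c1 d1 c2 d2; have [Pc _ _] := elc.
have eld := spans_elem_r Pd sp ce de d1.
have elu := spans_elem_sub sP Pc Pd sp ce de d1.
set u := (fun i => _) in elu.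
have ue : u e = c e by rewrite /u de mulr0 subr0.
have u2 : u f2 * d f1 = c f2 * d f1 - c f1 * d f2 by rewrite /u; field.
have [u0|un0] := eqVneq (u f2) 0.
  by apply/eqP; rewrite -subr_eq0 -u2 u0 mul0r.
exfalso; have /eqP := mulf_neq0 c1 d1; apply.
have := rP _ elu e f2; rewrite ue => /(_ ce un0).
have := rP c elc f1 f2 c1 c2; have := rP c elc f1 e c1 ce.
have := rP d eld f1 f2 d1 d2; move: u2.
by move=> u2 [] E1 [] E2 [] E3 [] E4; move: u2; rewrite E4 E1 E2 E3; lra.
Qed.

End Elementary.

(** * Uniqueness of the signs of a regular space *)

Section CommonElem.
Variables (F : realFieldType) (I : finType).
Implicit Types (P Q : (I -> F) -> Prop) (x y z c d : I -> F).

(** Lying on a common circuit is transitive. If [d1], obtained from [d] by avoiding [n], meets [c],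
    elimination at a common coordinate gives the circuit; if not, [d1] is a multiple of [d], which
    is impossible at [g]. *)
Lemma elem_connected P c d n g h : subspace P -> elem P c -> elem P d ->
    c n != 0 -> c g != 0 -> d g != 0 -> d h != 0 ->
  exists u, [/\ elem P u, u n != 0 & u h != 0].
Proof.
move=> sP elc eld cn cg dg dh.
have [ch|ch] := eqVneq (c h) 0; last by exists c.
have [dn|dn] := eqVneq (d n) 0; last by exists d.
have [Pc _ _] := elc; have [Pd _ eld'] := eld.
have [d1 [Pd1 d1n d1h d1c [sp _]]] := spans_exists sP elc cn Pd dn dh.
have [[f cf d1f]|no] := pselect (exists2 f, c f != 0 & d1 f != 0).
  exists (fun i => c i - c f / d1 f * d1 i); split.
  - exact: spans_elem_sub sp cn d1n d1f.
  - by rewrite d1n mulr0 subr0.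
  - by rewrite ch sub0r oppr_eq0 !mulf_neq0 ?invr_eq0.
exfalso; have d1_off i : c i != 0 -> d1 i = 0.
  by move=> ci; apply/eqP/negPn/negP => d1i; apply: no; exists i.
have [|t td] := eld' d1 Pd1.
  by move=> i di; have [ci|ci] := eqVneq (c i) 0; [apply: d1c|apply: d1_off].
have /eqP := td g; rewrite d1_off // eq_sym mulf_eq0 (negPf dg) orbF => /eqP t0.
by move: d1h; rewrite td t0 mul0r eqxx.
Qed.

Definition same_supports P Q := forall x, P x ->
  exists2 y, Q y & forall i, (y i == 0) = (x i == 0).

(** Passing from [P] to [Q] and back cannot shrink a minimal support, so there are circuits of both
    with one support; after rescaling at [e], regularity leaves only signs undetermined. *)
Lemma elem_signs P Q e : subspace P -> subspace Q -> regular P -> regular Q ->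
    same_supports P Q -> same_supports Q P -> (exists2 x, P x & x e != 0) ->
  exists c c', [/\ elem P c, elem Q c', c e != 0, c' e = c e &
    forall i, c' i = c i \/ c' i = - c i].
Proof.
move=> sP sQ rP rQ PQ QP [x Px xe].
have [c [elc _ ce]] := elem_exists sP Px xe; have [Pc _ elc'] := elc.
have [y Qy yc] := PQ c Pc.
have [|c1 [elc1 c1y c1e]] := elem_exists (h := e) sQ Qy; first by rewrite yc.
have [Qc1 _ elc1'] := elc1.
have [z Pz zc1] := QP c1 Qc1.
have [t zt] : exists t, forall i, z i = t * c i.
  apply: elc' => // i ci; apply/eqP; rewrite zc1; apply/eqP; apply: c1y.
  by apply/eqP; rewrite yc ci.
have t0 : t != 0.
  by apply: contraNneq c1e => t0; rewrite -zc1 zt t0 mul0r.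
have supp i : (c1 i == 0) = (c i == 0) by rewrite -zc1 zt mulf_eq0 (negPf t0).
pose s := c e / c1 e.
have sn : s != 0 by rewrite mulf_neq0 ?invr_eq0.
have se : s * c1 e = c e by rewrite divfK.
have elsc1 : elem Q (fun i => s * c1 i).
  split.
  - exact: (subspace_scale (t := s) sQ Qc1).
  - by exists e; rewrite se.
  move=> y' Qy' y'c.
  have [|t' yt'] := elc1' y' Qy'; first by move=> i ci; apply: y'c; rewrite ci mulr0.
  by exists (t' / s) => i; rewrite yt' mulrA divfK.
exists c, (fun i => s * c1 i); split=> //.
move=> i; have [ci|ci] := eqVneq (c i) 0.
  by left; rewrite ci; apply/eqP; rewrite mulf_eq0 supp ci eqxx orbT.
have := rP c elc e i ce ci; have := rQ c1 elc1 e i c1e; rewrite supp => /(_ ci).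
by move=> [] -> [] ->; rewrite ?mulrN se ?opprK; auto.
Qed.

(** Peels off from [d] one piece [d1] at a time, each forming a theta with [c] or disjoint from it.
    [dm] receives the pieces that meet the set where [c] and [c'] are opposite, [dp] all others. *)
Lemma off_split P Q c c' e d : subspace P -> subspace Q -> regular P ->
    regular Q -> elem P c -> elem Q c' -> c e != 0 -> c' e = c e ->
    (forall i, c' i = c i \/ c' i = - c i) ->
    (forall x, x e = 0 -> P x <-> Q x) -> P d -> d e = 0 ->
  exists dp dm, [/\ P dp /\ P dm, dp e = 0 /\ dm e = 0,
    forall i, d i = dp i + dm i,
    forall i, (c' i != c i -> dp i = 0) /\ (c' i = c i -> c i != 0 -> dm i = 0) &
    forall i, c i = 0 -> d i = 0 -> dp i = 0 /\ dm i = 0].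
Proof.
move=> sP sQ rP rQ elc elc' ce c'e c'c PQ.
have [Pc _ _] := elc; have [Qc' _ _] := elc'.
have c'0 i : (c' i == 0) = (c i == 0) by case: (c'c i) => ->; rewrite ?oppr_eq0.
have [n] := ubnP #|off c d|; elim: n d => // n IHn d /ltnSE led Pd de.
have [[h dh]|d0] := pselect (exists h, d h != 0); last first.
  have {}d0 i : d i = 0 by apply/eqP/negPn/negP => di; apply: d0; exists i.
  exists (fun=> 0), (fun=> 0); have [P0 _] := sP; split=> //.
  by move=> i; rewrite d0 addr0.
have [d1 [Pd1 d1e d1h d1c [sp [g cg d1g]]]] := spans_exists sP elc ce Pd de dh.
have Qd1 : Q d1 by rewrite -PQ.
(* Subtracting a multiple of [c'] makes a vector of [Q] vanish at [e], hence puts it in [P]; this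
   carries the spanning property to [Q], with [c'] in the place of [c]. *)
have sp' : spans Q c' d1.
  move=> y Qy yc; pose b := y e / c e.
  have [_ Py'] : P (fun i => y i - b * c' i) <-> Q (fun i => y i - b * c' i).
    by apply: PQ; rewrite c'e /b; field.
  have [||a [k yak]] := sp _ (Py' _).
  - exact: (@subspace_sub _ _ Q b y c').
  - move=> i ci d1i; rewrite yc //; last by apply/eqP; rewrite c'0 ci.
    by have /eqP -> : c' i == 0; rewrite ?c'0 ?ci ?mulr0 ?subr0.
  exists b, k => i; have /eqP := yak e; rewrite d1e mulr0 addr0 c'e.
  rewrite {1}/b divfK // subrr eq_sym mulf_eq0 (negPf ce) orbF => /eqP a0.
  by have := yak i; rewrite a0 mul0r add0r => <-; ring.
(* The ratio to [d1] is constant on the overlap both for [c] and for [c'], so [c'] cannot agree with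
   [c] at one point of it and be opposite at another. *)
have ratio f1 f2 : c f1 != 0 -> d1 f1 != 0 -> c f2 != 0 -> d1 f2 != 0 ->
    c' f1 != c f1 -> c' f2 = c f2 -> False.
  move=> c1 d11 c2 d12 n1 p2.
  have E1 := regular_ratio sP rP elc Pd1 sp ce d1e c1 d11 c2 d12.
  have := regular_ratio (e := e) (f1 := f1) (f2 := f2) sQ rQ elc' Qd1 sp'.
  rewrite !c'0 => /(_ ce d1e c1 d11 c2 d12).
  case: (c'c f1) n1 => ->; first by rewrite eqxx.
  rewrite p2 E1 => _ E2; have /eqP := mulf_neq0 c1 d12; apply; lra.
have dg : d g != 0 by apply: contraNneq d1g => dg; rewrite d1c.
pose t := d g / d1 g.
have [|||dp [dm [[Pp Pm] [pe me] dE sep pm0]]] := IHn (fun i => d i - t * d1 i).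
- apply: leq_trans led; apply: (off_lt (j := g)) => //.
    by move=> i ci di; rewrite di (d1c i) // mulr0 subr0.
  by rewrite /t divfK ?subrr.
- exact: (@subspace_sub _ _ P t d d1).
- by rewrite de d1e mulr0 subr0.
have pm00 i : c i = 0 -> d i = 0 -> [/\ dp i = 0, dm i = 0 & d1 i = 0].
  move=> ci di; have d1i := d1c i ci di.
  by have [|-> ->] := pm0 i ci; rewrite ?di ?d1i ?mulr0 ?subr0.
have [[f [cf d1f c'f]]|no] :=
    pselect (exists f, [/\ c f != 0, d1 f != 0 & c' f != c f]).
  exists dp, (fun i => dm i + t * d1 i); split=> //.
  - split=> //; apply: (@subspace_lin _ _ P 1 t dm d1) => // i; ring.
  - by rewrite me d1e mulr0 addr0.
  - by move=> i; rewrite addrA -dE subrK.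
  - move=> i; split=> [|pi ci]; first exact: (sep i).1.
    rewrite (sep i).2 // add0r.
    have [->|d1i] := eqVneq (d1 i) 0; first by rewrite mulr0.
    by case: (ratio f i).
  - by move=> i ci di; have [-> -> ->] := pm00 i ci di; rewrite mulr0 addr0.
exists (fun i => dp i + t * d1 i), dm; split=> //.
- split=> //; apply: (@subspace_lin _ _ P 1 t dp d1) => // i; ring.
- by rewrite pe d1e mulr0 addr0.
- by move=> i; rewrite addrAC -dE subrK.
- move=> i; split=> [ni|]; last exact: (sep i).2.
  rewrite (sep i).1 // add0r.
  have [->|d1i] := eqVneq (d1 i) 0; first by rewrite mulr0.
  case: no; exists i; split=> //; apply: contraNneq ni => ci.
  by rewrite ci; apply/eqP/eqP; rewrite c'0 ci.
- by move=> i ci di; have [-> -> ->] := pm00 i ci di; rewrite mulr0 addr0.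
Qed.

(* Let [c] in [P] and [c'] in [Q] be circuits through [e] with the same support and
   the same value at [e].  A circuit avoiding [e] cannot meet both the set where
   [c] and [c'] agree and the one where they are opposite, so the signs can be
   changed on the connected components, without [e], which meet the latter. *)
Lemma signing_step P Q e : subspace P -> subspace Q -> regular P -> regular Q ->
    same_supports P Q -> same_supports Q P ->
    (forall x, x e = 0 -> P x <-> Q x) ->
  exists2 s : I -> F, forall i, s i = 1 \/ s i = -1 &
    forall x, P x <-> Q (fun i => s i * x i).
Proof.
move=> sP sQ rP rQ SPQ SQP PQ.
have [exe|noe] := pselect (exists2 x, P x & x e != 0); last first.
  exists (fun=> 1) => [i|x]; first by left.
  have -> : (fun i => 1 * x i) = x by apply: funext => i; rewrite mul1r.
  have [xe|xe] := eqVneq (x e) 0; first exact: PQ.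
  split=> [Px|Qx]; first by case: noe; exists x.
  have [y Py yx] := SQP x Qx; by case: noe; exists y; rewrite ?yx.
have [c [c' [elc elc' ce c'e c'c]]] := elem_signs sP sQ rP rQ SPQ SQP exe.
have [Pc _ _] := elc; have [Qc' _ _] := elc'.
have split_ex := off_split sP sQ rP rQ elc elc' ce c'e c'c PQ.
pose W x := P x /\ x e = 0.
have sW : subspace W by exact: subspace_vanish1.
(* The part [dp] of an elementary [d] is a multiple of [d]; vanishing at [f1] it is zero, so [d] is
   [dm], which vanishes at [f2]. *)
have one_side d f1 f2 : elem W d -> d f1 != 0 -> d f2 != 0 ->
    c' f1 != c f1 -> c' f2 = c f2 -> c f2 != 0 -> False.
  move=> [[Pd de] _ eld] d1 d2 n1 p2 c2.
  have [dp [dm [[Pp Pm] [pe me] dE sep pm0]]] := split_ex d Pd de.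
  have [||t dpt] := eld dp; first by split.
    move=> i di; have [p|n] := eqVneq (c' i) (c i); last exact: (sep i).1.
    have [c0|ci] := eqVneq (c i) 0; first exact: (pm0 i c0 di).1.
    by have := dE i; rewrite di ((sep i).2 p ci) addr0.
  have /eqP := dpt f1; rewrite (sep f1).1 // eq_sym mulf_eq0 (negPf d1) orbF.
  move=> /eqP t0; have := dE f2.
  by rewrite dpt t0 mul0r add0r (sep f2).2 // => /eqP; rewrite (negPf d2).
pose neg g := c' g <> c g \/
  exists d f, [/\ elem W d, d g != 0, d f != 0 & c' f != c f].
pose s g : F := if `[< neg g >] then -1 else 1.
have s_sign i : s i = 1 \/ s i = -1 by rewrite /s; case: asboolP; auto.
have s_elem d : elem W d -> exists2 t, t = 1 \/ t = -1 &
    forall i, s i * d i = t * d i.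
  move=> eld.
  have [[g [dg ng]]|no] := pselect (exists g, d g != 0 /\ neg g); last first.
    exists 1; first by left.
    move=> i; rewrite /s; case: asboolP => // ni.
    have [->|di] := eqVneq (d i) 0; first by rewrite !mulr0.
    by case: no; exists i.
  have [d1 [f [el1 d1g d1f c'f]]] :
      exists d1 f, [/\ elem W d1, d1 g != 0, d1 f != 0 & c' f != c f].
    by case: ng => // /eqP ng; exists d, g.
  exists (-1); first by right.
  move=> i; have [->|di] := eqVneq (d i) 0; first by rewrite !mulr0.
  have [u [elu uf ui]] := elem_connected sW el1 eld d1f d1g dg di.
  by rewrite /s; case: asboolP => // ni; case: ni; right; exists u, f.
have sc i : s i * c i = c' i.
  rewrite /s; case: asboolP => [[ni|[d [f [eld di df c'f]]]]|pi].
  - by case: (c'c i) => // ->; rewrite mulN1r.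
  - have [c0|ci] := eqVneq (c i) 0.
      by rewrite c0 mulr0; case: (c'c i) => ->; rewrite c0 ?oppr0.
    have [p|/negPf n] := eqVneq (c' i) (c i); first by case: (one_side d f i).
    by case: (c'c i) => [/eqP|->]; rewrite ?n ?mulN1r.
  - have [p|/eqP n] := eqVneq (c' i) (c i); first by rewrite mul1r p.
    by case: pi; left.
have sW_ x : W x -> W (fun i => s i * x i).
  have [n] := ubnP #|off (fun=> 0%R) x|; elim: n x => // n IHn x /ltnSE lex Wx.
  have [x0|no] := pselect (exists i, x i != 0); last first.
    have -> : (fun i => s i * x i) = fun=> 0; last exact: sW.1.
    apply: funext => i; have [->|xi] := eqVneq (x i) 0; first by rewrite mulr0.
    by case: no; exists i.
  have [d [t [y [eld Wy xE _ lt]]]] := elem_decomp sW Wx x0.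
  have [t' _ sd] := s_elem d eld; have [Wd _ _] := eld.
  apply: (@subspace_lin _ _ W (t * t') 1 d (fun i => s i * y i)) => //.
    by apply: IHn => //; apply: leq_trans lt lex.
  by move=> i; rewrite xE mulrDr mulrCA sd; ring.
have ss i : s i * s i = 1 by case: (s_sign i) => ->; rewrite ?mulr1 ?mulrNN ?mulr1.
exists s => // x; split=> [Px|Qx].
  pose a := x e / c e.
  have [Pw we] : W (fun i => s i * (x i - a * c i)).
    apply: sW_; split; last by rewrite divfK ?subrr.
    exact: (@subspace_sub _ _ P a x c).
  apply: (@subspace_lin _ _ Q a 1 c' (fun i => s i * (x i - a * c i))) => //.
    by apply/PQ.
  by move=> i; rewrite -sc; ring.
pose a := s e * x e / c e.
have Ww : W (fun i => s i * x i - a * c' i).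
  have we : s e * x e - a * c' e = 0 by rewrite c'e divfK ?subrr.
  split=> //; apply/PQ => //.
  exact: (@subspace_sub _ _ Q a (fun i => s i * x i) c').
have [Pw _] := sW_ _ Ww.
apply: (subspace_lin (a := a) (b := 1) sP Pc Pw) => i.
rewrite mul1r mulrBr mulrA ss mul1r.
suff -> : s i * (a * c' i) = a * c i by ring.
by rewrite -sc mulrCA (mulrA (s i)) ss mul1r.
Qed.

(** Unique representability of regular matroids, up to signs. Induction on the coordinates where
    vectors may be nonzero: after twisting [Q] by the signs found so far, both spaces agree on the
    vectors vanishing at the new coordinate [e], as [signing_step] requires. *)
Theorem signing_unique P Q : subspace P -> subspace Q -> regular P ->
    regular Q -> same_supports P Q -> same_supports Q P ->
  exists2 s : I -> F, forall i, s i = 1 \/ s i = -1 &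
    forall x, P x <-> Q (fun i => s i * x i).
Proof.
move=> sP sQ rP rQ SPQ SQP.
suff [s s1 sE] : exists2 s : I -> F, forall i, s i = 1 \/ s i = -1 &
    forall x, (forall i, i \notin enum I -> x i = 0) ->
    P x <-> Q (fun i => s i * x i).
  by exists s => // x; apply: sE => i; rewrite mem_enum inE.
elim: (enum I) => [|e l [s s1 IH]].
  exists (fun=> 1) => [i|x x0]; first by left.
  have -> : x = (fun=> 0) by apply: funext => i; apply: x0.
  by rewrite (funext (fun i => mulr0 1)); split=> _; [exact: sQ.1|exact: sP.1].
have ss i : s i * s i = 1 by case: (s1 i) => ->; rewrite ?mulrNN mulr1.
have s0 i : s i != 0 by case: (s1 i) => ->; rewrite ?oppr_eq0 oner_eq0.
pose on x := forall i, i \notin e :: l -> x i = 0.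
have sub_on R : subspace R -> subspace (fun x => R x /\ on x).
  exact: subspace_vanish.
have reg_on R : subspace R -> regular R -> regular (fun x => R x /\ on x).
  move=> sR rR c [[Rc oc] cn elc]; apply: rR; split=> // y Ry yc.
  by apply: elc => //; split=> // i il; apply: yc; apply: oc.
pose Qs x := Q (fun i => s i * x i).
have sQs : subspace Qs.
  split; first by rewrite /Qs (funext (fun i => mulr0 (s i))); exact: sQ.1.
  by move=> a b x y Qx Qy; apply: (subspace_lin (a := a) (b := b) sQ Qx Qy) => i; ring.
have Qss x : Q x -> Qs (fun i => s i * x i).
  by rewrite /Qs => Qx; rewrite (_ : (fun i => _) = x) //; apply: funext => i;
    rewrite mulrA ss mul1r.
have rQs : regular Qs.
  move=> c [Qc [k ck] elc] i j ci cj.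
  have el : elem Q (fun i => s i * c i).
    split=> //; first by exists k; rewrite mulf_neq0.
    move=> y Qy yc; have [||t yt] := elc (fun i => s i * y i); first exact: Qss.
      by move=> m cm; rewrite (yc m) ?cm mulr0.
    by exists t => m; rewrite mulrCA -yt mulrA ss mul1r.
  have := rQ _ el i j; rewrite !mulf_neq0 // => /(_ isT isT).
  by case: (s1 i) (s1 j) => -> [] ->; rewrite ?mulN1r ?mul1r => -[] E;
    have := E; rewrite ?opprK => E'; try (by left; lra); right; lra.
have [|||||||s2 s21 s2E] := @signing_step (fun x => P x /\ on x)
  (fun x => Qs x /\ on x) e; [exact: sub_on|exact: sub_on|exact: reg_on|exact: reg_on| | | |].
- move=> x [Px ox]; have [y Qy yx] := SPQ x Px.
  exists (fun i => s i * y i).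
    split; first exact: Qss.
    by move=> i il; have /eqP -> : y i == 0; rewrite ?mulr0 // yx ox.
  by move=> i; rewrite mulf_eq0 (negPf (s0 i)) yx.
- move=> x [Qx ox]; have [y Py yx] := SQP _ Qx.
  exists y; last by move=> i; rewrite yx mulf_eq0 (negPf (s0 i)).
  by split=> // i il; apply/eqP; rewrite yx ox ?mulr0.
- move=> x xe; split=> -[Rx ox]; split=> //; [apply/IH|apply/IH] => // i il.
    have [->//|ie] := eqVneq i e; apply: ox; by rewrite inE negb_or ie.
  have [->//|ie] := eqVneq i e; apply: ox; by rewrite inE negb_or ie.
exists (fun i => s i * s2 i).
  by move=> i; case: (s1 i) (s21 i) => -> [] ->; rewrite ?mulrNN ?mul1r ?mulr1; auto.
move=> x ox; have [PQs QsP] := s2E x.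
have E : (fun i => s i * (s2 i * x i)) = (fun i => s i * s2 i * x i).
  by apply: funext => i; rewrite mulrA.
rewrite -E; split=> [Px|Qx]; first by have [] := PQs (conj Px ox).
have [] // := QsP _; split=> // i il; by rewrite ox ?mulr0.
Qed.

End CommonElem.

(** * Sign vectors and faces *)

Section Signs.
Variables (F : realFieldType) (I : finType).
Implicit Types (P Q : (I -> F) -> Prop) (x y z c d w : I -> F).

Lemma small_scale x y :
  exists2 t, 0 < t & forall i, x i != 0 -> t * `|y i| < `|x i|.
Proof.
suff [t t0 tP] : exists2 t, 0 < t & forall i, i \in enum I -> x i != 0 ->
    t * `|y i| < `|x i|.
  by exists t => // i; apply: tP; rewrite mem_enum.
elim: (enum I) => [|j s [t t0 tP]]; first by exists 1; rewrite ?ltr01.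
have [xj|xj] := eqVneq (x j) 0.
  exists t => // i; rewrite inE => /orP[/eqP-> |]; first by rewrite xj eqxx.
  exact: tP.
have xj0 : 0 < `|x j| by rewrite normr_gt0.
have yj0 : 0 < `|y j| + 1 by rewrite ltr_wpDl.
pose t' := Num.min t (`|x j| / (`|y j| + 1)).
have t'0 : 0 < t' by rewrite lt_min t0 divr_gt0.
exists t' => // i; rewrite inE => /orP[/eqP-> _|/tP lt /lt].
  apply: (@lt_le_trans _ _ (t' * (`|y j| + 1))).
    by rewrite ltr_pM2l // ltrDl.
  by rewrite -ler_pdivlMr // ge_min lexx orbT.
by apply: le_lt_trans; rewrite ler_wpM2r // ge_min lexx.
Qed.

Lemma perturb x y : exists2 t, 0 < t &
  forall i, x i != 0 -> Num.sg (x i + t * y i) = Num.sg (x i).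
Proof.
have [t t0 tP] := small_scale x y; exists t => // i xi; have := tP i xi.
rewrite -[X in X * _](gtr0_norm t0) -normrM => lt.
have [x0|x0|/eqP] := ltrgtP (x i) 0; last by rewrite (negPf xi).
  rewrite (ltr0_norm x0) in lt; have := ler_norm (t * y i).
  by move=> le; rewrite !ltr0_sg //; lra.
rewrite (gtr0_norm x0) in lt; have := lerNnormlW (lexx `|t * y i|).
by move=> le; rewrite !gtr0_sg //; lra.
Qed.

(** Composition of covectors of an oriented matroid, realized by adding a small multiple of [y]. *)
Lemma compose P x y : subspace P -> P x -> P y -> exists2 z, P z &
  forall i, Num.sg (z i) = if x i == 0 then Num.sg (y i) else Num.sg (x i).
Proof.
move=> sP Px Py; have [t t0 tP] := perturb x y.
exists (fun i => x i + t * y i).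
  by apply: (subspace_lin (a := 1) (b := t) sP Px Py) => i; rewrite mul1r.
move=> i; have [->|xi] := eqVneq (x i) 0; last exact: tP.
by rewrite add0r sgrM gtr0_sg ?mul1r.
Qed.

Lemma sgr_eqN (a : F) : Num.sg a = - Num.sg a -> a = 0.
Proof. by move=> E; apply/eqP; rewrite -sgr_eq0; apply/eqP; lra. Qed.

Definition conf y x := forall i, y i != 0 -> Num.sg (y i) = Num.sg (x i).

Lemma conf_supp y x i : conf y x -> x i = 0 -> y i = 0.
Proof.
by move=> yx xi; apply/eqP/negPn/negP => yi;
  have /eqP := yx i yi; rewrite xi sgr0 sgr_eq0 (negPf yi).
Qed.

Lemma sgr_supp x y i : Num.sg (x i) = Num.sg (y i) -> (x i == 0) = (y i == 0).
Proof. by move=> xy; rewrite -sgr_eq0 xy sgr_eq0. Qed.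

Lemma conf_mulr_ge0 y x i : conf y x -> 0 <= y i * x i.
Proof.
move=> yx; have [->|yi] := eqVneq (y i) 0; first by rewrite mul0r.
by rewrite -sgr_ge0 sgrM -(yx i yi) -expr2 sqr_ge0.
Qed.

Lemma mulr_ge0_conf y x : (forall i, 0 <= y i * x i) ->
  (forall i, x i = 0 -> y i = 0) -> conf y x.
Proof.
move=> ge0 xy i yi; have xi : x i != 0 by apply: contraNneq yi => /xy ->.
have := ge0 i; have [y0|y0|/eqP] := ltrgtP (y i) 0; last by rewrite (negPf yi).
  by rewrite nmulr_rge0 // le_eqVlt (negPf xi) => x0; rewrite !ltr0_sg.
by rewrite pmulr_rge0 // le_eqVlt eq_sym (negPf xi) => x0; rewrite !gtr0_sg.
Qed.

(** Vectors off every coordinate hyperplane that does not contain [P]; their sign vectors are the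
    topes. *)
Definition full P x := P x /\ forall y i, P y -> x i = 0 -> y i = 0.

Lemma full_exists P : subspace P -> exists x, full P x.
Proof.
move=> sP; have [] := @min_measure _ P (fun x => #|[set i | x i == 0]|).
  by exists (fun=> 0); exact: sP.1.
move=> x [Px xmin]; exists x; split=> // y i Py xi; apply/eqP/negPn/negP => yi.
have [z Pz zE] := compose sP Px Py.
have := xmin z Pz; rewrite leqNgt => /negP; apply; apply: proper_card.
apply/properP; split.
  apply/subsetP => j; rewrite !inE -sgr_eq0 zE.
  by have [//|xj] := eqVneq (x j) 0; rewrite sgr_eq0 (negPf xj).
by exists i; rewrite !inE ?xi ?eqxx // -sgr_eq0 zE xi eqxx sgr_eq0.
Qed.

Lemma fullN P x : subspace P -> full P x -> full P (fun i => - x i).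
Proof.
move=> sP [Px fx]; split; last by move=> y i Py /eqP; rewrite oppr_eq0 => /eqP/fx; apply.
by apply: (subspace_scale (t := -1) sP Px) => i; ring.
Qed.

Lemma compose_full P x y : subspace P -> P x -> full P y -> exists2 z, full P z &
  forall i, Num.sg (z i) = if x i == 0 then Num.sg (y i) else Num.sg (x i).
Proof.
move=> sP Px [Py fy]; have [z Pz zE] := compose sP Px Py; exists z => //.
split=> // u i Pu zi; have := zE i; rewrite zi sgr0.
have [xi|xi] := eqVneq (x i) 0; move=> /esym/eqP; rewrite sgr_eq0.
  by move=> /eqP/fy; apply.
by rewrite (negPf xi).
Qed.

(** Two linear forms with nested kernels are proportional, so the relation is symmetric as soon as
    [j] is not identically zero on [P]; see [zle_sym]. *)
Definition zle P i j := forall y, P y -> y i = 0 -> y j = 0.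

Lemma zleP P i j x : subspace P -> zle P i j -> P x -> x i != 0 ->
  forall y, P y -> y j = x j / x i * y i.
Proof.
move=> sP ij Px xi y Py; apply/eqP; rewrite -subr_eq0; apply/eqP.
have -> : y j - x j / x i * y i = y j - y i / x i * x j by field.
apply: (ij (fun k => y k - y i / x i * x k)); last by rewrite divfK ?subrr.
by apply: (subspace_lin (a := 1) (b := - (y i / x i)) sP Py Px) => k; ring.
Qed.

Lemma zle_sym P i j x : subspace P -> zle P i j -> P x -> x j != 0 -> zle P j i.
Proof.
move=> sP ij Px xj y Py yj.
have xi : x i != 0 by apply: contraNneq xj => xi; rewrite ij.
have /eqP := zleP sP ij Px xi Py; rewrite yj eq_sym !mulf_eq0 invr_eq0.
by rewrite (negPf xi) (negPf xj) => /eqP.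
Qed.

(* [J] indexes an irredundant system of inequalities for the cone of the
   vectors conforming to [x]. *)
Lemma facets P x : subspace P -> full P x -> exists J : {set I}, [/\
    forall y, P y -> (forall i, i \in J -> 0 <= y i * x i) -> conf y x,
    forall s, s \in J -> x s != 0 &
    forall s, s \in J -> exists w, [/\ P w, w s = 0, conf w x &
      forall i, w i = 0 -> zle P s i]].
Proof.
move=> sP [Px fx].
pose good (J : {set I}) := (forall i, i \in J -> x i != 0) /\
  forall y, P y -> (forall i, i \in J -> 0 <= y i * x i) -> conf y x.
have [] := @min_measure _ good (fun J => #|J|).
  exists [set i | x i != 0]; split=> [i|y Py yx]; first by rewrite inE.
  apply: mulr_ge0_conf => [i|i]; last exact: fx.
  have [->|xi] := eqVneq (x i) 0; first by rewrite mulr0.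
  by apply: yx; rewrite inE.
move=> J [[Jx Jge] Jmin]; exists J; split=> // s sJ.
(* By minimality of [J], some vector violates the inequality of [s] and no other. *)
have [y [Py yJ ys]] : exists y, [/\ P y,
    forall i, i \in J :\ s -> 0 <= y i * x i & y s * x s < 0].
  apply: contrapT => no.
  have : (#|J| <= #|J :\ s|)%N.
    apply: Jmin; split=> [i|y Py yJ]; first by rewrite inE => /andP[_ /Jx].
    apply: Jge => // i iJ; have [->|is'] := eqVneq i s; last first.
      by apply: yJ; rewrite inE iJ andbT inE.
    by rewrite leNgt; apply/negP => ys; apply: no; exists y.
  by rewrite [in X in (X <= _)%N](cardsD1 s) sJ ltnn.
have xs := Jx s sJ.
(* The point where the segment from [x] to [y] meets the hyperplane of [s], up to a positive factor
   that avoids a division. *)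
pose w i := (- (y s * x s)) * x i + x s ^+ 2 * y i.
have Pw : P w.
  exact: (subspace_lin (a := - (y s * x s)) (b := x s ^+ 2) sP Px Py).
have ws : w s = 0 by rewrite /w; ring.
have wJ i : i \in J -> i != s -> 0 < w i * x i.
  move=> iJ is'; have := yJ i; rewrite !inE is' iJ => /(_ isT) yi.
  have -> : w i * x i = - (y s * x s) * x i ^+ 2 + x s ^+ 2 * (y i * x i).
    by rewrite /w; ring.
  apply: ltr_pwDl; last by rewrite mulr_ge0 // sqr_ge0.
  by rewrite mulr_gt0 ?oppr_gt0 // exprn_even_gt0 //= Jx.
exists w; split=> //.
  apply: Jge => // i iJ; have [->|is'] := eqVneq i s; first by rewrite ws mul0r.
  exact/ltW/wJ.
move=> i wi z Pz zs; apply/eqP/negPn/negP => zi.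
have xi : x i != 0 by apply: contraNneq zi => xi; rewrite (fx z).
(* If [z] vanishes at [s] but not at [i], then [w] can be moved inside the hyperplane of [s] against
   the sign of [x] at [i], while all inequalities of [J] persist. *)
have [t t0 tP] := perturb w (fun k => - (z i * x i) * z k).
have : conf (fun k => w k + t * (- (z i * x i) * z k)) x.
  apply: Jge => [|k kJ].
    apply: (subspace_lin (a := 1) (b := t * - (z i * x i)) sP Pw Pz) => k.
    by ring.
  have [->|ks] := eqVneq k s; first by rewrite ws zs !mulr0 add0r mul0r.
  have wk := wJ k kJ ks; rewrite -sgr_ge0 sgrM tP -?sgrM ?sgr_ge0 ?ltW //.
  by apply: contraTneq wk => ->; rewrite mul0r ltxx.
move=> cf; have := conf_mulr_ge0 i cf; rewrite wi add0r => ge0.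
suff : t * (- (z i * x i) * z i) * x i < 0 by rewrite ltNge ge0.
have -> : t * (- (z i * x i) * z i) * x i = - (t * (z i * x i) ^+ 2) by ring.
by rewrite oppr_lt0 mulr_gt0 // exprn_even_gt0 //= mulf_neq0.
Qed.

(** A conforming vector [c] of least support is elementary: if [y] is supported in it and [m] is the
    largest ratio [y j / c j], then [m c - y] conforms to [c] and loses the coordinate [j], so it is
    zero. *)
Lemma conf_elem P x : subspace P -> P x -> (exists i, x i != 0) ->
  exists2 c, elem P c & conf c x.
Proof.
move=> sP Px x0.
have [] := @min_measure _
  (fun c => [/\ P c, exists i, c i != 0 & conf c x])
  (fun c => #|off (fun=> 0%R) c|); first by exists x.
move=> c [[Pc [k ck] cx] cmin]; exists c => //; split=> //; first by exists k.
suff pos y j0 : P y -> (forall i, c i = 0 -> y i = 0) -> 0 < y j0 * c j0 ->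
    exists t, forall i, y i = t * c i.
  move=> y Py yc; have [[i yi]|no] := pselect (exists i, y i != 0); last first.
    exists 0 => i; rewrite mul0r; apply/eqP/negPn/negP => yi.
    by apply: no; exists i.
  have ci : c i != 0 by apply: contraNneq yi => /yc ->.
  have := mulf_neq0 yi ci; rewrite neq_lt => /orP[lt|]; last exact: pos.
  have [||| t tE] := pos (fun i => - y i) i.
  - by apply: (subspace_scale (t := -1) sP Py) => j; ring.
  - by move=> j /yc ->; rewrite oppr0.
  - by rewrite mulNr oppr_gt0.
  by exists (- t) => j; rewrite mulNr -tE opprK.
move=> Py yc j0P.
have cj0 : c j0 != 0 by apply: contraTneq j0P => ->; rewrite mulr0 ltxx.
have [j cj jmax] := @arg_maxP _ F I j0 (fun i => c i != 0) (fun i => y i / c i) cj0.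
have sgdiv i : c i != 0 -> y i / c i = y i * c i / c i ^+ 2 by move=> ci; field.
have m0 : 0 < y j / c j.
  apply: lt_le_trans (jmax j0 cj0).
  by rewrite sgdiv // divr_gt0 // exprn_even_gt0.
pose m := y j / c j.
pose z i := m * c i - y i.
have Pz : P z.
  by apply: (subspace_lin (a := m) (b := -1) sP Pc Py) => i; rewrite /z; ring.
have zc : conf z c.
  apply: mulr_ge0_conf => [i|i ci]; last by rewrite /z ci yc // mulr0 subr0.
  have [->|ci] := eqVneq (c i) 0; first by rewrite mulr0.
  have -> : z i * c i = (m - y i / c i) * c i ^+ 2 by rewrite /z; field.
  by rewrite mulr_ge0 ?sqr_ge0 // subr_ge0; apply: jmax.
have zj : z j = 0 by rewrite /z /m divfK ?subrr.
exists m => i; apply/eqP; rewrite -subr_eq0 -oppr_eq0 opprB.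
apply/negPn/negP => zi.
have : (#|off (fun=> 0%R) c| <= #|off (fun=> 0%R) z|)%N.
  apply: cmin; split=> //; first by exists i.
  move=> l zl; have cl : c l != 0.
    by apply: contraNneq zl => cl; apply/eqP; apply: conf_supp zc cl.
  by rewrite (zc l zl) (cx l cl).
rewrite leqNgt (off_lt (j := j)) // => l _; exact: conf_supp zc.
Qed.

End Signs.

(** * Posets of classes of sign vectors *)

Section CellPoset.
Variables (F : realFieldType) (I : finType) (P : (I -> F) -> Prop).
Variables (eqv : (I -> F) -> (I -> F) -> Prop).
Variables (X : Type) (ge : rel X) (rp : X -> (I -> F) -> Prop).
Implicit Types (x y z c d u w : I -> F) (A B C D : X).

(* [rp C x] reads: [C] is the class of the sign vector of [x]. *)
Definition cell_poset :=
  [/\ forall C, exists x, rp C x, forall C x, rp C x -> P x,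
      forall x, P x -> exists C, rp C x,
      forall C D x y, rp C x -> rp D y -> C = D <-> eqv x y &
      forall C D, ge C D <-> exists x y, [/\ rp C x, rp D y & conf y x]].

Definition sg_eqv x y := forall i, Num.sg (x i) = Num.sg (y i).

(** Any equivalence between equality of sign vectors and equality of supports; this covers both
    [sg_eqv], used for OP, and [flow_eqv], used for its quotient. *)
Definition tame := (forall x y, sg_eqv x y -> eqv x y) /\
  forall x y i, eqv x y -> (x i == 0) = (y i == 0).

Hypotheses (sP : subspace P) (cpX : cell_poset) (tm : tame).

Lemma rp_ex C : exists x, rp C x. Proof. by case: cpX. Qed.

Lemma rp_in C x : rp C x -> P x. Proof. by case: cpX => _ + _ _ _; apply. Qed.

Lemma rp_cl x : P x -> exists C, rp C x.
Proof. by case: cpX => _ _ + _ _; apply. Qed.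
Lemma rp_eq C D x y : rp C x -> rp D y -> C = D <-> eqv x y.
Proof. by case: cpX => _ _ _ + _; apply. Qed.

Lemma rp_supp C x y i : rp C x -> rp C y -> (x i == 0) = (y i == 0).
Proof. by move=> Cx Cy; apply: tm.2; apply/(rp_eq Cx Cy). Qed.

Lemma rp_transfer C x y : rp C x -> P y -> eqv x y -> rp C y.
Proof. by move=> Cx /rp_cl[D Dy] /(rp_eq Cx Dy) ->. Qed.

Lemma ge_conf C D x y : rp C x -> rp D y -> conf y x -> ge C D.
Proof.
by case: cpX => _ _ _ _ geE Cx Dy yx; apply/geE; exists x, y.
Qed.

Lemma ge_rp C D : ge C D -> exists x y, [/\ rp C x, rp D y & conf y x].
Proof. by case: cpX => _ _ _ _ geE /geE. Qed.

Lemma ge_supp C D x y i : ge C D -> rp C x -> rp D y -> x i = 0 -> y i = 0.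
Proof.
move=> /ge_rp[x' [y' [Cx' Dy' yx]]] Cx Dy xi.
apply/eqP; rewrite (rp_supp i Dy Dy'); apply/eqP; apply: conf_supp yx _.
by apply/eqP; rewrite (rp_supp i Cx' Cx) xi.
Qed.

Lemma ge_eq C D x y : ge C D -> rp C x -> rp D y ->
  (forall i, y i = 0 -> x i = 0) -> D = C.
Proof.
move=> /ge_rp[x' [y' [Cx' Dy' yx]]] Cx Dy xy; apply/esym/(rp_eq Cx' Dy').
apply: tm.1 => i; have [y0|yi] := eqVneq (y' i) 0; last by rewrite yx.
suff -> : x' i = 0 by rewrite y0.
by apply/eqP; rewrite (rp_supp i Cx' Cx); apply/eqP/xy/eqP;
  rewrite (rp_supp i Dy Dy') y0.
Qed.

(** [bot], [low] and [plane] bound the height by 0, 1 and 2 in terms of the order alone, so that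
    isomorphisms preserve them. *)
Definition bot C := forall D, ge C D -> D = C.
Definition low C := forall D, ge C D -> D = C \/ bot D.
Definition plane C := forall D, ge C D -> D = C \/ low D.

Definition line x := forall y, P y -> (forall i, x i = 0 -> y i = 0) ->
  exists t, forall i, y i = t * x i.

Lemma rp_bot C x : rp C x -> bot C <-> forall i, x i = 0.
Proof.
move=> Cx; split=> [botC i|x0 D geCD].
  have [D D0] := rp_cl sP.1.
  have CD : D = C.
    by apply: botC; apply: (ge_conf Cx D0) => j; rewrite eqxx.
  by apply/eqP; rewrite -(rp_supp i _ Cx (x := fun=> 0)) -?CD.
have [y Dy] := rp_ex D; exact: ge_eq geCD Cx Dy (fun i _ => x0 i).
Qed.

(** [line] means zero or elementary. By [conf_elem] every nonzero class lies above the class of a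
    circuit, and height at most one forces the two classes to coincide. *)
Lemma rp_low C x : rp C x -> low C <-> line x.
Proof.
move=> Cx; split=> [lowC y Py yx|lx D geCD].
  have [[i xi]|no] := pselect (exists i, x i != 0); last first.
    exists 0 => i; rewrite mul0r yx //; apply/eqP/negPn/negP => xi.
    by apply: no; exists i.
  have [|c elc cx] := conf_elem sP (rp_in Cx); first by exists i.
  have [Pc [k ck] elc'] := elc.
  have [D Dc] := rp_cl Pc.
  have [DC|botD] := lowC D (ge_conf Cx Dc cx); last first.
    by move: ck; rewrite (rp_bot Dc).1 ?eqxx.
  have xc j : c j = 0 -> x j = 0.
    by move=> cj; apply/eqP; rewrite -(rp_supp j _ Cx (x := c)) ?cj -?DC.
  have [t xt] := elc' x (rp_in Cx) xc.
  have [|s ys] := elc' y Py; first by move=> j /xc/yx.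
  have t0 : t != 0 by apply: contraNneq xi => t0; rewrite xt t0 mul0r.
  by exists (s / t) => j; rewrite ys xt mulrA divfK.
have [y Dy] := rp_ex D.
have [i xi|t yt] := lx y (rp_in Dy); first exact: ge_supp geCD Cx Dy xi.
have [t0|t0] := eqVneq t 0.
  by right; apply/(rp_bot Dy) => i; rewrite yt t0 mul0r.
left; apply: (ge_eq geCD Cx Dy) => i /eqP.
by rewrite yt mulf_eq0 (negPf t0) => /eqP.
Qed.

Lemma rp_elem C x : rp C x -> elem P x <-> low C /\ ~ bot C.
Proof.
move=> Cx; rewrite (rp_low Cx) (rp_bot Cx); split=> [[_ [i xi] lx]|[lx x0]].
  by split=> // x0; rewrite x0 eqxx in xi.
split=> //; first exact: rp_in Cx.
apply: contrapT => no; apply: x0 => i; apply/eqP/negPn/negP => xi.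
by apply: no; exists i.
Qed.

End CellPoset.

(** * Sign vectors modulo flows: circuits and thetas *)

Section FlowClasses.
Variables (F : realFieldType) (I : finType) (P : (I -> F) -> Prop).
Implicit Types (x y z c d u w : I -> F).

Definition flow_eqv x y := (forall i, (x i == 0) = (y i == 0)) /\
  P (fun i => Num.sg (x i) - Num.sg (y i)).

Lemma flow_eqv_tame : subspace P -> tame flow_eqv.
Proof.
move=> sP; split=> [x y xy|x y i []//]; split=> [i|]; first exact: sgr_supp.
rewrite (_ : (fun i => _) = fun=> 0); first exact: sP.1.
by apply: funext => i; rewrite xy subrr.
Qed.

Lemma regular_norm c : regular P -> elem P c ->
  exists2 m, 0 < m & forall i, c i = m * Num.sg (c i).
Proof.
move=> rP elc; have [_ [h ch] _] := elc; exists `|c h|; first by rewrite normr_gt0.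
move=> i; have [->|ci] := eqVneq (c i) 0; first by rewrite sgr0 mulr0.
rewrite {1}[c i]numEsg mulrC; congr (_ * _).
by have [->|->] := rP c elc h i ch ci; rewrite ?normrN.
Qed.

(** By regularity the sign vector of a circuit is a multiple of it, so reversing the circuit changes
    the signs by a vector of [P]: modulo flows a circuit has one class, not two. *)
Lemma flow_eqv_scale c t : subspace P -> regular P -> elem P c -> t != 0 ->
  flow_eqv c (fun i => t * c i).
Proof.
move=> sP rP elc t0; have [Pc _ _] := elc; split=> [i|].
  by rewrite mulf_eq0 (negPf t0).
have [m m0 mE] := regular_norm rP elc.
apply: (subspace_lin (a := (1 - Num.sg t) / m) (b := 0) sP Pc Pc) => i.
by rewrite sgrM [in RHS]mE; field; rewrite gt_eqF.
Qed.

Variables (X : Type) (ge : rel X) (rp : X -> (I -> F) -> Prop).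
Hypotheses (sP : subspace P) (rP : regular P).
Hypothesis cpX : cell_poset P flow_eqv ge rp.
Let tm := flow_eqv_tame sP.

Lemma rp_elem_eq A B c d t : rp A c -> rp B d -> elem P c -> t != 0 ->
  (forall i, d i = t * c i) -> A = B.
Proof.
move=> Ac Bd elc t0 dE; apply/(rp_eq cpX Ac Bd).
by rewrite (funext dE); apply: flow_eqv_scale.
Qed.

(** Height at most two bounds by two the dimension of the space [PA] of vectors supported in the
    class: the part of it in the hyperplane of a facet [s] is spanned by one vector [w]. If two
    circuits that are not proportional vanish at [e], so does all of [PA]. *)
Lemma plane_union Z A B D c d u : plane ge Z -> ge Z A -> ge Z B -> ge Z D ->
    rp A c -> rp B d -> rp D u -> elem P c -> elem P d -> elem P u -> B <> D ->
  forall i, d i = 0 -> u i = 0 -> c i = 0.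
Proof.
move=> plZ geA geB geD Ac Bd Du elc eld elu BD e de ue.
have [[Pc _ _] [Pd [kd dk] _] [Pu [ku uk] _]] := And3 elc eld elu.
apply/eqP/negPn/negP => ce.
have [x Zx] := rp_ex cpX Z; have Px := rp_in cpX Zx.
pose PA y := P y /\ forall i, x i = 0 -> y i = 0.
have sPA : subspace PA by exact: subspace_vanish.
have PAc : PA c by split=> // i xi; apply: (ge_supp cpX tm geA Zx Ac xi).
have PAd : PA d by split=> // i xi; apply: (ge_supp cpX tm geB Zx Bd xi).
have PAu : PA u by split=> // i xi; apply: (ge_supp cpX tm geD Zx Du xi).
have [|J [Jconf Jx Jw]] := facets (x := x) sPA.
  by split=> // y i [_ yx]; exact: yx.
have [s sJ] : exists s, s \in J.
  apply: contrapT => no.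
  have xe : x e != 0 by apply: contraNneq ce => xe; rewrite PAc.2.
  have /(_ e) : conf (fun i => - x i) x.
    apply: Jconf => [|i iJ]; last by case: no; exists i.
    split=> [|i ->]; last by rewrite oppr0.
    by apply: (subspace_scale (t := -1) sP Px) => i; ring.
  by rewrite oppr_eq0 sgrN => /(_ xe)/esym/sgr_eqN/eqP; rewrite (negPf xe).
have [w [[Pw wx] ws wc wz]] := Jw s sJ.
have [W Ww] := rp_cl cpX Pw.
have geW := ge_conf cpX Zx Ww wc.
have lw : line P w.
  have [WZ|lowW] := plZ W geW; last exact/(rp_low sP cpX tm Ww).
  rewrite WZ in Ww; have := Jx s sJ.
  by rewrite (rp_supp cpX tm s Zx Ww) ws eqxx.
have ker y : PA y -> y s = 0 -> exists t, forall i, y i = t * w i.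
  by move=> PAy ys; apply: lw PAy.1 _ => i wi; apply: wz wi _ PAy ys.
have scale y z t i k : (forall j, y j = t * z j) -> y k != 0 -> z i = 0 ->
    t != 0 /\ y i = 0.
  move=> yE yk zi; split; last by rewrite yE zi mulr0.
  by apply: contraNneq yk => t0; rewrite yE t0 mul0r.
(* A combination of [d] and [u] that vanishes at [s], hence a multiple of [w]; it is nonzero because
   the two circuits have different classes. *)
pose u0 i := d s * u i - u s * d i.
have PAu0 : PA u0.
  by apply: (subspace_lin (a := d s) (b := - u s) sPA PAu PAd) => i; rewrite /u0; ring.
have prop t : ~ (forall i, u i = t * d i).
  move=> uE; have [t0 _] := scale _ _ _ e _ uE uk de.
  exact/BD/(rp_elem_eq Bd Du eld t0).
have [[k u0k]|no] := pselect (exists k, u0 k != 0); last first.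
  have u00 i : d s * u i = u s * d i.
    by apply/eqP; rewrite -subr_eq0; apply/negPn/negP => ui; apply: no; exists i.
  have [ds|ds] := eqVneq (d s) 0; last first.
    by apply: (prop (u s / d s)) => i; rewrite mulrAC -u00 mulrAC divff ?mul1r.
  have us : u s = 0.
    by have /eqP := u00 kd; rewrite ds mul0r eq_sym mulf_eq0 (negPf dk) orbF => /eqP.
  have [t1 dE] := ker d PAd ds; have [t2 uE] := ker u PAu us.
  have t10 : t1 != 0 by apply: contraNneq dk => t0; rewrite dE t0 mul0r.
  by apply: (prop (t2 / t1)) => i; rewrite uE dE mulrA divfK.
have [|t u0E] := ker u0 PAu0; first by rewrite /u0; ring.
have t0 : t != 0 by apply: contraNneq u0k => t0; rewrite u0E t0 mul0r.
have we : w e = 0.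
  have /eqP := u0E e; rewrite /u0 de ue !mulr0 subr0 eq_sym mulf_eq0.
  by rewrite (negPf t0) => /eqP.
have es := zle_sym sPA (wz e we) PAc ce.
by move: u0k; rewrite /u0 (es d PAd de) (es u PAu ue) !mul0r subrr eqxx.
Qed.

(** After scaling, [d'] equals [c] on the overlap, so [c] and [d'] conform to their sum [x]. The
    third circuit [d' - c] conforms not to [x] but to [x2], which is equivalent to [x]: their sign
    vectors differ by twice that of [c]. *)
Lemma plane_exists A B D c d e h : rp A c -> rp B d ->
    rp D (fun i => c i - c h / d h * d i) -> elem P c -> P d -> spans P c d ->
    c e != 0 -> d e = 0 -> c h != 0 -> d h != 0 ->
  exists Z, [/\ plane ge Z, ge Z A, ge Z B & ge Z D].
Proof.
move=> Ac Bd Du elc Pd sp ce de ch dh; have [Pc _ _] := elc.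
have eld := spans_elem_r Pd sp ce de dh.
have elu := spans_elem_sub sP Pc Pd sp ce de dh.
set u := (fun i => _) in Du elu.
pose r := c h / d h.
have r0 : r != 0 by rewrite mulf_neq0 ?invr_eq0.
pose d' i := r * d i.
have Pd' : P d' by apply: (subspace_lin (a := r) (b := 0) sP Pd Pd) => i; rewrite /d'; ring.
have Bd' : rp B d' by apply: (rp_transfer cpX Bd Pd'); apply: flow_eqv_scale.
have cd' i : c i != 0 -> d i != 0 -> c i = d' i.
  move=> ci di; have := regular_ratio sP rP elc Pd sp ce de ch dh ci di.
  by move=> /(canRL (mulfK dh)) ->; rewrite /d' /r; field.
(* The factor 2 gives [x2] the sign of [- c] on the common part of [c] and [d'], where [d' - c]
   vanishes. *)
pose x i := c i + d' i; pose x2 i := d' i - 2 * c i.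
have Px : P x by apply: (subspace_lin (a := 1) (b := 1) sP Pc Pd') => i; rewrite /x; ring.
have Px2 : P x2 by apply: (subspace_lin (a := 1) (b := -2) sP Pd' Pc) => i; rewrite /x2; ring.
have cases i : [\/ c i = 0, d' i = 0 | c i = d' i].
  have [ci|ci] := eqVneq (c i) 0; first by constructor 1.
  have [di|di] := eqVneq (d i) 0; first by constructor 2; rewrite /d' di mulr0.
  by constructor 3; apply: cd'.
have sg2 (a : F) : Num.sg (2 * a) = Num.sg a by rewrite sgrM gtr0_sg ?ltr0n ?mul1r.
have [Z Zx] := rp_cl cpX Px.
have Zx2 : rp Z x2.
  apply: (rp_transfer cpX Zx Px2); split=> [i|].
    rewrite /x /x2; have [->|->|->] := cases i.
    - by rewrite mulr0 add0r subr0.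
    - by rewrite add0r addr0 oppr_eq0 mulf_eq0 pnatr_eq0.
    - rewrite -mulr2n mulrn_eq0 /=.
      have -> : d' i - 2 * d' i = - d' i by ring.
      by rewrite oppr_eq0.
  have [m m0 mE] := regular_norm rP elc.
  apply: (subspace_lin (a := 2 / m) (b := 0) sP Pc Pc) => i.
  have -> : 2 / m * c i + 0 * c i = 2 * Num.sg (c i).
    by rewrite [in LHS]mE; field; rewrite gt_eqF.
  rewrite /x /x2; have [->|->|->] := cases i.
  - by rewrite mulr0 add0r subr0 subrr sgr0 mulr0.
  - by rewrite add0r addr0 sgrN sg2 opprK mulr_natl mulr2n.
  - have -> : d' i - 2 * d' i = - d' i by ring.
    have -> : d' i + d' i = 2 * d' i by ring.
    by rewrite sg2 sgrN opprK; ring.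
have Du' : rp D (fun i => -1 * u i).
  apply: (rp_transfer cpX Du).
    by have [Pu _ _] := elu; apply: (subspace_scale (t := -1) sP Pu) => i; ring.
  by apply: flow_eqv_scale => //; rewrite oppr_eq0 oner_eq0.
exists Z; split.
- move=> V geV; have [v Vv] := rp_ex cpX V.
  have vx i : x i = 0 -> v i = 0 := ge_supp cpX tm geV Zx Vv.
  have x0 i : c i = 0 -> d i = 0 -> x i = 0.
    by move=> ci di; rewrite /x /d' ci di mulr0 addr0.
  have [a [b vE]] : exists a b, forall i, v i = a * c i + b * d i.
    by apply: sp; [exact: (rp_in cpX Vv)|move=> i ci di; apply/vx/x0].
  have [[k [xk vk]]|no] := pselect (exists k, x k != 0 /\ v k = 0); last first.
    left; apply: (ge_eq cpX tm geV Zx Vv) => i vi.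
    by apply/eqP/negPn/negP => xi; apply: no; exists i.
  right; apply/(rp_low sP cpX tm Vv) => y Py yv.
  have [|a' [b' yE]] := sp y Py; first by move=> i ci di; apply/yv/vx/x0.
  have yk := yv k vk; rewrite yE in yk; rewrite vE in vk.
  (* Vanishing at [k] is a nontrivial linear condition on the pair of coefficients, so the pairs of
     [v] and [y] are proportional. *)
  have ab : a * b' = a' * b.
    have [ck|ck] := eqVneq (c k) 0.
      have dk : d k != 0 by apply: contraNneq xk => dk; rewrite x0.
      move: vk yk; rewrite ck !mulr0 !add0r => /eqP + /eqP.
      by rewrite !mulf_eq0 (negPf dk) !orbF => /eqP -> /eqP ->; rewrite !mulr0.
    apply: (mulIf ck); apply/eqP; rewrite -subr_eq0; apply/eqP.
    have -> : a * b' * c k - a' * b * c k =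
      b' * (a * c k + b * d k) - b * (a' * c k + b' * d k) by ring.
    by rewrite vk yk !mulr0 subrr.
  have [a0|a0] := eqVneq a 0; last first.
    exists (a' / a) => i; rewrite yE vE.
    have -> : b' = a' / a * b by rewrite mulrAC -ab mulrAC divff ?mul1r.
    by field.
  have [b0|b0] := eqVneq b 0.
    exists 0 => i; rewrite mul0r yv // vE a0 b0; ring.
  exists (b' / b) => i; rewrite yE vE.
  have -> : a' = b' / b * a by rewrite mulrAC [b' * _]mulrC ab -mulrA divff ?mulr1.
  by field.
- apply: (ge_conf cpX Zx Ac) => i ci; rewrite /x.
  have [/eqP|->|<-] := cases i; first by rewrite (negPf ci).
    by rewrite addr0.
  by rewrite -mulr2n -mulr_natl sg2.
- apply: (ge_conf cpX Zx Bd') => i di; rewrite /x.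
  have [->|/eqP|->] := cases i; last 1 first.
  + by rewrite -mulr2n -mulr_natl sg2.
  + by rewrite add0r.
  + by rewrite (negPf di).
- apply: (ge_conf cpX Zx2 Du') => i ui.
  have uE : u i = c i - d' i by [].
  rewrite mulN1r sgrN uE /x2; have [->|->|cd] := cases i.
  + by rewrite sub0r sgrN opprK mulr0 subr0.
  + by rewrite subr0 sub0r sgrN sg2.
  + by move: ui; rewrite uE cd subrr mulr0 eqxx.
Qed.

End FlowClasses.

Section HeightIso.
Variables (X X' : Type) (ge : rel X) (ge' : rel X') (f : X -> X') (g : X' -> X).
Hypotheses (fK : cancel f g) (gK : cancel g f).
Hypothesis fge : {mono f : x y / ge x y >-> ge' x y}.

Lemma mono_inv : {mono g : x y / ge' x y >-> ge x y}.
Proof. by move=> x y; rewrite -fge !gK. Qed.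

Lemma iso_bot C : bot ge C -> bot ge' (f C).
Proof. by move=> bC D; rewrite -[D]gK fge => /bC ->. Qed.

Lemma iso_bot_inv C : bot ge' (f C) -> bot ge C.
Proof. by move=> bC D; rewrite -fge => /bC /(can_inj fK). Qed.

Lemma iso_low C : low ge C -> low ge' (f C).
Proof.
by move=> lC D; rewrite -[D]gK fge => /lC[->|/iso_bot]; auto.
Qed.

Lemma iso_plane C : plane ge C -> plane ge' (f C).
Proof.
by move=> lC D; rewrite -[D]gK fge => /lC[->|/iso_low]; auto.
Qed.

End HeightIso.

(** * Isomorphisms of the quotient poset respect supports *)

Section FlowClassIso.
Variables (F : realFieldType) (I I' : finType).
Variables (P : (I -> F) -> Prop) (P' : (I' -> F) -> Prop).
Variables (X X' : Type) (ge : rel X) (ge' : rel X').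
Variables (rp : X -> (I -> F) -> Prop) (rp' : X' -> (I' -> F) -> Prop).
Variables (f : X -> X') (g : X' -> X).
Hypotheses (sP : subspace P) (rP : regular P) (sP' : subspace P').
Hypotheses (rP' : regular P') (cpX : cell_poset P (flow_eqv P) ge rp).
Hypothesis cpX' : cell_poset P' (flow_eqv P') ge' rp'.
Hypotheses (fK : cancel f g) (gK : cancel g f).
Hypothesis fge : {mono f : x y / ge x y >-> ge' x y}.
Let tm := flow_eqv_tame sP.
Let tm' := flow_eqv_tame sP'.

Lemma iso_elem A c c' : rp A c -> rp' (f A) c' -> elem P c -> elem P' c'.
Proof.
move=> Ac Ac' /(rp_elem sP cpX tm Ac)[lA nbA].
apply/(rp_elem sP' cpX' tm' Ac'); split; first exact: iso_low lA.
by move=> bA; apply: nbA; apply: iso_bot_inv bA.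
Qed.

(* Induction on the support of [C]: two facets of [C] contain circuits whose
   theta closure contains the given circuit of the support of [C]. *)
Lemma iso_elem_supp C A x c x' c' : rp C x -> rp A c -> elem P c ->
  (forall i, x i = 0 -> c i = 0) -> rp' (f C) x' -> rp' (f A) c' ->
  forall i, x' i = 0 -> c' i = 0.
Proof.
have [n] := ubnP #|off (fun=> 0%R) x|.
elim: n C A x c x' c' => // n IHn C A x c x' c' /ltnSE len Cx Ac elc cx Cx' Ac'.
have [Pc [k ck] _] := elc; have Px := rp_in cpX Cx.
pose PA y := P y /\ forall i, x i = 0 -> y i = 0.
have sPA : subspace PA by exact: subspace_vanish.
have PAc : PA c by [].
have fx : full PA x by split=> // y i [_ yx]; exact: yx.
have [[t xE]|nx] := pselect (exists t, forall i, x i = t * c i).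
  have xk : x k != 0 by apply: contraNneq ck => /cx ->.
  have t0 : t != 0 by apply: contraNneq xk => t0; rewrite xE t0 mul0r.
  have AC := rp_elem_eq sP rP cpX Ac Cx elc t0 xE.
  by move=> i xi; apply/eqP; rewrite (rp_supp cpX' tm' i Ac' (y := x')) ?xi -?AC // AC.
have [J [Jconf Jx Jw]] := facets sPA fx.
have Jn y : PA y -> (forall s, s \in J -> y s = 0) -> forall i, y i = 0.
  move=> PAy y0 i; have xy : conf y x by apply: Jconf => // s /y0->; rewrite mul0r.
  have xNy : conf (fun i => - y i) x.
    apply: Jconf => [|s /y0->]; last by rewrite oppr0 mul0r.
    by apply: (subspace_scale (t := -1) sPA PAy) => j; ring.
  apply/eqP/negPn/negP => yi; have := xNy i; rewrite oppr_eq0 sgrN => /(_ yi).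
  by rewrite -(xy i yi) => /esym/sgr_eqN/eqP; rewrite (negPf yi).
have [s1 s1J] : exists s, s \in J.
  apply: contrapT => no; have := Jn x (conj Px (fun i xi => xi)).
  by move=> x0; apply: nx; exists 0 => i; rewrite mul0r x0 // => s sJ; case: no; exists s.
(* A nonzero vector of [PA] in the hyperplane of [s1]: either [c], or the combination of [x] and [c]
   vanishing there, nonzero as they are not proportional. *)
have [d0 [PAd0 d0s d0n]] : exists d, [/\ PA d, d s1 = 0 & exists i, d i != 0].
  have [cs|cs] := eqVneq (c s1) 0; first by exists c; split=> //; exists k.
  exists (fun i => c s1 * x i - x s1 * c i); split; last 1 first.
  - apply: contrapT => no; apply: nx; exists (x s1 / c s1) => i.
    apply: (mulIf cs); rewrite mulrAC divfK // mulrC; apply/eqP.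
    rewrite -subr_eq0; apply/negPn/negP => ne; apply: no; exists i.
    by move: ne; rewrite [x s1 * _]mulrC.
  - by apply: (subspace_lin (a := c s1) (b := - x s1) sPA fx.1 PAc) => i; ring.
  - by rewrite mulrC subrr.
have [s2 s2J d0s2] : exists2 s, s \in J & d0 s != 0.
  apply: contrapT => no; have [i] := d0n; rewrite Jn ?eqxx // => s sJ.
  by apply/eqP/negPn/negP => ds; apply: no; exists s.
(* A circuit that vanishes at some [s] of [J] lies in the support of the facet [w], to which the
   induction applies. *)
have down s d D d' : s \in J -> elem P d -> (forall i, x i = 0 -> d i = 0) ->
    d s = 0 -> rp D d -> rp' (f D) d' -> forall i, x' i = 0 -> d' i = 0.
  move=> sJ eld dx ds Dd Dd' i x'i.
  have [w [[Pw wx] ws wc wz]] := Jw s sJ.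
  have [W Ww] := rp_cl cpX Pw; have [w' Ww'] := rp_ex cpX' (f W).
  have gW := ge_conf cpX Cx Ww wc.
  have Pd : P d by case: eld.
  apply: (IHn W D w d w' d') => //.
  - apply: leq_trans len; apply: (off_lt (j := s)) => //; last exact: Jx.
    by move=> j _; exact: wx.
  - by move=> j wj; apply: wz wj _ _ ds.
  - by apply: (ge_supp cpX' tm' _ Cx' Ww') => //; rewrite fge.
have [c1|c1] := eqVneq (c s1) 0; first exact: (down s1 c A).
have [c2|c2] := eqVneq (c s2) 0; first exact: (down s2 c A).
have [PAd01 d0x] := PAd0.
(* Now [c] is nonzero at [s1] and at [s2]. It is a cycle of a theta whose other two cycles, [d] and
   [u], avoid [s1] and [s2] respectively and are settled by [down]. *)
have [d [Pd ds1 ds2 dc [sp _]]] := spans_exists sP elc c1 PAd01 d0s d0s2.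
have dx i : x i = 0 -> d i = 0 by move=> xi; rewrite dc ?cx ?d0x.
have eld := spans_elem_r Pd sp c1 ds1 ds2.
have elu := spans_elem_sub sP Pc Pd sp c1 ds1 ds2.
have [B Bd] := rp_cl cpX Pd; have [D Du] : exists D, rp D _ := rp_cl cpX (let: And3 Pu _ _ := elu in Pu).
have [Z [plZ ZA ZB ZD]] := plane_exists sP rP cpX Ac Bd Du elc Pd sp c1 ds1 c2 ds2.
have [d' Bd'] := rp_ex cpX' (f B); have [u' Du'] := rp_ex cpX' (f D).
set u := (fun i => _) in elu Du.
have us2 : u s2 = 0 by rewrite /u divfK ?subrr.
move=> i x'i.
apply: (plane_union sP' rP' cpX' (iso_plane gK fge plZ) _ _ _ Ac' Bd' Du') => //.
- by rewrite fge.
- by rewrite fge.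
- by rewrite fge.
- exact: iso_elem Ac Ac' elc.
- exact: iso_elem Bd Bd' eld.
- exact: iso_elem Du Du' elu.
- move=> /(can_inj fK) BD; rewrite -BD in Du.
  have := rp_supp cpX tm s1 Bd Du; rewrite ds1 eqxx => /esym/eqP.
  by rewrite /u ds1 mulr0 subr0 => c10; rewrite c10 eqxx in c1.
- exact: (down s1 d B d' s1J eld dx ds1 Bd Bd').
- apply: (down s2 u D u' s2J elu _ us2 Du Du') => // j xj.
  by rewrite /u (cx j) // (dx j) // mulr0 subr0.
Qed.

End FlowClassIso.

Definition supp_mono (F : realFieldType) (I I' : finType) (X X' : Type)
    (rp : X -> (I -> F) -> Prop) (rp' : X' -> (I' -> F) -> Prop) (f : X -> X') :=
  forall C D x y x' y', rp C x -> rp D y -> rp' (f C) x' -> rp' (f D) y' ->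
  (forall i, y i = 0 -> x i = 0) -> forall i, y' i = 0 -> x' i = 0.

(** Supports are unions of supports of circuits. A circuit inside [x'] is pulled back by [g] into
    [x], hence into [y], then pushed forward by [f] into [y'], each time by [iso_elem_supp]. *)
Lemma flow_iso_supp (F : realFieldType) (I I' : finType) P P' (X X' : Type)
    (ge : rel X) (ge' : rel X') (rp : X -> (I -> F) -> Prop)
    (rp' : X' -> (I' -> F) -> Prop) (f : X -> X') (g : X' -> X) :
  subspace P -> regular P -> subspace P' -> regular P' ->
  cell_poset P (flow_eqv P) ge rp -> cell_poset P' (flow_eqv P') ge' rp' ->
  cancel f g -> cancel g f -> {mono f : x y / ge x y >-> ge' x y} ->
  supp_mono rp rp' f.
Proof.
move=> sP rP sP' rP' cpX cpX' fK gK fge C D x y x' y' Cx Dy Cx' Dy' xy i y'i.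
apply/eqP/negPn/negP => x'i.
have [c' [elc' c'x c'i]] := elem_exists sP' (rp_in cpX' Cx') x'i.
have [Pc' _ _] := elc'; have [A' Ac'] := rp_cl cpX' Pc'.
have [c Ac] := rp_ex cpX (g A').
have gge := mono_inv gK fge.
have elc := iso_elem sP' sP cpX' cpX gK fK gge Ac' Ac elc'.
have cx : forall j, x j = 0 -> c j = 0.
  apply: (iso_elem_supp sP' rP' sP rP cpX' cpX gK fK gge Cx' Ac' elc' c'x) => //.
  by rewrite fK.
move: c'i; rewrite (iso_elem_supp sP rP sP' rP' cpX cpX' fK gK fge Dy Ac elc _ Dy' _ y'i) ?eqxx //.
- by move=> j /xy/cx.
- by rewrite gK.
Qed.

(** * The graph of topes *)

Section Topes.
Variables (F : realFieldType) (I : finType) (P : (I -> F) -> Prop).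
Variables (X : Type) (ge : rel X) (rp : X -> (I -> F) -> Prop).
Hypotheses (sP : subspace P) (cpX : cell_poset P (@sg_eqv F I) ge rp).
Implicit Types (x y z w : I -> F) (C D W : X).

Lemma sg_eqv_tame : tame (@sg_eqv F I).
Proof. by split=> // x y i xy; apply: sgr_supp. Qed.

Definition top C := forall D, ge D C -> D = C.

(** Topes with a common wall. The condition on [W], stated in terms of the order alone, says that it
    has codimension one. *)
Definition adjacent C D := [/\ top C, top D, C <> D &
  exists W, [/\ ge C W, ge D W & forall E, ge E W -> E = W \/ top E]].

Fixpoint walk n C D := if n is n'.+1 then exists2 E, adjacent C E & walk n' E D
  else C = D.

(** The coordinates that cut the same hyperplane of [P] as [i]. Crossing a wall changes the signs of
    a whole class at once, so distances count classes. *)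
Definition parallel_class i : {set I} := [set j | `[< zle P i j /\ zle P j i >]].

Definition sep x y : {set I} := [set i | Num.sg (x i) != Num.sg (y i)].

(* The distance in the graph of topes, by [walk_dst] and [dst_walk]. *)
Definition dst x y := #|[set parallel_class i | i in sep x y]|.

Lemma mem_parallel i j : reflect (zle P i j /\ zle P j i) (j \in parallel_class i).
Proof. by rewrite inE; apply: asboolP. Qed.

Lemma parallel_refl i : i \in parallel_class i.
Proof. by apply/mem_parallel; split. Qed.

Lemma parallel_class_eq i j : j \in parallel_class i ->
  parallel_class j = parallel_class i.
Proof.
move=> /mem_parallel[ij ji]; apply/setP => k; apply/mem_parallel/mem_parallel.
  by move=> [jk kj]; split=> y Py y0; [apply/jk/ij | apply/ji/kj].
by move=> [ik ki]; split=> y Py y0; [apply/ik/ji | apply/ij/ki].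
Qed.

Lemma rp_sg C x y : rp C x -> rp C y -> forall i, Num.sg (x i) = Num.sg (y i).
Proof. by move=> Cx Cy; apply/(rp_eq cpX Cx Cy). Qed.

Lemma ge_conf_rp C D x y : ge C D -> rp C x -> rp D y -> conf y x.
Proof.
move=> /(ge_rp cpX)[x' [y' [Cx' Dy' yx]]] Cx Dy i yi.
rewrite (rp_sg Dy Dy') (rp_sg Cx Cx') yx //.
by rewrite -sgr_eq0 -(rp_sg Dy Dy') sgr_eq0.
Qed.

Lemma rp_top C x : rp C x -> top C <-> full P x.
Proof.
move=> Cx; have Px := rp_in cpX Cx; split=> [topC|[_ fx] D geDC].
  split=> // y i Py xi; have [z Pz zE] := compose sP Px Py.
  have [D Dz] := rp_cl cpX Pz.
  have DC : D = C.
    apply: topC; apply: (ge_conf cpX Dz Cx) => j xj.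
    by rewrite zE (negPf xj).
  rewrite DC in Dz; have := rp_sg Cx Dz i; rewrite zE xi eqxx sgr0 => /esym/eqP.
  by rewrite sgr_eq0 => /eqP.
have [y Dy] := rp_ex cpX D; have Py := rp_in cpX Dy.
apply/(rp_eq cpX Dy Cx) => i; have [xi|xi] := eqVneq (x i) 0.
  by rewrite xi (fx y).
by rewrite (ge_conf_rp geDC Dy Cx).
Qed.

Lemma parallel_sg x y i j : full P x -> full P y -> j \in parallel_class i ->
  Num.sg (x i) = Num.sg (y i) <-> Num.sg (x j) = Num.sg (y j).
Proof.
move=> [Px fx] [Py fy] /mem_parallel[ij ji].
have [xi|xi] := eqVneq (x i) 0.
  by rewrite (ij x) // xi (fx y i Py xi) (ij y) // (fx y).
have xj : x j != 0 by apply: contraNneq xi => xj; rewrite (ji x).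
rewrite (zleP sP ij Px xi Py) -[in Num.sg (x j)](divfK xi (x j)) !sgrM.
split=> [->//|]; apply: mulfI.
by rewrite -sgrM sgr_eq0 mulf_neq0 ?invr_eq0.
Qed.

Lemma sepC x y : sep x y = sep y x.
Proof. by apply/setP => i; rewrite !inE eq_sym. Qed.

Lemma dstC x y : dst x y = dst y x.
Proof. by rewrite /dst sepC. Qed.

Lemma sg_other x y z i : full P x -> full P y -> full P z ->
  Num.sg (z i) <> Num.sg (x i) -> Num.sg (y i) <> Num.sg (x i) ->
  Num.sg (y i) = Num.sg (z i).
Proof.
move=> fx fy fz zx yx.
have xi : x i != 0.
  by apply/eqP => xi; apply: zx; rewrite xi (fx.2 z i) //; case: fz.
have yi : y i != 0 by apply: contraNneq xi => /fy.2 -> //; case: fx.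
have zi : z i != 0 by apply: contraNneq xi => /fz.2 -> //; case: fx.
have sg1 (a : F) : a != 0 -> Num.sg a = 1 \/ Num.sg a = -1.
  by rewrite neq_lt => /orP[/ltr0_sg|/gtr0_sg]; auto.
by move: zx yx; case: (sg1 _ xi) (sg1 _ yi) (sg1 _ zi) => -> [] -> [] ->.
Qed.

Lemma dst_step x y y' e : full P x -> full P y -> full P y' ->
  sep y y' = parallel_class e -> Num.sg (x e) = Num.sg (y e) ->
  dst x y' = (dst x y).+1.
Proof.
move=> fx fy fy' sepE xe.
have on i : i \in parallel_class e ->
    Num.sg (x i) = Num.sg (y i) /\ Num.sg (y i) != Num.sg (y' i).
  move=> ie; split; first exact/(parallel_sg fx fy ie).
  by move: ie; rewrite -sepE inE.
have out i : i \notin parallel_class e -> Num.sg (y i) = Num.sg (y' i).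
  by rewrite -sepE inE negbK => /eqP.
rewrite /dst.
have -> : [set parallel_class i | i in sep x y'] =
    parallel_class e |: [set parallel_class i | i in sep x y].
  apply/setP => K; rewrite !inE; apply/imsetP/orP => [[i ixy' ->]|[/eqP->|]].
  - have [ie|ie] := boolP (i \in parallel_class e).
      by left; rewrite (parallel_class_eq ie).
    right; apply: imset_f; move: ixy'; rewrite !inE; by rewrite (out i ie).
  - by exists e => //; rewrite inE; have [-> ye] := on e (parallel_refl e).
  - move=> /imsetP[i ixy ->]; exists i => //; move: ixy; rewrite !inE => ixy.
    rewrite -out //; apply: contraNN ixy => /on[-> _]; exact: eqxx.
rewrite cardsU1; suff -> : parallel_class e \notin
  [set parallel_class i | i in sep x y] by [].
apply/negP => /imsetP[i ixy eE].
have /on[xi _] : i \in parallel_class e by rewrite eE parallel_refl.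
by move: ixy; rewrite inE xi eqxx.
Qed.

Lemma facet_adjacent C C' x x' w e : rp C x -> rp C' x' -> full P x ->
    full P x' -> P w -> w e = 0 -> (forall i, w i = 0 -> zle P e i) ->
    conf w x -> conf w x' -> Num.sg (x e) <> Num.sg (x' e) ->
  adjacent C C' /\ sep x x' = parallel_class e.
Proof.
move=> Cx Cx' fx fx' Pw we wz wx wx' xe; split.
  split; [exact/(rp_top Cx) | exact/(rp_top Cx') | |].
    by move=> CC'; apply: xe; rewrite CC' in Cx; exact: (rp_sg Cx Cx').
  have [W Ww] := rp_cl cpX Pw; exists W; split.
  - exact: (ge_conf cpX Cx Ww wx).
  - exact: (ge_conf cpX Cx' Ww wx').
  move=> E geE; have [y Ey] := rp_ex cpX E; have Py := rp_in cpX Ey.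
  have wy := ge_conf_rp geE Ey Ww.
  have [ye|ye] := eqVneq (y e) 0.
    left; apply/(rp_eq cpX Ey Ww) => i; have [wi|wi] := eqVneq (w i) 0.
      by rewrite wi (wz i wi).
    by rewrite wy.
  right; apply/(rp_top Ey); split=> // z i Pz yi; apply/eqP/negPn/negP => zi.
  have wi := conf_supp wy yi.
  by move: ye; rewrite (zle_sym sP (wz i wi) Pz zi Py yi) eqxx.
apply/setP => i; rewrite inE; apply/idP/idP => [xi|ie].
  have wi : w i = 0.
    by apply/eqP/negPn/negP => wi; move: xi; rewrite -wx // -wx' // eqxx.
  have xi0 : x i != 0.
    by apply: contraNneq xi => x0; rewrite x0 (fx.2 x' i) ?eqxx //; case: fx'.
  apply/mem_parallel; split; first exact: wz.
  exact: zle_sym sP (wz i wi) fx.1 xi0.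
by apply/eqP; move/(parallel_sg fx fx' ie).
Qed.

(** The common wall [w] vanishes on all separating coordinates. If two of them had different
    hyperplanes, moving [w] inside one and off the other would give an element above the wall that
    is neither the wall nor a tope. *)
Lemma adjacent_sep C C' x x' : adjacent C C' -> rp C x -> rp C' x' ->
  exists e, sep x x' = parallel_class e.
Proof.
move=> [tC tC' CC' [W [geC geC' Wmax]]] Cx Cx'.
have /(rp_top Cx) fx := tC; have /(rp_top Cx') fx' := tC'.
have [w Ww] := rp_ex cpX W; have Pw := rp_in cpX Ww.
have wx := ge_conf_rp geC Cx Ww; have wx' := ge_conf_rp geC' Cx' Ww.
have [e xe] : exists e, e \in sep x x'.
  apply: contrapT => no; apply: CC'; apply/(rp_eq cpX Cx Cx') => i.
  by apply/eqP/negPn/negP => xi; apply: no; exists i; rewrite inE.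
have w0 i : i \in sep x x' -> w i = 0.
  rewrite inE => xi; apply/eqP/negPn/negP => wi.
  by move: xi; rewrite -wx // -wx' // eqxx.
have x0 i : i \in sep x x' -> x i != 0.
  rewrite inE; apply: contraNneq => xi.
  by rewrite xi (fx.2 x' i) ?eqxx //; case: fx'.
have zl i j : i \in sep x x' -> j \in sep x x' -> zle P i j.
  move=> ix jx y Py yi; apply/eqP/negPn/negP => yj.
  have [z Pz zE] := compose sP Pw Py; have [E Ez] := rp_cl cpX Pz.
  have zj : Num.sg (z j) != 0 by rewrite zE w0 // eqxx sgr_eq0.
  have zi : z i = 0 by apply/eqP; rewrite -sgr_eq0 zE w0 // eqxx yi sgr0.
  have [||tE] := Wmax E; first 1 last.
  - by move=> EW; rewrite EW in Ez; rewrite (rp_sg Ez Ww) w0 // sgr0 eqxx in zj.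
  - have /(rp_top Ez)[_ fz] := tE.
    by have := x0 i ix; rewrite (fz x i fx.1 zi) eqxx.
  by apply: (ge_conf cpX Ez Ww) => k wk; rewrite zE (negPf wk).
exists e; apply/setP => i; apply/idP/idP => [ix|ie].
  by apply/mem_parallel; split; apply: zl.
move: xe; rewrite !inE; apply: contraNN => /eqP xi.
apply/eqP; apply/(parallel_sg fx fx' _ (j := e) (i := i)) => //.
by rewrite (parallel_class_eq ie) parallel_refl.
Qed.

Lemma walk_dst n C D x y : walk n C D -> rp C x -> rp D y ->
  full P x -> full P y -> (dst x y <= n)%N.
Proof.
elim: n C x => [|n IHn] C x /=.
  move=> CD Cx Dy _ _; rewrite -CD in Dy; rewrite leqn0 cards_eq0.
  apply/eqP/setP => K; rewrite inE; apply/negP => /imsetP[i].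
  by rewrite inE (rp_sg Cx Dy) eqxx.
move=> [E adj w] Cx Dy fx fy; have [z Ez] := rp_ex cpX E.
have [e xz] := adjacent_sep adj Cx Ez.
have fz : full P z by apply/(rp_top Ez); case: adj.
have := IHn E z w Ez Dy fz fy; rewrite dstC [dst x y]dstC => le.
have [ye|ye] := eqVneq (Num.sg (y e)) (Num.sg (x e)).
  have dE := dst_step fy fx fz xz ye; rewrite dE in le.
  by apply: leq_trans (leqW _); [exact: leqnSn | exact: leq_trans le _].
have zx : sep z x = parallel_class e by rewrite sepC.
have ex : e \in sep x z by rewrite xz parallel_refl.
rewrite (dst_step fy fz fx zx) ?ltnS //.
by apply: (sg_other fx fy fz); apply/eqP => //; move: ex; rewrite inE eq_sym.
Qed.

(** If [y] is not in the tope of [x], it violates the inequality of some facet [s] of [x], and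
    crossing this facet lowers by one the number of separating hyperplanes. *)
Lemma dst_walk n C D x y : rp C x -> rp D y -> full P x -> full P y ->
  dst x y = n -> walk n C D.
Proof.
elim: n C x => [|n IHn] C x Cx Dy fx fy.
  move=> /eqP; rewrite cards_eq0 => /eqP d0; apply/(rp_eq cpX Cx Dy) => i.
  apply/eqP/negPn/negP => xi; have : parallel_class i \in set0 by rewrite -d0 imset_f ?inE.
  by rewrite inE.
move=> dn; have [J [Jconf Jx Jw]] := facets sP fx.
have [s sJ ys] : exists2 s, s \in J & y s * x s < 0.
  apply: contrapT => no.
  have yx : conf y x.
    apply: Jconf => [|i iJ]; first by case: fy.
    by rewrite leNgt; apply/negP => lt; apply: no; exists i.
  have /eqP : dst x y = 0%N.
    apply/eqP; rewrite cards_eq0; apply/eqP/setP => K; rewrite inE.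
    apply/negP => /imsetP[i]; rewrite inE => /eqP xi; case: xi.
    have [yi|yi] := eqVneq (y i) 0; last by rewrite yx.
    by rewrite yi (fy.2 x i) //; case: fx.
  by rewrite dn.
have [w [Pw ws wx wz]] := Jw s sJ; have xs := Jx s sJ.
(* The tope opposite to [x] across the facet [w]. *)
have [z fz zE] := compose_full sP Pw (fullN sP fx); have [Pz _] := fz.
have [E Ez] := rp_cl cpX Pz.
have zs : Num.sg (z s) = - Num.sg (x s) by rewrite zE ws eqxx sgrN.
have sxz : Num.sg (x s) <> Num.sg (z s).
  by rewrite zs => /sgr_eqN/eqP; rewrite (negPf xs).
have wzc : conf w z by move=> i wi; rewrite zE (negPf wi).
have [adj xz] := facet_adjacent Cx Ez fx fz Pw ws wz wx wzc sxz.
exists E => //; apply: (IHn E z) => //; apply: succn_inj; rewrite -dn.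
rewrite dstC [dst x y]dstC; symmetry; apply: (@dst_step y z x s) => //.
  by rewrite sepC.
apply: (sg_other fx fy fz) => [zx|yx]; first exact/sxz/esym.
move: ys.
by rewrite -sgr_lt0 sgrM yx -expr2 ltNge sqr_ge0.
Qed.

(** A generic vector of the hyperplane of [e], composed with a tope and with its opposite, gives two
    topes that differ exactly on the class of [e]. *)
Lemma wall_exists z e : P z -> z e != 0 -> exists C D, [/\ adjacent C D &
  forall x y, rp C x -> rp D y -> sep x y = parallel_class e].
Proof.
move=> Pz ze.
pose Pe y := P y /\ y e = 0.
have sPe : subspace Pe by exact: subspace_vanish1.
have [w [[Pw we] fw]] := full_exists sPe.
have [x0 fx0] := full_exists sP.
have wz i : w i = 0 -> zle P e i by move=> wi y Py ye; apply: fw wi.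
have [x fx xE] := compose_full sP Pw fx0.
have [y fy yE] := compose_full sP Pw (fullN sP fx0).
have wx : conf w x by move=> i wi; rewrite xE (negPf wi).
have wy : conf w y by move=> i wi; rewrite yE (negPf wi).
have [C Cx] := rp_cl cpX fx.1; have [D Dy] := rp_cl cpX fy.1.
have xy : Num.sg (x e) <> Num.sg (y e).
  rewrite xE yE we eqxx sgrN => /sgr_eqN x0e.
  by rewrite (fx0.2 z e Pz x0e) eqxx in ze.
have [adj xyE] := facet_adjacent Cx Dy fx fy Pw we wz wx wy xy.
exists C, D; split=> // x' y' Cx' Dy'; rewrite -xyE; apply/setP => i.
by rewrite !inE (rp_sg Cx' Cx) (rp_sg Dy' Dy).
Qed.

(** At a coordinate where [x] vanishes the topes above [C] show both signs: compose [x] with a tope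
    and with its opposite. *)
Lemma supp_top C x e z : rp C x -> P z -> z e != 0 -> x e != 0 <->
  forall D E y y', top D -> top E -> ge D C -> ge E C -> rp D y -> rp E y' ->
    Num.sg (y e) = Num.sg (y' e).
Proof.
move=> Cx Pz ze; split=> [xe D E y y' _ _ geD geE Dy Ey'|H].
  by rewrite -(ge_conf_rp geD Dy Cx) // -(ge_conf_rp geE Ey' Cx).
apply: contra_notN (fun h => h H) => {H} /eqP xe H.
have Px := rp_in cpX Cx; have [x0 fx0] := full_exists sP.
have tope u : full P u -> exists D y, [/\ top D, ge D C, rp D y &
    Num.sg (y e) = Num.sg (u e)].
  move=> fu; have [y fy yE] := compose_full sP Px fu.
  have [D Dy] := rp_cl cpX fy.1; exists D, y; split=> //.
  - exact/(rp_top Dy).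
  - by apply: (ge_conf cpX Dy Cx) => i xi; rewrite yE (negPf xi).
  - by rewrite yE xe eqxx.
have [D [y [tD geD Dy yE]]] := tope _ fx0.
have [E [y' [tE geE Ey y'E]]] := tope _ (fullN sP fx0).
have := H D E y y' tD tE geD geE Dy Ey; rewrite yE y'E sgrN => /sgr_eqN x0e.
by rewrite (fx0.2 z e Pz x0e) eqxx in ze.
Qed.

End Topes.

Section TopeIso.
Variables (X X' : Type) (ge : rel X) (ge' : rel X') (f : X -> X') (g : X' -> X).
Hypotheses (fK : cancel f g) (gK : cancel g f).
Hypothesis fge : {mono f : x y / ge x y >-> ge' x y}.

Lemma iso_top C : top ge C -> top ge' (f C).
Proof. by move=> tC D; rewrite -[D]gK fge => /tC ->. Qed.

Lemma iso_adjacent C D : adjacent ge C D -> adjacent ge' (f C) (f D).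
Proof.
move=> [tC tD CD [W [gC gD Wmax]]]; split; [exact: iso_top.. | |].
  by move=> /(can_inj fK).
exists (f W); rewrite !fge; split=> // E; rewrite -[E]gK fge.
by move=> /Wmax[->|/iso_top]; auto.
Qed.

Lemma iso_walk n C D : walk ge n C D -> walk ge' n (f C) (f D).
Proof.
elim: n C => [C ->|n IHn C [E adj w]] //=.
by exists (f E); [exact: iso_adjacent | exact: IHn].
Qed.

End TopeIso.

Section SignIso.
Variables (F : realFieldType) (I I' : finType).
Variables (P : (I -> F) -> Prop) (P' : (I' -> F) -> Prop).
Variables (X X' : Type) (ge : rel X) (ge' : rel X').
Variables (rp : X -> (I -> F) -> Prop) (rp' : X' -> (I' -> F) -> Prop).
Variables (f : X -> X') (g : X' -> X).
Hypotheses (sP : subspace P) (sP' : subspace P').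
Hypotheses (cpX : cell_poset P (@sg_eqv F I) ge rp).
Hypothesis cpX' : cell_poset P' (@sg_eqv F I') ge' rp'.
Hypotheses (fK : cancel f g) (gK : cancel g f).
Hypothesis fge : {mono f : x y / ge x y >-> ge' x y}.

Lemma iso_dst C D x y x' y' : top ge C -> top ge D -> rp C x -> rp D y ->
  rp' (f C) x' -> rp' (f D) y' -> dst P' x' y' = dst P x y.
Proof.
move=> tC tD Cx Dy Cx' Dy'; have gge := mono_inv gK fge.
have /(rp_top sP cpX Cx) fx := tC; have /(rp_top sP cpX Dy) fy := tD.
have /(rp_top sP' cpX' Cx') fx' := iso_top gK fge tC.
have /(rp_top sP' cpX' Dy') fy' := iso_top gK fge tD.
apply/eqP; rewrite eqn_leq; apply/andP; split.
  have w := iso_walk fK gK fge (dst_walk sP cpX Cx Dy fx fy erefl).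
  exact: (walk_dst sP' cpX' w Cx' Dy' fx' fy').
have := iso_walk gK fK gge (dst_walk sP' cpX' Cx' Dy' fx' fy' erefl).
by rewrite !fK => w; apply: (walk_dst sP cpX w Cx Dy fx fy).
Qed.

(* A tope lies on the same side of the wall between two adjacent topes as the
   one of them which is nearer. *)
Lemma iso_side z e : P z -> z e != 0 -> exists e' z', [/\ P' z', z' e' != 0 &
  forall C x x', rp C x -> rp' (f C) x' -> (x e == 0) = (x' e' == 0)].
Proof.
move=> Pz ze; have [T [T0 [adj Tsep]]] := wall_exists sP cpX Pz ze.
have adj' := iso_adjacent fK gK fge adj.
have [[tT tT0 _ _] [tT' tT0' _ _]] := (adj, adj').
have [t Tt] := rp_ex cpX T; have [t0 Tt0] := rp_ex cpX T0.
have [t' Tt'] := rp_ex cpX' (f T); have [t0' Tt0'] := rp_ex cpX' (f T0).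
have tE := Tsep t t0 Tt Tt0.
have [e' tE'] := adjacent_sep sP' cpX' adj' Tt' Tt0'.
have ft := (rp_top sP cpX Tt).1 tT; have ft0 := (rp_top sP cpX Tt0).1 tT0.
have ft' := (rp_top sP' cpX' Tt').1 tT'.
have ft0' := (rp_top sP' cpX' Tt0').1 tT0'.
have t'e' : t' e' != 0.
  have := parallel_refl P' e'; rewrite -tE' inE; apply: contraNneq => te.
  by rewrite te (ft'.2 t0' e') ?eqxx //; case: ft0'.
have near (J : finType) (Q : (J -> F) -> Prop) u v v0 (j : J) : subspace Q ->
    full Q u -> full Q v -> full Q v0 -> sep v v0 = parallel_class Q j ->
    Num.sg (u j) = Num.sg (v j) <-> (dst Q u v < dst Q u v0)%N.
  move=> sQ fu fv fv0 vE; split=> [uv|lt].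
    by rewrite (dst_step sQ fu fv fv0 vE uv).
  apply: contrapT => uv.
  have jv : j \in sep v v0 by rewrite vE parallel_refl.
  have vE0 : sep v0 v = parallel_class Q j by rewrite sepC.
  have uv0 : Num.sg (u j) = Num.sg (v0 j).
    apply: (sg_other fv fu fv0) => //; move: jv; rewrite inE eq_sym.
    by move/eqP.
  by move: lt; rewrite (dst_step sQ fu fv0 fv vE0 uv0) ltnNge leqnSn.
have side C x x' : top ge C -> rp C x -> rp' (f C) x' ->
    Num.sg (x e) = Num.sg (t e) <-> Num.sg (x' e') = Num.sg (t' e').
  move=> tC Cx Cx'; have fx := (rp_top sP cpX Cx).1 tC.
  have fx' := (rp_top sP' cpX' Cx').1 (iso_top gK fge tC).
  rewrite (near _ _ _ _ _ _ sP fx ft ft0 tE).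
  rewrite (near _ _ _ _ _ _ sP' fx' ft' ft0' tE').
  by rewrite (iso_dst tC tT Cx Tt Cx' Tt') (iso_dst tC tT0 Cx Tt0 Cx' Tt0').
have te0 : t e != 0 by apply: contraNneq ze => te; rewrite (ft.2 z e Pz te).
have two (J : finType) (Q : (J -> F) -> Prop) (u v v0 : J -> F) (j : J) :
    full Q u -> full Q v -> full Q v0 ->
    (Num.sg (u j) = Num.sg (v0 j) <-> Num.sg (v j) = Num.sg (v0 j)) ->
    Num.sg (u j) = Num.sg (v j).
  move=> fu fv fv0 uv; have [uE|/eqP uE] := eqVneq (Num.sg (u j)) (Num.sg (v0 j)).
    by rewrite (uv.1 uE).
  by apply: (sg_other fv0 fu fv) => // vE; apply: uE; apply: uv.2.
exists e', t'; split=> //; first by case: ft'.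
move=> C x x' Cx Cx'; apply: negb_inj; apply/idP/idP => [xe|x'e]; last first.
  apply/(supp_top sP cpX Cx Pz ze) => D E y y' tD tE0 geD geE Dy Ey.
  have [u Du] := rp_ex cpX' (f D); have [u' Eu] := rp_ex cpX' (f E).
  have fy := (rp_top sP cpX Dy).1 tD; have fy' := (rp_top sP cpX Ey).1 tE0.
  apply: (two _ P y y' t e fy fy' ft).
  rewrite (side D y u tD Dy Du) (side E y' u' tE0 Ey Eu).
  suff -> : Num.sg (u e') = Num.sg (u' e') by [].
  have H := (supp_top sP' cpX' Cx' ft'.1 t'e').1 x'e.
  by apply: (H (f D) (f E)); rewrite ?fge //; apply: (iso_top gK fge).
apply/(supp_top sP' cpX' Cx' ft'.1 t'e') => D E u u' tD tE0 geD geE Du Eu.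
have gge := mono_inv gK fge.
have tgD := iso_top fK gge tD; have tgE := iso_top fK gge tE0.
have [y Dy] := rp_ex cpX (g D); have [y' Ey] := rp_ex cpX (g E).
have fu := (rp_top sP' cpX' Du).1 tD; have fu' := (rp_top sP' cpX' Eu).1 tE0.
rewrite -[D]gK in Du; rewrite -[E]gK in Eu.
apply: (two _ P' u u' t' e' fu fu' ft').
rewrite -(side (g D) y u tgD Dy Du) -(side (g E) y' u' tgE Ey Eu).
suff -> : Num.sg (y e) = Num.sg (y' e) by [].
have H := (supp_top sP cpX Cx Pz ze).1 xe.
by apply: (H (g D) (g E)) => //; rewrite -fge gK.
Qed.

End SignIso.

Lemma sign_iso_supp (F : realFieldType) (I I' : finType) P P' (X X' : Type)
    (ge : rel X) (ge' : rel X') (rp : X -> (I -> F) -> Prop)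
    (rp' : X' -> (I' -> F) -> Prop) (f : X -> X') (g : X' -> X) :
  subspace P -> subspace P' ->
  cell_poset P (@sg_eqv F I) ge rp -> cell_poset P' (@sg_eqv F I') ge' rp' ->
  cancel f g -> cancel g f -> {mono f : x y / ge x y >-> ge' x y} ->
  supp_mono rp rp' f.
Proof.
move=> sP sP' cpX cpX' fK gK fge C D x y x' y' Cx Dy Cx' Dy' xy i y'i.
apply/eqP/negPn/negP => x'i.
have gge := mono_inv gK fge.
have [j [z [_ _ jE]]] := iso_side sP' sP cpX' cpX gK fK gge (rp_in cpX' Cx') x'i.
move: x'i; rewrite (jE (f C) x' x) ?fK // xy ?eqxx //.
by apply/eqP; rewrite -(jE (f D) y' y) ?fK // y'i.
Qed.

(** * Flows on graphs *)

Section Flows.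
Variables (F : realFieldType) (G : graph).
Implicit Types (x y p : edge G -> F) (e : edge G) (u v : vert G).

Definition net x v := \sum_(e | tgt e == v) x e - \sum_(e | src e == v) x e.

Definition isflow x : Prop := forall v, net x v = 0.

Lemma net_lin a b x y v :
  net (fun e => a * x e + b * y e) v = a * net x v + b * net y v.
Proof.
rewrite /net !big_split /= -!mulr_sumr; ring.
Qed.

Lemma isflow_subspace : subspace isflow.
Proof.
split=> [v|a b x y fx fy v]; first by rewrite /net !big1 ?subrr.
by rewrite net_lin fx fy !mulr0 addr0.
Qed.

Lemma sum_net x (K : {set vert G}) : \sum_(v in K) net x v =
  \sum_(e | tgt e \in K) x e - \sum_(e | src e \in K) x e.
Proof.
rewrite sumrB; congr (_ - _).
  rewrite [RHS](partition_big (@tgt G) (mem K)) //=; apply: eq_bigr => v vK.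
  by apply: eq_bigl => e; rewrite andbC; case: eqP => // ->; rewrite vK.
rewrite [RHS](partition_big (@src G) (mem K)) //=; apply: eq_bigr => v vK.
by apply: eq_bigl => e; rewrite andbC; case: eqP => // ->; rewrite vK.
Qed.

Lemma cut_sum x (K : {set vert G}) : isflow x ->
  \sum_(e | (tgt e \in K) && (src e \notin K)) x e =
  \sum_(e | (src e \in K) && (tgt e \notin K)) x e.
Proof.
move=> fx; have /eqP : \sum_(v in K) net x v = 0 by rewrite big1.
rewrite sum_net subr_eq0 (bigID (fun e => src e \in K)) /=.
rewrite [X in _ == X](bigID (fun e => tgt e \in K)) /=.
rewrite (eq_bigl (fun e => (src e \in K) && (tgt e \in K))) => [|e].
  by move=> /eqP/addrI.
by rewrite andbC.
Qed.

Lemma net_delta e0 (a : F) v : net (fun e => a * (e == e0)%:R) v =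
  a * ((tgt e0 == v)%:R - (src e0 == v)%:R).
Proof.
have sumE (f : edge G -> vert G) :
    \sum_(e | f e == v) a * (e == e0)%:R = a * (f e0 == v)%:R.
  rewrite big_mkcond (bigD1 e0) //= big1 ?addr0 ?eqxx => [|e /negPf->].
    by case: eqP; rewrite ?mulr0.
  by rewrite mulr0; case: ifP.
by rewrite /net !sumE mulrBr.
Qed.

(* [al e true] and [al e false] allow to walk along [e] forwards, backwards. *)
Definition arc (al : edge G -> bool -> bool) : rel (vert G) := fun u v =>
  [exists e, (al e true && (src e == u) && (tgt e == v)) ||
             (al e false && (tgt e == u) && (src e == v))].

Lemma arc_path al u q : path (arc al) u q -> uniq (u :: q) ->
  exists p, [/\ forall e, [\/ p e = 0, p e = 1 /\ al e true |
                             p e = -1 /\ al e false],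
    forall v, net p v = (last u q == v)%:R - (u == v)%:R &
    forall e, p e != 0 -> (src e \in u :: q) && (tgt e \in u :: q)].
Proof.
elim: q u => [|w q IHq] u /=.
  move=> _ _; exists (fun=> 0); split=> [e|v|e]; first by constructor 1.
    by rewrite isflow_subspace.1 subrr.
  by rewrite eqxx.
move=> /andP[/existsP[e0 arc0] pq] /andP[uq unq].
have [p [p01 netp pq0]] := IHq w pq unq.
have pe0 : p e0 = 0.
  apply/eqP/negPn/negP => /pq0; case/orP: arc0 => /andP[/andP[_ /eqP-> _]];
    by rewrite (negPf uq) ?andbF.
have [a [a1 aE ends]] : exists a : F,
    [/\ a = 1 /\ al e0 true \/ a = -1 /\ al e0 false,
        forall v, a * ((tgt e0 == v)%:R - (src e0 == v)%:R) =
          (w == v)%:R - (u == v)%:R :> F &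
        (src e0 \in u :: w :: q) && (tgt e0 \in u :: w :: q)].
  case/orP: arc0 => /andP[/andP[al0 /eqP<-] /eqP<-].
    by exists 1; rewrite !inE !eqxx !orbT; split=> // [|v]; [left | rewrite mul1r].
  exists (-1); rewrite !inE !eqxx !orbT; split=> // [|v]; first by right.
  by rewrite mulN1r opprB.
exists (fun e => 1 * p e + 1 * (a * (e == e0)%:R)); split=> [e|v|e].
- have [->|ne] := eqVneq e e0; last by rewrite mulr0 mulr0 addr0 mul1r.
  rewrite pe0 mulr0 add0r mulr1 mul1r.
  by case: a1 => -[-> al0]; [constructor 2 | constructor 3].
- by rewrite net_lin netp net_delta aE; ring.
have [->//|ne] := eqVneq e e0; rewrite mulr0 mulr0 addr0 mul1r => /pq0.
by rewrite !inE; case/andP => -> ->; rewrite !orbT.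
Qed.

Lemma connect_arc al u v : connect (arc al) u v ->
  exists p, (forall e, [\/ p e = 0, p e = 1 /\ al e true |
                          p e = -1 /\ al e false]) /\
    forall w, net p w = (v == w)%:R - (u == w)%:R.
Proof.
case/connectP => q0 pq0 ->; case/shortenP: pq0 => q pq uq _.
by have [p [p01 netp _]] := arc_path pq uq; exists p.
Qed.

(** [N] is a subgroup of [F]: zero alone for supports, the integers for Delaunay cells. If [e] were
    the only edge of a cut with value outside [N], conservation across the cut would put [x e] in
    [N]. *)
Lemma connect_of_cut x e (N : F -> Prop) : isflow x -> N 0 ->
    (forall a b, N a -> N b -> N (a - b)) -> ~ N (x e) ->
  connect (arc (fun e' _ => (e' != e) && `[< ~ N (x e') >])) (src e) (tgt e).
Proof.
move=> fx N0 NB Ne; set al := fun _ _ => _.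
have NN a : N a -> N (- a) by rewrite -[- a]sub0r; apply: NB.
have ND a b : N a -> N b -> N (a + b) by move=> Na /NN/(NB _ _ Na); rewrite opprK.
pose K := [set v | connect (arc al) (src e) v].
have srcK : src e \in K by rewrite inE connect0.
apply: contrapT => /negP; have -> : connect (arc al) (src e) (tgt e) =
  (tgt e \in K) by rewrite inE.
move=> tgtK; have := cut_sum K fx.
rewrite [RHS](bigD1 e) ?srcK //= => /(canLR (addrK _)) eE.
apply: Ne; rewrite -eE.
have closed e' u v : e' != e -> u \in K -> v \notin K ->
    (src e' == u) && (tgt e' == v) || (tgt e' == u) && (src e' == v) ->
    N (x e').
  move=> ne; rewrite !inE => Ku Kv ends; apply: contrapT => Ne'.
  apply: (negP Kv); apply: connect_trans Ku (connect1 _).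
  apply/existsP; exists e'; rewrite /al ne /=.
  by move: ends; case: asboolP.
apply: NB; apply: big_ind => // e'.
  move=> /andP[tK sK]; apply: (closed e' (tgt e') (src e')) => //.
    by apply: contraNneq tgtK => <-.
  by rewrite !eqxx orbT.
move=> /andP[/andP[sK tK] ne]; apply: (closed e' (src e') (tgt e')) => //.
by rewrite !eqxx.
Qed.

(** Otherwise the set reached from the head of [e] by following the direction of the flow would
    receive flow through [e] and release none. *)
Lemma connect_of_sign x e (b := 0 < x e) : isflow x -> x e != 0 ->
  connect (arc (fun e' c => (e' != e) && (if c then 0 < x e' else x e' < 0)))
    (if b then tgt e else src e) (if b then src e else tgt e).
Proof.
move=> fx xe; set al := fun _ _ => _; set u := (X in connect _ X).
set v := (X in connect _ _ X).
pose K := [set w | connect (arc al) u w].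
have uK : u \in K by rewrite inE connect0.
apply: contrapT => /negP; have -> : connect (arc al) u v = (v \in K) by rewrite inE.
move=> vK.
have closed e' a w c : e' != e -> a \in K -> w \notin K ->
    (if c then (src e' == a) && (tgt e' == w) else
       (tgt e' == a) && (src e' == w)) ->
    ~ (if c then 0 < x e' else x e' < 0).
  move=> ne; rewrite !inE => Ka Kw ends xc.
  apply: (negP Kw); apply: connect_trans Ka (connect1 _).
  by apply/existsP; exists e'; rewrite /al ne /=; case: c ends xc => /= /andP[-> ->] ->;
    rewrite ?orbT.
have cin e' : (tgt e' \in K) && (src e' \notin K) -> e' != e -> 0 <= x e'.
  move=> /andP[tK sK] ne; rewrite leNgt; apply/negP.
  by apply: (closed e' (tgt e') (src e') false) => //; rewrite !eqxx.
have cout e' : (src e' \in K) && (tgt e' \notin K) -> e' != e -> x e' <= 0.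
  move=> /andP[sK tK] ne; rewrite leNgt; apply/negP.
  by apply: (closed e' (src e') (tgt e') true) => //; rewrite !eqxx.
have := cut_sum K fx; move: uK vK; rewrite /u /v /b.
have := xe; rewrite neq_lt => /orP[xe0|xe0]; rewrite ?(lt_gtF xe0) ?xe0 => sK tK.
  rewrite [RHS](bigD1 e) ?sK //= => E.
  have : 0 <= \sum_(e' | (tgt e' \in K) && (src e' \notin K)) x e'.
    apply: sumr_ge0 => e' H; apply: cin => //.
    by apply: contraTneq H => ->; rewrite sK andbF.
  rewrite E leNgt => /negP; apply; apply: ltr_wnDr => //.
  by apply: sumr_le0 => e' /andP[H ne]; apply: cout.
rewrite (bigD1 e) ?sK //= => E.
have : \sum_(e' | (src e' \in K) && (tgt e' \notin K)) x e' <= 0.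
  apply: sumr_le0 => e' H; apply: cout => //.
  by apply: contraTneq H => ->; rewrite sK andbF.
rewrite -E leNgt => /negP; apply; apply: ltr_wpDr => //.
by apply: sumr_ge0 => e' /andP[H ne]; apply: cin.
Qed.

Definition unimodular x := forall e, [\/ x e = 0, x e = 1 | x e = -1].

Lemma flow_through e (b : bool) al :
    connect (arc (fun e' c => (e' != e) && al e' c))
      (if b then tgt e else src e) (if b then src e else tgt e) ->
  exists y, [/\ isflow y, unimodular y, y e = (-1) ^+ (~~ b) &
    forall e', e' != e -> [\/ y e' = 0, y e' = 1 /\ al e' true |
                             y e' = -1 /\ al e' false]].
Proof.
move=> /connect_arc[p [p01 netp]].
have pe : p e = 0 by case: (p01 e) => [//|[_]|[_]]; rewrite eqxx.
pose y e' := 1 * p e' + 1 * ((-1) ^+ (~~ b) * (e' == e)%:R).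
have ye' e' : e' != e -> y e' = p e'.
  by rewrite /y => /negPf->; rewrite !mulr0 addr0 mul1r.
have ye : y e = (-1) ^+ (~~ b) by rewrite /y pe eqxx mulr1 !mul1r add0r.
exists y; split=> [v|e'|//|e' ne].
- by rewrite net_lin netp net_delta; case: (b); rewrite /= ?expr0 ?expr1; ring.
- have [->|ne] := eqVneq e' e; last first.
    by rewrite ye' //; case: (p01 e') => [->|[->]|[->]]; constructor.
  by rewrite ye; case: (b); rewrite /= ?expr0 ?expr1; constructor.
by rewrite ye' //; case: (p01 e') => [->|[-> /andP[_ H]]|[-> /andP[_ H]]];
  [constructor 1 | constructor 2 | constructor 3].
Qed.

Lemma unimodular_conf x e : isflow x -> x e != 0 ->
  exists y, [/\ isflow y, unimodular y, y e != 0 & conf y x].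
Proof.
move=> fx xe; have c := connect_of_sign fx xe.
have [y [fy uy ye yal]] := flow_through c.
exists y; split=> //; first by rewrite ye signr_eq0.
move=> e' ye'; have [E|ne] := eqVneq e' e; last first.
  have [y0|[-> /gtr0_sg->]|[-> /ltr0_sg->]] := yal e' ne.
  - by rewrite y0 eqxx in ye'.
  - by rewrite sgr1.
  - by rewrite sgrN sgr1.
rewrite E ye; have := xe; rewrite neq_lt => /orP[x0|x0].
  by rewrite (lt_gtF x0) (ltr0_sg x0) /= expr1 sgrN sgr1.
by rewrite x0 (gtr0_sg x0) expr0 sgr1.
Qed.

Lemma unimodular_avoid x e (N : F -> Prop) : isflow x -> N 0 ->
    (forall a b, N a -> N b -> N (a - b)) -> ~ N (x e) ->
  exists y, [/\ isflow y, unimodular y, y e != 0 &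
    forall e', N (x e') -> y e' = 0].
Proof.
move=> fx N0 NB Ne; have c := connect_of_cut fx N0 NB Ne.
have [y [fy uy ye yal]] := @flow_through e false (fun e' _ => `[< ~ N (x e') >]) c.
exists y; split=> // [|e' Ne']; first by rewrite ye signr_eq0.
have ne : e' != e by apply: contraPneq Ne' => ->.
by have [//|[_ /asboolP]|[_ /asboolP]] := yal e' ne.
Qed.

End Flows.

(** * Separating edges and pairs *)

Section Separation.
Variables (F : realFieldType) (G : graph).
Local Notation flow := (@isflow F G).
Implicit Types (x y : edge G -> F) (e f : edge G) (S : {set edge G}).

(** A circuit is a multiple of a flow with values 0, 1, -1 conforming to it, given by a directed
    cycle. *)
Lemma flow_regular : regular flow.
Proof.
move=> c [fc _ elc] i j ci cj; have [y [fy uy yi yc]] := unimodular_conf fc ci.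
have [|t yt] := elc y fy; first by move=> k; apply: conf_supp yc.
have t0 : t != 0 by apply: contraNneq yi => t0; rewrite yt t0 mul0r.
have sq k : c k != 0 -> t * c k = 1 \/ t * c k = -1.
  move=> ck; rewrite -yt; case: (uy k) => [yk|->|->]; [|by left|by right].
  by have := mulf_neq0 t0 ck; rewrite -yt yk eqxx.
by case: (sq i ci) (sq j cj) => Ei [] Ej; [left|right|right|left];
  apply: (mulfI t0); rewrite ?mulrN Ei Ej ?opprK.
Qed.

(** Connectedness in [delete S] (see [conn_delete]), kept on the edges of [G] to avoid the subtype
    of the remaining edges. *)
Definition walkable S : rel (vert G) := connect (arc (fun e _ => e \notin S)).

Lemma walkable_sym S u v : walkable S u v = walkable S v u.
Proof.
apply: sym_connect_sym => {u v} u v; apply/existsP/existsP => -[e H];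
  by exists e; move: H; rewrite -!andbA -!andb_orr orbC => /andP[-> H] /=;
    move: H; rewrite andbC [X in _ || X]andbC.
Qed.

Lemma walkable_trans S v u w : walkable S u v -> walkable S v w -> walkable S u w.
Proof. exact: connect_trans. Qed.

Lemma conn_delete S : @conn (delete S) =2 walkable S.
Proof.
apply: eq_connect => u v; apply/existsP/existsP => [[[e eS] /= H]|[e H]].
  by exists e; rewrite eS /= ; move: H; rewrite [X in _ || X]andbC.
have [eS|eS] := boolP (e \in S); first by rewrite eS in H.
exists (exist _ e eS) => /=; move: H; rewrite eS /=.
by rewrite [X in _ || X]andbC.
Qed.

Lemma conn_walkable : @conn G =2 walkable set0.
Proof.
apply: eq_connect => u v; apply: eq_existsb => e; rewrite inE /=.
by congr (_ || _); rewrite andbC.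
Qed.

(** Both sides say that [e] lies on a cycle avoiding [S]. *)
Lemma walkable_flow S e : e \notin S -> reflect
  (exists x, [/\ flow x, x e != 0 & forall f, f \in S -> x f = 0])
  (walkable (e |: S) (src e) (tgt e)).
Proof.
move=> eS; apply: (iffP idP) => [w|[x [fx xe xS]]].
  have [|y [fy _ ye yS]] := @flow_through F G e false (fun f _ => f \notin S).
    apply: connect_sub w => u v /existsP[f H]; apply: connect1.
    by apply/existsP; exists f; move: H; rewrite in_setU1 negb_or.
  exists y; split=> //; first by rewrite ye signr_eq0.
  move=> f fS; have ne : f != e by apply: contraNneq eS => <-.
  by have [//|[_]|[_]] := yS f ne; rewrite fS.
have c : connect (arc (fun f _ => (f != e) && `[< x f <> 0 >])) (src e) (tgt e).
  by apply: (connect_of_cut fx (N := fun a => a = 0)) => [//|a b -> ->|/eqP];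
    rewrite ?subr0 // (negPf xe).
apply: connect_sub c => u v /existsP[f H]; apply: connect1; apply/existsP.
exists f; have [xf|xf] := pselect (x f = 0).
  by rewrite (asboolF (fun h => h xf)) andbF in H.
rewrite (asboolT xf) andbT in H.
rewrite in_setU1 negb_or; have [fS|fS] := boolP (f \in S); first by case: xf; apply: xS.
by rewrite andbT.
Qed.

Lemma walkable_bypass S e u v : walkable (e |: S) (src e) (tgt e) ->
  walkable S u v -> walkable (e |: S) u v.
Proof.
move=> we; apply: connect_sub => {u v} u v /existsP[f H].
have [E|ne] := eqVneq f e; last first.
  apply: connect1; apply/existsP; exists f.
  by rewrite in_setU1 negb_or ne.
rewrite E in H; case/orP: H => /andP[/andP[_ /eqP<-] /eqP<-] //.
by rewrite -/(walkable _ _ _) walkable_sym.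
Qed.

Lemma walkable_edge S e : e \notin S -> walkable S (src e) (tgt e).
Proof.
by move=> eS; apply/connect1/existsP; exists e; rewrite eS !eqxx.
Qed.

Lemma conn_ends u e : conn u (src e) = conn u (tgt e).
Proof.
have w : walkable set0 (src e) (tgt e) by apply: walkable_edge; rewrite inE.
rewrite !conn_walkable; apply/idP/idP => h; first exact: walkable_trans h w.
by apply: walkable_trans h _; rewrite walkable_sym.
Qed.

Lemma separatingP e : reflect (forall x, flow x -> x e = 0) (separating e).
Proof.
have e0 : e \notin (set0 : {set edge G}) by rewrite inE.
have e0E : e |: set0 = [set e] by rewrite setU0.
apply: (iffP existsP) => [[u /andP[ue /existsP[v /andP[ve nuv]]]] x fx|none].
  apply/eqP/negPn/negP => xe; move: nuv; rewrite conn_delete => /negP; apply.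
  have we : walkable [set e] (src e) (tgt e).
    by rewrite -e0E; apply/(walkable_flow e0); exists x; split=> // f; rewrite inE.
  rewrite -e0E; apply: walkable_bypass; first by rewrite e0E.
  rewrite !inE !conn_walkable in ue ve.
  by apply: walkable_trans ve; rewrite walkable_sym.
exists (src e); rewrite inE conn_walkable {1}/walkable connect0; apply/existsP.
exists (tgt e); rewrite inE conn_walkable walkable_edge //= conn_delete -e0E.
by apply/negP => /(walkable_flow e0)[x [fx xe _]]; rewrite none ?eqxx in xe.
Qed.

(** A generic flow is nonzero on every edge where some flow is, thus on every edge that is not a
    bridge. *)
Lemma no_separatingP : reflect
  (exists2 x, flow x & forall e, x e != 0) (no_separating G).
Proof.
apply: (iffP forallP) => [ns|[x fx xn] e]; last first.
  by apply/negP => /separatingP/(_ x fx) xe; have := xn e; rewrite xe eqxx.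
have [x [fx xfull]] := full_exists (isflow_subspace F G).
exists x => // e; have := ns e; apply: contraNneq => xe.
by apply/separatingP => y fy; apply: xfull.
Qed.

Lemma flow_restrict x (K : {set vert G}) :
  (forall e, x e != 0 -> (src e \in K) = (tgt e \in K)) -> flow x ->
  flow (fun e => if src e \in K then x e else 0).
Proof.
move=> cK fx v; have [vK|vK] := boolP (v \in K).
  rewrite -(fx v); congr (_ - _); apply: eq_bigr => e /eqP ev.
    have [->|xe] := eqVneq (x e) 0; first by case: ifP.
    by rewrite cK // ev vK.
  by rewrite ev vK.
have out e : (tgt e == v) || (src e == v) -> (if src e \in K then x e else 0) = 0.
  have [->|xe] := eqVneq (x e) 0; first by case: ifP.
  case/orP=> /eqP ev; last by rewrite ev (negPf vK).
  by rewrite cK // ev (negPf vK).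
by rewrite /net !big1 ?subrr // => e ev; apply: out; rewrite ev ?orbT.
Qed.

Lemma separating_pairP e f : reflect
  [/\ e != f, exists2 x, flow x & x e != 0, exists2 x, flow x & x f != 0 &
      zle flow e f]
  (separating_pair e f).
Proof.
have nsep g : reflect (exists2 x, flow x & x g != 0) (~~ separating g).
  apply: (iffP idP) => [/separatingP ns|[x fx xg]]; last first.
    by apply/negP => /separatingP/(_ x fx) x0; rewrite x0 eqxx in xg.
  apply: contrapT => no; apply: ns => x fx; apply/eqP/negPn/negP => xg.
  by apply: no; exists x.
have e0 : e \notin (set0 : {set edge G}) by rewrite inE.
have e0E : e |: set0 = [set e] by rewrite setU0.
apply: (iffP and5P) => [[ef /nsep[xe fxe xen] nf _]|[ef ne [x fx xf] zef]].
  move=> /existsP[u /andP[ue /existsP[v /andP[ve nuv]]]]; split=> //.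
  - by exists xe.
  - exact/nsep.
  move=> y fy ye; apply/eqP/negPn/negP => yf.
  move: nuv; rewrite conn_delete => /negP; apply.
  have -> : [set e; f] = f |: [set e] by rewrite setUC.
  apply: walkable_bypass.
    apply/walkable_flow; first by rewrite inE eq_sym.
    by exists y; split=> // g; rewrite inE => /eqP->.
  rewrite -e0E; apply: walkable_bypass.
    by apply/(walkable_flow e0); exists xe; split=> // g; rewrite inE.
  rewrite !inE !conn_walkable in ue ve.
  by apply: walkable_trans ve; rewrite walkable_sym.
(* For edges in different components, the restriction of [x] to the component of [f] would be a flow
   vanishing at [e] but not at [f]. *)
have nef : conn (src e) (src f).
  apply/negPn/negP => ncon.
  pose K := [set v | conn (src f) v].
  have fK : flow (fun g => if src g \in K then x g else 0).
    by apply: flow_restrict fx => g _; rewrite !inE conn_ends.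
  have eK : src e \in K = false.
    by rewrite inE conn_walkable walkable_sym -conn_walkable; apply: negPf.
  have := zef _ fK; rewrite eK => /(_ erefl); rewrite inE conn_walkable.
  by rewrite {1}/walkable connect0 => xf0; rewrite xf0 eqxx in xf.
split=> //; [exact/nsep | by apply/nsep; exists x |].
apply/existsP; exists (src f); rewrite inE nef; apply/existsP; exists (tgt f).
apply/andP; split.
  rewrite inE; move: nef; rewrite !conn_walkable => /walkable_trans; apply.
  by apply: walkable_edge; rewrite inE.
rewrite conn_delete setUC; apply/negP => /walkable_flow[].
  by rewrite inE eq_sym.
move=> y [fy yf y0]; rewrite zef ?eqxx // in yf; apply: y0; by rewrite inE.
Qed.

End Separation.

Section Extension.
Variables (F : realFieldType) (T : finType) (p : pred T).

Definition ext (x : {e | p e} -> F) (e : T) : F :=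
  if insub e is Some u then x u else 0.

Lemma ext_val x u : ext x (val u) = x u.
Proof. by rewrite /ext valK. Qed.

Lemma ext_out x e : ~~ p e -> ext x e = 0.
Proof. by move=> pe; rewrite /ext insubN. Qed.

Lemma ext_res (y : T -> F) : (forall e, ~~ p e -> y e = 0) ->
  ext (fun u => y (val u)) = y.
Proof.
move=> y0; apply: funext => e; rewrite /ext; case: insubP => [u _ ->//|pe].
by rewrite y0.
Qed.

Lemma sum_ext x (q : pred T) :
  \sum_(u : {e | p e} | q (val u)) x u = \sum_(e | q e) ext x e.
Proof.
rewrite [RHS](bigID p) /= [X in _ + X]big1 ?addr0; last first.
  by move=> e /andP[_ pe]; rewrite ext_out.
rewrite (reindex_omap (val : {e | p e} -> T) insub) => [|e /andP[_ pe]]; last first.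
  by rewrite insubT.
apply: eq_big => [u|u _]; last by rewrite ext_val.
by rewrite valK eqxx andbT (valP u) andbT.
Qed.

End Extension.

Section Subgraphs.
Variables (F : realFieldType) (G : graph).

Lemma flow_delete (S : {set edge G}) (x : edge (delete S) -> F) :
  isflow x <-> isflow (ext x).
Proof.
have E v : @net F (delete S) x v = @net F G (ext x) v.
  rewrite /net; congr (_ - _).
    exact: (@sum_ext F _ (fun e => e \notin S) x (fun e => tgt e == v)).
  exact: (@sum_ext F _ (fun e => e \notin S) x (fun e => src e == v)).
by split=> fx v; move: (fx v); rewrite E.
Qed.

Lemma flow_subgraph (W : {set vert G}) (A : {set edge G})
    (x : edge (subgraph W A) -> F) : isflow x <-> isflow (ext x).
Proof.
have E w : @net F (subgraph W A) x w = @net F G (ext x) (val w).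
  rewrite /net; congr (_ - _).
    exact: (@sum_ext F _ (fun e => [&& e \in A, src e \in W & tgt e \in W])
      x (fun e => tgt e == val w)).
  exact: (@sum_ext F _ (fun e => [&& e \in A, src e \in W & tgt e \in W])
    x (fun e => src e == val w)).
split=> fx v; last by rewrite E.
have [vW|vW] := boolP (v \in W); first by have := fx (exist _ v vW); rewrite E.
rewrite /net !big1 ?subrr // => e /eqP ev; rewrite ext_out // ev (negPf vW) ?andbF //.
Qed.

Lemma no_separating_delete (S : {set edge G}) : reflect
  (exists2 x : edge G -> F, isflow x & forall e, (x e != 0) = (e \notin S))
  (no_separating (delete S)).
Proof.
apply: (iffP (no_separatingP F _)) => [[x fx xn]|[x fx xS]].
  exists (ext x) => [|e]; first exact/flow_delete.
  have [eS|eS] := boolP (e \in S); first by rewrite ext_out ?eqxx // eS.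
  by have := ext_val x (exist _ e eS) => /= ->; rewrite xn.
exists (fun u => x (val u)) => [|u]; last by rewrite xS (valP u).
apply/flow_delete; rewrite ext_res // => e; rewrite negbK => eS.
by apply/eqP/negPn; rewrite xS eS.
Qed.

End Subgraphs.

(** * Contraction and the poset of supports *)

Section Contraction.
Variables (F : realFieldType) (G : graph) (T : {set edge G}).

Lemma mem_block u v : (u \in block T v) = walkable (~: T) v u.
Proof. by rewrite inE conn_delete. Qed.

Lemma to_blockE u (B : contract_vert T) : (to_block T u == B) = (u \in val B).
Proof.
case: B => B exB /=; have /existsP[w /eqP Bw] := exB.
rewrite -val_eqE /= {}Bw mem_block; apply/eqP/idP => [E|wu].
  by rewrite -mem_block -E mem_block /walkable connect0.
apply/setP => v; rewrite !mem_block; apply/idP/idP; apply: walkable_trans => //.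
by rewrite walkable_sym.
Qed.

Lemma block_edge e (B : contract_vert T) : e \in T ->
  (src e \in val B) = (tgt e \in val B).
Proof.
move=> eT; rewrite -!to_blockE; congr (_ == _); apply: val_inj => /=.
have w : walkable (~: T) (src e) (tgt e) by apply: walkable_edge; rewrite inE negbK.
apply/setP => v; rewrite !mem_block; apply/idP/idP; apply: walkable_trans => //.
by rewrite walkable_sym.
Qed.

Lemma net_contract (x : edge (contract T) -> F) B :
  net x B = \sum_(v in val B) net (ext x) v.
Proof.
rewrite sum_net /net; congr (_ - _).
  rewrite -(@sum_ext F _ (fun e => e \notin T) x (fun e => tgt e \in val B)).
  by apply: eq_bigl => u; rewrite -to_blockE.
rewrite -(@sum_ext F _ (fun e => e \notin T) x (fun e => src e \in val B)).
by apply: eq_bigl => u; rewrite -to_blockE.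
Qed.

Lemma flow_contract (y : edge G -> F) : isflow y ->
  isflow (fun u : edge (contract T) => y (val u)).
Proof.
move=> fy B; rewrite net_contract.
rewrite -[RHS](@big1 F 0 +%R _ (index_enum (vert G))
  (fun v => v \in val B) (net y)) => [|v _]; last exact: fy.
have cutE (z : edge G -> F) : \sum_(v in val B) net z v = \sum_e
    ((if tgt e \in val B then z e else 0) - (if src e \in val B then z e else 0)).
  by rewrite sum_net sumrB -!big_mkcond.
rewrite !cutE; apply: eq_bigr => e _.
have [eT|eT] := boolP (e \in T); first by rewrite (block_edge B eT) !subrr.
by have := ext_val (fun u : edge (contract T) => y (val u)) (exist _ e eT) => /= ->.
Qed.

(** The extension of [x] by zero has some excess at each vertex. It is sent through [T] to the root
    of the block, where the total excess is the net flow of [x] at this block, that is zero. *)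
Lemma flow_lift (x : edge (contract T) -> F) : isflow x ->
  exists2 y : edge G -> F, isflow y & forall u, y (val u) = x u.
Proof.
move=> fx; pose step : rel (vert G) := arc (fun e _ => e \notin ~: T).
have step_sym : connect_sym step by move=> u v; exact: walkable_sym.
have paths v : exists p : edge G -> F, (forall e, e \notin T -> p e = 0) /\
    forall w, net p w = (fingraph.root step v == w)%:R - (v == w)%:R.
  have /(@connect_arc F)[p [p01 pnet]] := connect_root step v.
  exists p; split=> // e eT.
  by have [//|[_]|[_]] := p01 e; rewrite inE eT.
have [P PP] := choice paths.
pose r v := net (ext x) v.
exists (fun e => 1 * ext x e + 1 * (\sum_v r v * P v e)) => [w|u]; last first.
  rewrite ext_val big1 ?mulr0 ?addr0 ?mul1r // => v _.
  by rewrite (PP v).1 ?mulr0 //; exact: (valP u).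
have netS : net (fun e => \sum_v r v * P v e) w = \sum_v r v * net (P v) w.
  rewrite /net exchange_big /= [X in _ - X]exchange_big -sumrB.
  by apply: eq_bigr => v _; rewrite -!mulr_sumr mulrBr.
rewrite net_lin netS !mul1r.
under eq_bigr do rewrite (PP _).2 mulrBr.
have deltaE : \sum_v r v * (v == w)%:R = r w.
  rewrite (bigD1 w) //= eqxx mulr1 big1 ?addr0 // => v /negPf->.
  by rewrite mulr0.
rewrite sumrB deltaE addrCA subrr addr0.
under eq_bigr do rewrite mulr_natr mulrb.
rewrite -big_mkcond /=.
have [[v0 /eqP v0w]|no] := pselect (exists v, fingraph.root step v == w); last first.
  by rewrite big1 // => v vw; case: no; exists v.
rewrite -[RHS](fx (to_block T w)) net_contract; apply: eq_bigl => v /=.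
have -> : (v \in block T w) = (fingraph.root step w == fingraph.root step v).
  by rewrite mem_block fingraph.root_connect.
by rewrite eq_sym -v0w fingraph.root_root.
Qed.

End Contraction.

(** * Order isomorphisms and the poset of supports *)

Section OrderIso.
Variables (A B : Type) (leA : rel A) (leB : rel B).

(** Allows an isomorphism to be given by a correspondence between representatives; antisymmetry
    makes the two chosen maps mutually inverse. *)
Lemma order_iso_rel (r : A -> B -> Prop) :
    reflexive leA -> antisymmetric leA -> reflexive leB -> antisymmetric leB ->
    (forall a, exists b, r a b) -> (forall b, exists a, r a b) ->
    (forall a b a' b', r a b -> r a' b' -> leA a a' = leB b b') ->
  order_iso leA leB.
Proof.
move=> rA aA rB aB totA totB mono.
have [f fP] := choice totA; have [g gP] := choice totB.
exists f => [|a a']; last by rewrite (mono _ _ _ _ (fP a) (fP a')).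
exists g => [a|b].
  by apply: aA; rewrite !(mono _ _ _ _ (fP a) (gP (f a)), mono _ _ _ _ (gP (f a)) (fP a)) rB.
by apply: aB; rewrite -!(mono _ _ _ _ (fP (g b)) (gP b), mono _ _ _ _ (gP b) (fP (g b))) rA.
Qed.

Lemma order_iso_sym : order_iso leA leB -> order_iso leB leA.
Proof.
move=> [f [g fK gK] fle]; exists g; first by exists f.
by move=> x y; rewrite -fle !gK.
Qed.

Lemma order_iso_trans (C : Type) (leC : rel C) :
  order_iso leA leB -> order_iso leB leC -> order_iso leA leC.
Proof.
move=> [f bf fle] [g bg gle]; exists (g \o f); first exact: bij_comp.
by move=> x y; rewrite /= gle fle.
Qed.

End OrderIso.

Section SupportPoset.
Variables (F : realFieldType) (G : graph).

Lemma SP_ge_refl : reflexive (@SP_ge G).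
Proof. by move=> S; apply: subxx. Qed.

Lemma SP_ge_anti : antisymmetric (@SP_ge G).
Proof. by move=> S T; rewrite -eqEsubset => /eqP/val_inj. Qed.

Lemma SP_flow (S : SP G) : exists2 x : edge G -> F, isflow x &
  forall e, (x e == 0) = (e \in val S).
Proof.
have [x fx xS] := no_separating_delete F (val S) (valP S).
by exists x => // e; rewrite -[e \in _]negbK -xS negbK.
Qed.

Lemma flow_SP (x : edge G -> F) : isflow x ->
  exists S : SP G, forall e, (x e == 0) = (e \in val S).
Proof.
move=> fx; have ns : no_separating (delete [set e | x e == 0]).
  by apply/(no_separating_delete F); exists x => // e; rewrite inE.
by exists (exist (fun S : {set edge G} => no_separating (delete S)) _ ns) => e;
  rewrite inE.
Qed.

Lemma SP_ge_supp (S T : SP G) (x y : edge G -> F) :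
  (forall e, (x e == 0) = (e \in val S)) ->
  (forall e, (y e == 0) = (e \in val T)) ->
  SP_ge S T <-> forall e, x e = 0 -> y e = 0.
Proof.
move=> xS yT; rewrite /SP_ge; split=> [/subsetP ST e /eqP|xy].
  by rewrite xS => /ST; rewrite -yT => /eqP.
by apply/subsetP => e; rewrite -xS -yT => /eqP/xy->.
Qed.

End SupportPoset.

Lemma SP_iso_flows (F : realFieldType) (G G' : graph)
    (r : (edge G -> F) -> (edge G' -> F) -> Prop) :
    (forall x, isflow x -> exists2 x', isflow x' & r x x') ->
    (forall x', isflow x' -> exists2 x, isflow x & r x x') ->
    (forall x x' y y', isflow x -> isflow x' -> isflow y -> isflow y' ->
       r x x' -> r y y' ->
       (forall e, x e = 0 -> y e = 0) <-> (forall e, x' e = 0 -> y' e = 0)) ->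
  order_iso (@SP_ge G) (@SP_ge G').
Proof.
move=> tot tot' mono.
pose R (S : SP G) (S' : SP G') := exists x x', [/\ isflow x, isflow x', r x x',
  forall e, (x e == 0) = (e \in val S) & forall e, (x' e == 0) = (e \in val S')].
apply: (order_iso_rel (r := R)); try exact: SP_ge_refl; try exact: SP_ge_anti.
- move=> S; have [x fx xS] := SP_flow F S; have [x' fx' xx'] := tot x fx.
  by have [S' xS'] := flow_SP fx'; exists S', x, x'.
- move=> S'; have [x' fx' xS'] := SP_flow F S'; have [x fx xx'] := tot' x' fx'.
  by have [S xS] := flow_SP fx; exists S, x, x'.
move=> S S' T T' [x [x' [fx fx' rx xS xS']]] [y [y' [fy fy' ry yT yT']]].
by apply/idP/idP => /SP_ge_supp-/(_ _ _ _)-H; apply/SP_ge_supp; [exact: xS'|exact:yT'| |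
  exact: xS | exact: yT|]; apply/(mono _ _ _ _ fx fx' fy fy' rx ry); apply: H.
Qed.

(** Flows of the contraction are the restrictions of flows of [G]; by hypothesis, comparing supports
    outside [T] is enough. *)
Lemma SP_iso_contract (F : realFieldType) (G : graph) (T : {set edge G}) :
    (forall x y : edge G -> F, isflow x -> isflow y ->
       (forall e, e \notin T -> x e = 0 -> y e = 0) ->
       forall e, x e = 0 -> y e = 0) ->
  order_iso (@SP_ge G) (@SP_ge (contract T)).
Proof.
move=> H; pose r (x : edge G -> F) (x' : edge (contract T) -> F) :=
  forall u, x' u = x (val u).
apply: (SP_iso_flows (r := r)) => [x fx|x' fx'|].
- by exists (fun u => x (val u)) => //; apply: flow_contract.
- by have [x fx xx'] := flow_lift fx'; exists x.
move=> x x' y y' fx fx' fy fy' xx' yy'; split=> [xy u|xy].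
  by rewrite xx' yy'; apply: xy.
apply: H => // e eT xe.
have := xy (exist _ e eT); rewrite xx' yy'; exact.
Qed.

(** The absence of bridges is carried through the reduction, whose end condition only speaks of
    separating pairs. *)
Lemma three_conn_SP (F : realFieldType) G H : three_conn G H ->
  [/\ order_iso (@SP_ge G) (@SP_ge H), no_separating H &
      forall e f : edge H, ~~ separating_pair e f].
Proof.
rewrite /three_conn.
have ns2 : no_separating (two_conn G).
  apply/(no_separatingP F); have [x [fx xfull]] := full_exists (isflow_subspace F G).
  exists (fun u => x (val u)) => [|u]; first exact: flow_contract.
  have := valP u; rewrite inE; apply: contraNneq => xu.
  by apply/(separatingP F) => y fy; apply: xfull.
have iso2 : order_iso (@SP_ge G) (@SP_ge (two_conn G)).
  apply: (SP_iso_contract (F := F)) => x y fx fy xy e xe.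
  have [|eT] := boolP (e \in [set e | separating e]); last exact: xy.
  by rewrite inE => /(separatingP F); apply.
move=> red; suff [iso ns np] : [/\ order_iso (@SP_ge (two_conn G)) (@SP_ge H),
    no_separating H & forall e f : edge H, ~~ separating_pair e f].
  by split=> //; apply: order_iso_trans iso2 iso.
elim: red ns2 => {G iso2 H} [G np|G H e f /(separating_pairP F) sp _ IH] ns.
  by split=> //; exists id => //; exists id.
have [ef _ [z fz zf] ze] := sp.
have zs := zle_sym (isflow_subspace F G) ze fz zf.
have [iso ns' np] : [/\ order_iso (@SP_ge (contract [set e])) (@SP_ge H),
    no_separating H & forall e f : edge H, ~~ separating_pair e f].
  apply: IH; apply/(no_separatingP F); have /(no_separatingP F)[x fx xn] := ns.
  by exists (fun u => x (val u)) => [|u]; [exact: flow_contract | exact: xn].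
split=> //; apply: order_iso_trans iso; apply: (SP_iso_contract (F := F)).
move=> x y fx fy xy g xg; have [gE|gn] := eqVneq g e; last first.
  by apply: xy xg; rewrite inE.
rewrite gE in xg *; apply: zs => //; apply: xy; first by rewrite inE eq_sym.
exact: ze.
Qed.

Lemma three_conn_exists G : exists H, three_conn G H.
Proof.
rewrite /three_conn; move: (two_conn G) => {}G.
have [n] := ubnP #|edge G|; elim: n G => // n IHn G /ltnSE leG.
have [[e [f sp]]|no] := pselect (exists e f : edge G, separating_pair e f).
  have [|H red] := IHn (contract [set e]).
    apply: leq_trans leG; rewrite [X in (X < _)%N]card_sig.
    by apply: proper_card; apply/properP; split; [apply/subsetP | exists e];
      rewrite ?inE ?eqxx.
  by exists H; apply: pair_reduces_step sp red.
exists G; apply: pair_reduces_stop => e f; apply/negP => sp; apply: no.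
by exists e, f.
Qed.

(** * Cycles *)

Section Circuits.
Variables (G : graph).
Implicit Types (A B C : {set edge G}) (e : edge G).

Definition cyclic A := no_separating (delete (~: A)).

Definition circuit A := [/\ A != set0, cyclic A &
  forall B, cyclic B -> B \subset A -> B != set0 -> B = A].

Lemma cyclicP (F : realFieldType) A : reflect
  (exists2 x : edge G -> F, isflow x & forall e, (x e != 0) = (e \in A))
  (cyclic A).
Proof.
by apply: (iffP (no_separating_delete F _)) => -[x fx xA]; exists x => // e;
  rewrite xA inE negbK.
Qed.

Lemma supp_cyclic (F : realFieldType) (x : edge G -> F) : isflow x ->
  cyclic [set e | x e != 0].
Proof. by move=> fx; apply/(cyclicP F); exists x => // e; rewrite inE. Qed.

Lemma circuitP (F : realFieldType) A : circuit A <->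
  exists2 c, elem (@isflow F G) c & forall e, (c e != 0) = (e \in A).
Proof.
split=> [[A0 /(cyclicP F)[c fc cA] Amin]|[c [fc [k ck] elc] cA]].
  have [k kA] := set0Pn _ A0; have ck : c k != 0 by rewrite cA.
  exists c => //; split=> //; first by exists k.
  move=> y fy yc; pose z e := y e - y k / c k * c e.
  have fz : isflow z.
    by apply: (subspace_lin (a := 1) (b := - (y k / c k))
      (isflow_subspace F G) fy fc) => i; rewrite /z; ring.
  have zA : [set e | z e != 0] \subset A.
    apply/subsetP => e; rewrite inE -cA; apply: contraNneq => ce.
    by rewrite /z ce yc // mulr0 subr0.
  have [z0|z0] := eqVneq [set e | z e != 0] set0; last first.
    have := Amin _ (supp_cyclic fz) zA z0 => zE.
    by move: kA; rewrite -zE inE /z divfK ?subrr ?eqxx.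
  exists (y k / c k) => e; apply/eqP; rewrite -subr_eq0; apply/negPn/negP => ze.
  by have := in_set0 e; rewrite -z0 inE; move/negbT/negP; apply.
split=> [||B /(cyclicP F)[y fy yB] BA B0].
- by apply/set0Pn; exists k; rewrite -cA.
- by apply/(cyclicP F); exists c.
have [i iB] := set0Pn _ B0.
have [e ce|t yt] := elc y fy.
  apply/eqP/negPn; rewrite yB; apply/negP => /(subsetP BA).
  by rewrite -cA ce eqxx.
have t0 : t != 0 by move: iB; rewrite -yB yt; apply: contraNneq => ->; rewrite mul0r.
by apply/setP => e; rewrite -yB -cA yt mulf_eq0 (negPf t0).
Qed.

Lemma cyclic_circuits A : cyclic A <->
  forall e, e \in A -> exists C, [/\ circuit C, e \in C & C \subset A].
Proof.
split=> [/(cyclicP rat)[x fx xA] e eA|cA].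
  have [|c [elc cx ce]] := elem_exists (h := e) (isflow_subspace rat G) fx.
    by rewrite xA.
  exists [set i | c i != 0]; split; last by
    apply/subsetP => i; rewrite inE -xA; apply: contraNneq => /cx->.
  - by apply/(circuitP rat); exists c => // i; rewrite inE.
  - by rewrite inE.
pose PA (y : edge G -> rat) := isflow y /\ forall i, i \notin A -> y i = 0.
have sPA : subspace PA by apply: subspace_vanish; exact: isflow_subspace.
have [x [[fx xA] xfull]] := full_exists sPA.
apply/(cyclicP rat); exists x => // e; have [eA|eA] := boolP (e \in A); last first.
  by rewrite xA ?eqxx.
have [C [/(circuitP rat)[c [fc _ _] cC] eC CA]] := cA e eA.
have PAc : PA c.
  split=> // i; apply: contraNeq; rewrite cC; exact: (subsetP CA).
have ce : c e != 0 by rewrite cC.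
by apply: contraNneq ce => xe; rewrite (xfull c e).
Qed.

Lemma cycle_spaceP (F : realFieldType) (x : chain1 F G) :
  x \in cycle_space F G <-> isflow (fun e => x e : F).
Proof.
rewrite memv_ker lfunE /=; split=> [/eqP/ffunP bx v|fx].
  by have := bx v; rewrite !ffunE.
by apply/eqP/ffunP => v; rewrite !ffunE; apply: fx.
Qed.

End Circuits.

Section CycleSubgraphs.
Variables (G : graph) (W : {set vert G}) (A : {set edge G}).
Hypothesis ends : forall e, e \in A -> (src e \in W) && (tgt e \in W).
Local Notation H := (subgraph W A).

Lemma sub_edgeP e : e \in A -> [&& e \in A, src e \in W & tgt e \in W].
Proof. by move=> eA; rewrite eA ends. Qed.

(** First Betti number one makes the flow space a line; without bridges it is spanned by a nowhere
    zero flow, so no proper nonempty subset of the edges supports a flow. *)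
Lemma cycle_subgraph_circuit : is_cycle H -> circuit A.
Proof.
move=> /and3P[_ /(no_separatingP rat)[x fx xn] /eqP dim1].
have Vn0 : cycle_space rat H != 0%VS by rewrite -dimv_eq0 -/(betti1 H) dim1.
have vn0 : vpick (cycle_space rat H) != 0 by rewrite vpick0.
have VE : cycle_space rat H = <[vpick (cycle_space rat H)]>%VS.
  apply/esym/eqP; rewrite eqEdim -memvE memv_pick.
  by rewrite dim_vline vn0 -/(betti1 H) dim1.
set v := vpick _ in vn0 VE.
have prop (y : edge H -> rat) : isflow y -> exists k, forall u, y u = k * v u.
  move=> fy; have : [ffun u => y u] \in cycle_space rat H.
    apply/cycle_spaceP; rewrite (_ : (fun e => _) = y) //.
    by apply: funext => u; rewrite ffunE.
  by rewrite VE => /vlineP[k /ffunP yk]; exists k => u; have := yk u; rewrite !ffunE.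
have [u0 vu0] : exists u, v u != 0.
  apply: contrapT => no; case/eqP: vn0; apply/ffunP => u; rewrite ffunE.
  by apply/eqP/negPn/negP => vu; apply: no; exists u.
have [k xk] := prop x fx.
have k0 : k != 0 by apply: contraNneq (xn u0) => k0; rewrite xk k0 mul0r.
have suppE e : (ext x e != 0) = (e \in A).
  have [eA|eA] := boolP (e \in A).
    by have := ext_val x (exist _ e (sub_edgeP eA)) => /= ->; rewrite xn.
  by rewrite ext_out ?eqxx // negb_and eA.
apply/(circuitP rat); exists (ext x) => //; split.
- exact/flow_subgraph.
- by exists (val u0); rewrite ext_val xn.
move=> y fy yx.
have yA e : e \notin A -> y e = 0.
  by move=> eA; apply: yx; apply/eqP; rewrite -[_ == _]negbK suppE.
have [|t yt] := prop (fun u : edge H => y (val u)).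
  apply/flow_subgraph; rewrite ext_res // => e.
  by apply: contraNeq => ye; apply: sub_edgeP; apply: contraNT ye => /yA->.
exists (t / k) => e; have [eA|eA] := boolP (e \in A).
  have := ext_val x (exist _ e (sub_edgeP eA)) => /= ->.
  rewrite xk mulrA divfK //; exact: (yt (exist _ e (sub_edgeP eA))).
by rewrite yA // ext_out ?mulr0 // negb_and eA.
Qed.

Hypothesis cover : forall v, v \in W -> exists2 e, e \in A & (src e == v) || (tgt e == v).

Lemma circuit_cycle_subgraph : circuit A -> is_cycle H.
Proof.
move=> /(circuitP rat)[c [fc [k ck] elc] cA].
have resE : ext (fun u : edge H => c (val u)) = c.
  by apply: ext_res => e; apply: contraNeq; rewrite cA; apply: sub_edgeP.
have fH : isflow (fun u : edge H => c (val u)) by apply/flow_subgraph; rewrite resE.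
have cn (u : edge H) : c (val u) != 0 by rewrite cA; case/andP: (valP u).
have kA : k \in A by rewrite -cA.
pose k' : edge H := exist _ k (sub_edgeP kA).
have prop (y : edge H -> rat) : isflow y -> exists t, forall u, y u = t * c (val u).
  move=> /flow_subgraph fy; have [e ce|t yt] := elc _ fy.
    by rewrite ext_out // negb_and -cA ce eqxx.
  by exists t => u; rewrite -ext_val yt.
apply/and3P; split.
- apply/andP; split; first by apply/card_gt0P; exists (src k').
  have inc v : exists u : edge H, (src u == v) || (tgt u == v).
    have [e eA ev] := cover (valP v).
    by exists (exist _ e (sub_edgeP eA)).
  apply/forallP => a; apply/forallP => b.
  (* The part of [c] in the component of [a] is a flow, hence a multiple of [c]; being nonzero, it
     has the whole support of [c], so it reaches the edge at [b]. *)
  pose K := [set v | conn a v].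
  have KE u : (src u \in K) = (tgt u \in K) by rewrite !inE conn_ends.
  have fK : isflow (fun u : edge H => if src u \in K then c (val u) else 0).
    by apply: (@flow_restrict rat H (fun u => c (val u))) fH => u _; apply: KE.
  have [t tE] := prop _ fK.
  have end_in v u : (src u == v) || (tgt u == v) -> (src u \in K) = (v \in K).
    by move=> /orP[/eqP<-//|/eqP<-]; rewrite KE.
  have [ua ha] := inc a; have [ub hb] := inc b.
  have aK : a \in K by rewrite inE conn_walkable /walkable connect0.
  have := tE ua; rewrite (end_in _ _ ha) aK => /esym ta.
  have t0 : t != 0.
    by apply: contraTneq (cn ua) => t0; rewrite negbK -ta t0 mul0r.
  have := tE ub; rewrite (end_in _ _ hb) inE; case: (conn a b) => // /esym/eqP.
  by rewrite mulf_eq0 (negPf t0) (negPf (cn ub)).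
- by apply/(no_separatingP rat); exists (fun u => c (val u)).
pose v : chain1 rat H := [ffun u => c (val u)].
have vV : v \in cycle_space rat H.
  apply/cycle_spaceP; rewrite (_ : (fun e => _) = fun u => c (val u)) //.
  by apply: funext => u; rewrite ffunE.
have vn0 : v != 0.
  by apply/eqP => /ffunP/(_ k')/eqP; rewrite !ffunE (negPf (cn k')).
have VE : cycle_space rat H = <[v]>%VS.
  apply/eqP; rewrite eqEsubv -memvE vV andbT; apply/subvP => y.
  move=> /cycle_spaceP/prop[t yt]; apply/vlineP; exists t; apply/ffunP => u.
  by rewrite !ffunE yt.
by rewrite /betti1 VE dim_vline vn0.
Qed.

End CycleSubgraphs.

Lemma cycle_edgesP (G : graph) (A : {set edge G}) : cycle_edges A <-> circuit A.
Proof.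
split=> [/existsP[W /andP[/forallP WA cyc]]|cA].
  apply: (@cycle_subgraph_circuit G W A) => // e eA.
  by have := WA e; rewrite eA.
pose W := [set v | [exists e in A, (src e == v) || (tgt e == v)]].
have ends e : e \in A -> (src e \in W) && (tgt e \in W).
  by move=> eA; rewrite !inE; apply/andP; split; apply/existsP; exists e;
    rewrite eA eqxx ?orbT.
apply/existsP; exists W; apply/andP; split.
  by apply/forallP => e; apply/implyP/ends.
apply: circuit_cycle_subgraph => // v; rewrite inE => /existsP[e /andP[eA ev]].
by exists e.
Qed.

(** * Cyclic equivalence *)

Section Matching.
Variables (F : realFieldType) (G G' : graph) (f : SP G -> SP G') (g : SP G' -> SP G).
Hypotheses (fK : cancel f g) (gK : cancel g f).
Hypothesis fge : {mono f : S T / SP_ge S T >-> SP_ge S T}.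

Definition matched (e : edge G) (e' : edge G') := forall S : SP G, (e \in val S) = (e' \in val (f S)).

(* The minimal [S] containing [e] is the complement of a coatom of the lattice of
   the unions of circuits, and each coatom arises in this way. *)
Lemma SP_min (K : graph) (e : edge K) : exists2 S : SP K, e \in val S &
  forall T : SP K, e \in val T -> SP_ge S T.
Proof.
pose Pe (y : edge K -> F) := isflow y /\ y e = 0.
have sPe : subspace Pe by apply: subspace_vanish1; exact: isflow_subspace.
have [w [[fw we] wfull]] := full_exists sPe; have [S wS] := flow_SP fw.
exists S => [|T eT]; first by rewrite -wS we.
have [y fy yT] := SP_flow F T; apply/(SP_ge_supp wS yT) => i wi.
by apply: wfull wi; split=> //; apply/eqP; rewrite yT.
Qed.

(** Any edge [e'] that [f Se] contains beyond the bridges will do: [f Se] turns out to be the least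
    member containing [e'], so [e] and [e'] belong to corresponding members. *)
Lemma SP_match e (z : edge G -> F) : isflow z -> z e != 0 ->
  exists e' z', [/\ @isflow F G' z', z' e' != 0 & matched e e'].
Proof.
move=> fz ze; have [Se eSe Semin] := SP_min e.
have [x0 [fx0 x0full]] := full_exists (isflow_subspace F G).
(* [S0] is the set of bridges, contained in every member of [SP]. *)
have [S0 x0S] := flow_SP fx0.
have S0min S : SP_ge S0 S.
  have [y fy yS] := SP_flow F S; apply/(SP_ge_supp x0S yS) => i; exact: x0full.
have fS0min S : SP_ge (f S0) S by rewrite -[S]gK fge.
have eS0 : e \notin val S0.
  by rewrite -x0S; apply: contraNneq ze => x0e; rewrite (x0full z e).
have nSe : ~~ SP_ge (f Se) (f S0) by rewrite fge; apply: contraNN eS0 => /subsetP; apply.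
have [e' e'Se e'S0] : exists2 e', e' \in val (f Se) & e' \notin val (f S0).
  by move: nSe => /subsetPn[e' h1 h2]; exists e'.
have [z' fz' z'S] := SP_flow F (f S0).
exists e', z'; split=> //; first by rewrite z'S.
have [Se' e'Se' Se'min] := SP_min e'.
(* The preimage of [Se'] is contained in [Se] and contains some [k] that is not a bridge. All flows
   zero at [e] are zero at [k], hence conversely, so the preimage contains [e] and is [Se]. *)
suff E : f Se = Se'.
  move=> S; apply/idP/idP => h.
    by have := Semin S h; rewrite -fge => /subsetP; apply.
  by have := Se'min _ h; rewrite -E fge => /subsetP; apply.
have U_le : SP_ge (g Se') Se by rewrite -fge gK; apply: Se'min.
have [k kU kS0] : exists2 k, k \in val (g Se') & k \notin val S0.
  apply/subsetPn/negP => US0; move: e'S0 => /negP; apply.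
  suff /subsetP : SP_ge Se' (f S0) by apply.
  by rewrite -[Se']gK fge.
have [w fw wSe] := SP_flow F Se.
have ek : zle (@isflow F G) e k.
  move=> y fy ye; have [T yT] := flow_SP fy; apply/eqP; rewrite yT.
  have eT : e \in val T by rewrite -yT ye.
  apply: (subsetP (Semin T eT)); exact: (subsetP U_le).
have x0k : x0 k != 0 by rewrite x0S.
have ke := zle_sym (isflow_subspace F G) ek fx0 x0k.
have [u fu uU] := SP_flow F (g Se').
have eU : e \in val (g Se').
  by rewrite -uU; apply/eqP; apply: ke => //; apply/eqP; rewrite uU.
apply: (can_inj gK); rewrite fK; apply: SP_ge_anti; rewrite U_le andbT.
exact: Semin.
Qed.

Lemma matched_zle e1 e2 e' : matched e1 e' -> matched e2 e' ->
  zle (@isflow F G) e1 e2.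
Proof.
move=> m1 m2 y fy y1; have [S yS] := flow_SP fy.
by apply/eqP; rewrite yS m2 -m1 -yS y1.
Qed.

End Matching.

Lemma matched_sym (G G' : graph) (f : SP G -> SP G') (g : SP G' -> SP G) e e' :
  cancel g f -> matched f e e' -> matched g e' e.
Proof. by move=> gK m S; rewrite m gK. Qed.

Lemma cyc_equiv_SP (F : realFieldType) (G G' : graph) :
  cyc_equiv G G' -> order_iso (@SP_ge G) (@SP_ge G').
Proof.
move=> [f [g fK gK] fcyc].
have finj := can_inj fK.
have circ A : circuit A <-> circuit [set f e | e in A].
  by rewrite -!cycle_edgesP fcyc.
have cyc A : cyclic A <-> cyclic [set f e | e in A].
  split=> /cyclic_circuits H; apply/cyclic_circuits => e.
    move=> /imsetP[a aA ->]; have [C [cC aC CA]] := H a aA.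
    by exists [set f e | e in C]; split; [exact/circ | exact: imset_f | exact: imsetS].
  move=> eA; have [|C' [cC' eC' CA']] := H (f e); first exact: imset_f.
  have CE : C' = [set f e | e in f @^-1: C'].
    apply/setP => i; apply/idP/imsetP => [iC|[j jC ->]]; last by rewrite inE in jC.
    by exists (g i); rewrite ?inE gK.
  exists (f @^-1: C'); split; [by apply/circ; rewrite -CE | by rewrite inE |].
  apply/subsetP => i; rewrite inE => /(subsetP CA') /imsetP[j jA /finj->] //.
pose r (x : edge G -> F) (x' : edge G' -> F) := forall e, (x e == 0) = (x' (f e) == 0).
apply: (SP_iso_flows (r := r)) => [x fx|x' fx'|].
- have /(cyclicP F)[x' fx' x'E] := (cyc _).1 (supp_cyclic fx).
  exists x' => // e; apply: negb_inj; rewrite x'E; apply/idP/imsetP => [xe|[i ix /finj->]].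
    by exists e; rewrite ?inE.
  by rewrite inE in ix.
- have := supp_cyclic fx'.
  have -> : [set e | x' e != 0] = [set f e | e in [set e | x' (f e) != 0]].
    apply/setP => i; rewrite inE; apply/idP/imsetP => [xi|[j jx ->]].
      by exists (g i); rewrite ?inE gK.
    by rewrite inE in jx.
  move=> /cyc/(cyclicP F)[x fx xE]; exists x => // e.
  by apply: negb_inj; rewrite xE inE.
move=> x x' y y' _ _ _ _ xx' yy'; split=> xy e xe.
  by rewrite -[e]gK; apply/eqP; rewrite -yy'; apply/eqP/xy/eqP; rewrite xx' gK xe.
by apply/eqP; rewrite yy'; apply/eqP/xy/eqP; rewrite -xx' xe.
Qed.

(** Without bridges every edge has a match, and without separating pairs only one: two edges with
    the same match vanish on the same flows. *)
Lemma SP_cyc_equiv (F : realFieldType) (G G' : graph) :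
    no_separating G -> (forall e f : edge G, ~~ separating_pair e f) ->
    no_separating G' -> (forall e f : edge G', ~~ separating_pair e f) ->
  order_iso (@SP_ge G) (@SP_ge G') -> cyc_equiv G G'.
Proof.
move=> /(no_separatingP F)[x fx xn] np /(no_separatingP F)[x' fx' xn'] np'.
move=> [f [g fK gK] fge]; have gge := mono_inv gK fge.
have exh e : exists e', matched f e e'.
  by have [e' [_ [_ _ m]]] := SP_match fK gK fge fx (xn e); exists e'.
have exk e : exists e', matched g e e'.
  by have [e' [_ [_ _ m]]] := SP_match gK fK gge fx' (xn' e); exists e'.
have [h hP] := choice exh; have [k kP] := choice exk.
have uniq_match (K K' : graph) (f0 : SP K -> SP K') (w : edge K -> F) e1 e2 e' :
    isflow w -> (forall e, w e != 0) -> (forall e f : edge K, ~~ separating_pair e f) ->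
    matched f0 e1 e' -> matched f0 e2 e' -> e1 = e2.
  move=> fw wn npK m1 m2; apply/eqP/negPn/negP => ne; apply/negP: (npK e1 e2).
  rewrite negbK; apply/(separating_pairP F).
  by split; [| exists w | exists w | exact: matched_zle m1 m2].
have hK : cancel h k.
  move=> e; apply: (uniq_match _ _ f x _ _ (h e) fx xn np) => //.
  exact: matched_sym fK (kP (h e)).
have kK : cancel k h.
  move=> e; apply: (uniq_match _ _ g x' _ _ (k e) fx' xn' np') => //.
  exact: matched_sym gK (hP (k e)).
have cyc A : cyclic A <-> cyclic [set h e | e in A].
  have imC (S : SP G) : ~: val (f S) = [set h e | e in ~: val S].
    apply/setP => i; rewrite inE; apply/idP/imsetP => [iS|[j jS ->]].
      by exists (k i); rewrite ?inE ?(hP (k i)) kK.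
    by move: jS; rewrite inE (hP j).
  split=> cA.
    pose S : SP G := exist (fun S : {set edge G} => no_separating (delete S)) _ cA.
    have := imC S; rewrite /= setCK => <-; rewrite /cyclic setCK; exact: (valP (f S)).
  pose S' : SP G' := exist (fun S : {set edge G'} => no_separating (delete S)) _ cA.
  have := imC (g S'); rewrite gK /= setCK => /(imset_inj (can_inj hK)) ->.
  by rewrite /cyclic setCK; exact: (valP (g S')).
exists h; first by exists k.
have pre (B : {set edge G'}) : B = [set h e | e in h @^-1: B].
  apply/setP => i; apply/idP/imsetP => [iB|[j jB ->]]; last by rewrite inE in jB.
  by exists (k i); rewrite ?inE kK.
have im0 (A : {set edge G}) : (A == set0) = ([set h e | e in A] == set0).
  by rewrite imset_eq0.
move=> A; apply/idP/idP => /cycle_edgesP[A0 cA Amin]; apply/cycle_edgesP; split.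
- by rewrite -im0.
- exact/cyc.
- move=> B cB BA B0; suff hB : h @^-1: B = A by rewrite (pre B) hB.
  apply: Amin.
  + by apply/cyc; rewrite -pre.
  + by apply/subsetP => i; rewrite inE => /(subsetP BA)/imsetP[j jA /(can_inj hK)->].
  + by rewrite im0 -pre.
- by rewrite im0.
- exact/cyc.
move=> B /cyc cB BA B0; apply: (imset_inj (can_inj hK)); apply: Amin => //.
  exact: imsetS.
by rewrite -im0.
Qed.

Lemma cyc_equiv_trans (G1 G2 G3 : graph) :
  cyc_equiv G1 G2 -> cyc_equiv G2 G3 -> cyc_equiv G1 G3.
Proof.
move=> [f bf fc] [g bg gc]; exists (g \o f); first exact: bij_comp.
by move=> A; rewrite fc gc -imset_comp.
Qed.

Lemma cyc_equiv_refl (G : graph) : cyc_equiv G G.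
Proof. by exists id => [|A]; [exists id | rewrite imset_id]. Qed.

Lemma same_cyc_class3_SP (G G' : graph) :
  same_cyc_class3 G G' <-> order_iso (@SP_ge G) (@SP_ge G').
Proof.
split=> [same|].
  have [H t] := three_conn_exists G.
  have [isoG _ _] := three_conn_SP rat t.
  have /same[H' t' c] : cyc_class3 G H by exists H => //; exact: cyc_equiv_refl.
  have [isoG' _ _] := three_conn_SP rat t'.
  apply: order_iso_trans isoG _; apply: order_iso_trans (order_iso_sym isoG').
  exact/order_iso_sym/(cyc_equiv_SP rat).
suff incl K K' H : order_iso (@SP_ge K) (@SP_ge K') ->
    cyc_class3 K H -> cyc_class3 K' H.
  move=> iso H; split; first exact: incl.
  by apply: incl; apply: order_iso_sym.
move=> iso [K3 t c]; have [isoK ns np] := three_conn_SP rat t.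
have [K3' t'] := three_conn_exists K'; have [isoK' ns' np'] := three_conn_SP rat t'.
exists K3' => //; apply: cyc_equiv_trans c; apply: (SP_cyc_equiv rat) => //.
apply: order_iso_trans (order_iso_sym isoK') _.
by apply: order_iso_trans (order_iso_sym iso) _.
Qed.

(** * Signed correspondence between the edges of two graphs *)

Section SignIsomorphism.
Variables (F : realFieldType) (G G' : graph).

Definition linked (m : edge G -> edge G' -> F) x x' :=
  forall e e', m e e' != 0 -> x' e' = m e e' * x e.

(* Up to signs, the nonzero coordinates are the same on both spaces of flows. *)
Definition sign_link (m : edge G -> edge G' -> F) :=
  [/\ forall e e', [\/ m e e' = 0, m e e' = 1 | m e e' = -1],
      forall x, isflow x -> exists2 x', isflow x' & linked m x x',
      forall x', isflow x' -> exists2 x, isflow x & linked m x x',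
      forall x e, @isflow F G x -> x e != 0 -> exists e', m e e' != 0 &
      forall x' e', @isflow F G' x' -> x' e' != 0 -> exists e, m e e' != 0].

(** Matching is many to many, so the signs are sought on the set [I] of matched pairs of edges that
    carry flow: pulled back there, both flow spaces are regular and have the same supports, and
    [signing_unique] applies. Other pairs get the entry 0. *)
Lemma SP_sign_iso : order_iso (@SP_ge G) (@SP_ge G') -> exists m, sign_link m.
Proof.
move=> [f [g fK gK] fge]; have gge := mono_inv gK fge.
pose live (K : graph) (e : edge K) := exists2 z : edge K -> F, isflow z & z e != 0.
pose link (p : edge G * edge G') :=
  `[< [/\ live G p.1, live G' p.2 & matched f p.1 p.2] >].
pose I : finType := {p | link p}.
have liveP e : live G e -> exists i : I, (val i).1 = e.
  move=> le; have [z fz ze] := le.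
  have [e' [z' [fz' ze' m]]] := SP_match fK gK fge fz ze.
  have l : link (e, e') by apply/asboolP; split=> //; exists z'.
  by exists (exist (fun p => link p) _ l).
have liveP' e' : live G' e' -> exists i : I, (val i).2 = e'.
  move=> le; have [z fz ze] := le.
  have [e [z' [fz' ze' m]]] := SP_match gK fK gge fz ze.
  have l : link (e, e').
    by apply/asboolP; split=> //; [exists z' | exact: matched_sym fK m].
  by exists (exist (fun p => link p) _ l).
pose pull (K : graph) (h : I -> edge K) (y : I -> F) :=
  exists2 x : edge K -> F, isflow x & forall i, y i = x (h i).
have sub_pull (K : graph) (h : I -> edge K) : subspace (pull K h).
  have [s0 slin] := isflow_subspace F K.
  split; first by exists (fun=> 0).
  move=> a b y y' [x fx xE] [x' fx' xE'].
  by exists (fun e => a * x e + b * x' e) => [|i]; [exact: slin | rewrite xE xE'].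
have reg_pull (K : graph) (h : I -> edge K) :
    (forall e, live K e -> exists i, h i = e) -> regular (pull K h).
  move=> hP c [[x fx xE] [k ck] elc] i j; rewrite !xE.
  apply: (flow_regular (G := K)); split=> //; first by exists (h k); rewrite -xE.
  move=> z fz zx; have [||t zt] := elc (fun i => z (h i)); first by exists z.
    by move=> l; rewrite xE; apply: zx.
  exists t => e; have [[l le]|no] := pselect (exists i, h i = e).
    by rewrite -le zt xE.
  have zero (y : edge K -> F) : isflow y -> y e = 0.
    by move=> fy; apply/eqP/negPn/negP => ye; apply: no; apply: hP; exists y.
  by rewrite !zero ?mulr0.
have matchP (i : I) (S : SP G) : ((val i).1 \in val S) = ((val i).2 \in val (f S)).
  by have /asboolP[_ _ m] := valP i; apply: m.
pose P := pull G (fun i => (val i).1); pose Q := pull G' (fun i => (val i).2).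
have PQ : same_supports P Q.
  move=> y [x fx xE]; have [S xS] := flow_SP fx.
  have [x' fx' x'S] := SP_flow F (f S).
  exists (fun i => x' (val i).2) => [|i]; first by exists x'.
  by rewrite x'S -matchP -xS xE.
have QP : same_supports Q P.
  move=> y [x' fx' x'E]; have [S' x'S] := flow_SP fx'.
  have [x fx xS] := SP_flow F (g S').
  exists (fun i => x (val i).1) => [|i]; first by exists x.
  by rewrite xS matchP gK -x'S x'E.
have [s s1 sE] := signing_unique (sub_pull G _) (sub_pull G' _)
  (reg_pull G _ liveP) (reg_pull G' _ liveP') PQ QP.
have ss i : s i * s i = 1 by case: (s1 i) => ->; rewrite ?mulrNN mulr1.
have s0 i : s i != 0 by case: (s1 i) => ->; rewrite ?oppr_eq0 oner_eq0.
pose m e e' := if insub (e, e') is Some i then s i else 0.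
have mE (i : I) : m (val i).1 (val i).2 = s i.
  by rewrite /m (_ : ((val i).1, (val i).2) = val i) ?valK //; case: (val i).
have mP e e' : m e e' != 0 -> exists i : I, e = (val i).1 /\ e' = (val i).2.
  by rewrite /m; case: insubP => [i _ iE _|]; rewrite ?eqxx //; exists i; rewrite iE.
exists m; split=> [e e'|x fx|x' fx'|x e fx xe|x' e' fx' xe'].
- rewrite /m; case: insubP => [i _ _|_]; last by constructor 1.
  by case: (s1 i) => ->; constructor.
- have [|x' fx' x'E] := (sE (fun i => x (val i).1)).1; first by exists x.
  by exists x' => // e e' /mP[i [-> ->]]; rewrite mE -x'E.
- have [|x fx xE] := (sE (fun i => s i * x' (val i).2)).2.
    by exists x' => // i; rewrite mulrA ss mul1r.
  by exists x => // e e' /mP[i [-> ->]]; rewrite mE -xE mulrA ss mul1r.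
- by have [|i <-] := liveP e; [exists x | exists (val i).2; rewrite mE].
- by have [|i <-] := liveP' e'; [exists x' | exists (val i).1; rewrite mE].
Qed.

End SignIsomorphism.

(** * Totally cyclic orientations *)

Section TotallyCyclic.
Variables (F : realFieldType) (G : graph).

Lemma flow_sum (J : finType) (X : J -> edge G -> F) :
  (forall j, isflow (X j)) -> isflow (fun e => \sum_j X j e).
Proof.
move=> fX v; rewrite /net exchange_big /= [X in _ - X]exchange_big -sumrB /=.
by rewrite big1 // => j _; exact: fX.
Qed.

Lemma one_way_no_cut (x : edge G -> F) (W : {set vert G}) : isflow x ->
    (forall e, tgt e \in W -> src e \notin W -> x e < 0) ->
    (forall e, src e \in W -> tgt e \notin W -> 0 < x e) ->
  forall e, (src e \in W) = (tgt e \in W).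
Proof.
move=> fx xin xout; have := cut_sum W fx.
set A := (X in X = _); set B := (X in _ = X) => AB.
have A0 : A <= 0 by apply: sumr_le0 => e /andP[t s]; apply/ltW/xin.
have B0 : 0 <= B by apply: sumr_ge0 => e /andP[t s]; apply/ltW/xout.
have Bz : B = 0 by apply/eqP; rewrite eq_le B0 -AB A0.
have Az : \sum_(e | (tgt e \in W) && (src e \notin W)) - x e = 0.
  by rewrite sumrN -/A AB Bz oppr0.
move=> e; case: (boolP (src e \in W)) (boolP (tgt e \in W)) => [sW|sW] [tW|tW] //.
- have := psumr_eq0P _ Bz; move=> /(_ _ e) H; have := xout e sW tW.
  by rewrite H ?ltxx ?sW // => i /andP[s t]; apply/ltW/xout.
- have := psumr_eq0P _ Az; move=> /(_ _ e) H; have := xin e tW sW.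
  rewrite -oppr_gt0 H ?ltxx ?tW // => i /andP[t s].
  by rewrite oppr_ge0; apply/ltW/xin.
Qed.

Definition orient_sg (phi : orientation G) e : F := (-1) ^+ (~~ phi e).

(** In a totally cyclic orientation every edge lies on a directed cycle, and the sum of these cycles
    is the flow; conversely, a flow cannot cross a cut in one direction only. *)
Lemma totally_cyclicP (phi : orientation G) : reflect
  (exists2 x, isflow x & forall e, Num.sg (x e) = orient_sg phi e)
  (totally_cyclic phi).
Proof.
apply: (iffP idP) => [tc|[x fx xphi]].
  have cyc e : exists y : edge G -> F, [/\ isflow y, y e = orient_sg phi e &
      forall e', 0 <= y e' * orient_sg phi e'].
    have [|y [fy _ ye yal]] := @flow_through F G e (phi e) (fun e' c => c == phi e').
      set al := fun _ _ => _; set u := (X in connect _ X).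
      set v := (X in connect _ _ X).
      (* Were the tail of [e] not reachable from its head, the set reached would be a one-way cut of
         the component. *)
      pose K := [set w | connect (arc al) u w].
      apply/negPn/negP => ncon.
      have uv : (u == src e) && (v == tgt e) || (u == tgt e) && (v == src e).
        by rewrite /u /v; case: (phi e); rewrite !eqxx ?orbT.
      have adj_uv : conn u v.
        rewrite conn_walkable; have w : walkable set0 (src e) (tgt e).
          by apply: walkable_edge; rewrite inE.
        by case/orP: uv => /andP[/eqP-> /eqP->] //; rewrite walkable_sym.
      have Ksub w : w \in K -> conn u w.
        rewrite inE conn_walkable; apply: connect_sub => a b /existsP[f H].
        apply: connect1; apply/existsP; exists f; rewrite inE /=.
        by case/orP: H => /andP[/andP[_ ->] ->]; rewrite ?orbT.
      have KC : (K != set0) && (K \proper component u).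
        apply/andP; split; first by apply/set0Pn; exists u; rewrite inE connect0.
        apply/properP; split; last by exists v; rewrite inE.
        by apply/subsetP => w /Ksub; rewrite inE.
      have /forallP/(_ K)/implyP/(_ KC)/andP[_ /negP] := (forallP tc) u; apply.
      apply/forallP => f; apply/negP => /andP[sK]; rewrite !inE => /andP[tK _].
      move/negP: tK; apply; rewrite inE in sK; apply: (connect_trans sK (connect1 _)).
      have fe : f != e.
        apply: contraNneq ncon => fe; move: sK; rewrite fe /osrc /v.
        by case: (phi e).
      apply/existsP; exists f; rewrite /al fe /osrc /otgt /=.
      by case: (phi f); rewrite !eqxx ?orbT.
    exists y; split=> // e'; have [->|ne] := eqVneq e' e.
      by rewrite ye -expr2 sqr_ge0.
    rewrite /orient_sg; case: (yal e' ne) => [->|[-> /eqP<-]|[-> /eqP<-]] /=.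
    - by rewrite mul0r.
    - by rewrite expr0 mulr1 ler01.
    - by rewrite expr1 mulrNN mulr1 ler01.
  have [Y YP] := choice cyc.
  exists (fun e => \sum_j Y j e) => [|e]; first by apply: flow_sum => j; case: (YP j).
  have sq : orient_sg phi e * orient_sg phi e = 1 by rewrite /orient_sg -expr2 sqrr_sign.
  have pos : 0 < (\sum_j Y j e) * orient_sg phi e.
    rewrite mulr_suml (bigD1 e) //=; apply: ltr_wpDr.
      by apply: sumr_ge0 => j _; case: (YP j).
    by have [_ -> _] := YP e; rewrite sq ltr01.
  have -> : \sum_j Y j e = ((\sum_j Y j e) * orient_sg phi e) * orient_sg phi e.
    by rewrite -mulrA sq mulr1.
  rewrite sgrM gtr0_sg // mul1r /orient_sg.
  by case: (phi e); rewrite /= ?expr0 ?expr1 ?sgrN sgr1.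
apply/forallP => v; apply/forallP => W; apply/implyP => /andP[/set0Pn[u uW]].
move=> /properP[WC [w wC wW]].
have crossing : ~ forall e, (src e \in W) = (tgt e \in W).
  move=> cl; move/negP: wW; apply.
  have uC := subsetP WC u uW.
  have uw : walkable set0 u w.
    rewrite !inE !conn_walkable in uC wC; apply: walkable_trans wC.
    by rewrite walkable_sym.
  have clW : closed (arc (fun e _ => e \notin (set0 : {set edge G}))) W.
    by move=> a b /existsP[e]; rewrite inE /= => /orP[] /andP[/eqP<- /eqP<-]; rewrite cl.
  by rewrite -(closed_connect clW uw).
have endC e : (src e \in component v) = (tgt e \in component v).
  by rewrite !inE conn_ends.
have sgE e : if phi e then 0 < x e else x e < 0.
  rewrite -sgr_gt0 -sgr_lt0 xphi /orient_sg.
  by case: (phi e); rewrite /= ?expr0 ?expr1 ?ltr01 ?ltrN10.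
have nin B e : one_way phi B (component v :\: B) -> src e \in component v ->
    if phi e then ~~ ((src e \notin B) && (tgt e \in B))
    else ~~ ((tgt e \notin B) && (src e \in B)).
  move=> /forallP/(_ e); rewrite /osrc /otgt !in_setD.
  by case: (phi e); rewrite -?endC => ow sC; move: ow; rewrite sC andbT.
have nout B e : one_way phi (component v :\: B) B -> src e \in component v ->
    if phi e then ~~ ((src e \in B) && (tgt e \notin B))
    else ~~ ((tgt e \in B) && (src e \notin B)).
  move=> /forallP/(_ e); rewrite /osrc /otgt !in_setD.
  by case: (phi e); rewrite -?endC => ow sC; move: ow; rewrite sC andbT.
have inC e : (src e \in W) || (tgt e \in W) -> src e \in component v.
  by case/orP=> /(subsetP WC); rewrite -?endC.
apply/andP; split; apply/negP => ow; apply: crossing.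
  by apply: (one_way_no_cut fx) => e eW nW;
    have := nin W e ow; rewrite inC ?eW ?orbT // nW => /(_ isT);
    have := sgE e; case: (phi e).
have fNx : isflow (fun e => - x e).
  by apply: (subspace_scale (t := -1) (isflow_subspace F G) fx) => e; ring.
by apply: (one_way_no_cut fNx) => e eW nW; rewrite ?oppr_lt0 ?oppr_gt0;
  have := nout W e ow; rewrite inC ?eW ?orbT // nW => /(_ isT);
  have := sgE e; case: (phi e).
Qed.

(** In-degree minus out-degree is the degree, independent of [phi], minus twice the out-degree.
    Hence two orientations have equal out-degrees exactly when their sign vectors differ by a
    flow. *)
Lemma net_orient_sg (phi : orientation G) v : net (orient_sg phi) v =
  (\sum_(e | tgt e == v) 1 + \sum_(e | src e == v) 1) - 2 * (out_degree phi v)%:R.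
Proof.
rewrite /net /out_degree -sum1_card natr_sum.
rewrite (big_mkcond (fun e => tgt e == v) (orient_sg phi)).
rewrite (big_mkcond (fun e => src e == v) (orient_sg phi)).
rewrite (big_mkcond (fun e => tgt e == v)) (big_mkcond (fun e => src e == v)) /=.
rewrite (big_mkcond (fun e => e \in _)) /= mulr_sumr -!sumrB -big_split -sumrB /=.
apply: eq_bigr => e _; rewrite inE /orient_sg /osrc.
by case: (phi e); case: eqP => _; case: eqP => _; rewrite /= ?expr0 ?expr1; ring.
Qed.

End TotallyCyclic.

(** * The orientation posets as posets of classes of sign vectors *)

Section OrientationPosets.
Variables (F : realFieldType) (G : graph).
Local Notation oriented := {S : {set edge G} & orientation (delete S)}.
Local Notation pair phi :=
  (existT (fun S : {set edge G} => orientation (delete S)) _ phi).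

(** Orientations of different subgraphs become comparable as functions on all edges of [G], with
    value 0 on the removed ones. *)
Definition osv (p : oriented) : edge G -> F := ext (orient_sg F (tagged p)).

Lemma osv_val (S : {set edge G}) (phi : orientation (delete S)) u :
  osv (pair phi) (val u) = orient_sg F phi u.
Proof. exact: (@ext_val F (edge G) (fun e => e \notin S)). Qed.

Lemma osv_eq0 p e : (osv p e == 0) = (e \in tag p).
Proof.
case: p => S phi /=; have [eS|eS] := boolP (e \in S).
  by rewrite /osv ext_out ?eqxx //= eS.
by rewrite (osv_val phi (exist _ e eS)) /orient_sg signr_eq0.
Qed.

Lemma osv_inj : injective osv.
Proof.
move=> p q pq; have E : tag p = tag q.
  by apply/setP => e; rewrite -!osv_eq0 pq.
case: p q E pq => S phi [S' psi] /= E; case: _ / E in psi * => pq.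
congr existT; apply/ffunP => u; have := congr1 (fun h => h (val u)) pq.
by rewrite /= !osv_val => /signr_inj/negb_inj.
Qed.

Definition OP_rp (p : OP G) (x : edge G -> F) :=
  isflow x /\ forall e, Num.sg (x e) = osv (val p) e.

Lemma osv_flow (p : OP G) : exists x, OP_rp p x.
Proof.
case: p => -[S phi] /= H; have /andP[_ /(totally_cyclicP F)[x fx xphi]] := H.
exists (ext x); split; first exact/flow_delete.
move=> e; have [eS|eS] := boolP (e \in S).
  by rewrite /osv /= !ext_out ?sgr0 //= eS.
have -> : e = val (exist (fun e => e \notin S) e eS) by [].
rewrite (ext_val x) (osv_val phi) /=; exact: xphi.
Qed.

Lemma flow_osv x : isflow x -> exists p, OP_rp p x.
Proof.
move=> fx; pose S := [set e | x e == 0].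
pose phi : orientation (delete S) := [ffun u => 0 < x (val u)].
have phiE u : Num.sg (x (val u)) = orient_sg F phi u.
  rewrite /orient_sg ffunE; have := valP u; rewrite inE neq_lt => /orP[x0|x0].
    by rewrite (lt_gtF x0) ltr0_sg.
  by rewrite x0 gtr0_sg.
have H : no_separating (delete S) && totally_cyclic phi.
  apply/andP; split.
    by apply/(no_separating_delete F); exists x => // e; rewrite inE.
  apply/(totally_cyclicP F); exists (fun u => x (val u)) => //.
  apply/flow_delete; rewrite ext_res // => e; rewrite inE negbK.
  by move/eqP.
pose t : oriented := pair phi.
exists (exist (fun x : oriented => no_separating (delete (tag x)) &&
  totally_cyclic (tagged x)) t H); split=> // e /=.
have [eS|eS] := boolP (e \in S).
  by rewrite /osv ext_out /= ?eS //; move: eS; rewrite inE => /eqP->; rewrite sgr0.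
by have := osv_val phi (exist _ e eS); rewrite -phiE => ->.
Qed.

Lemma OP_geP (p q : OP G) : OP_ge p q <-> forall e, osv (val q) e != 0 ->
  osv (val q) e = osv (val p) e.
Proof.
case: p q => -[S phi] Hp [[T psi] Hq]; rewrite /OP_ge /=.
split=> [/andP[/subsetP ST /forallP H] e|H].
  rewrite osv_eq0 /= => eT; have eS : e \notin S by apply: contraNN eT; apply: ST.
  have /forallP/(_ (exist _ e eS))/implyP/(_ (eqxx _))/eqP E := H (exist _ e eT).
  rewrite (osv_val psi (exist _ e eT)) (osv_val phi (exist _ e eS)).
  by rewrite /orient_sg E.
apply/andP; split.
  apply/subsetP => e eS; apply/negPn/negP => eT.
  have := H e; rewrite osv_eq0 => /(_ eT) /eqP.
  have /eqP -> : osv (pair phi) e == 0.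
    by rewrite osv_eq0.
  by rewrite osv_eq0 (negPf eT).
apply/forallP => u; apply/forallP => u'; apply/implyP => /eqP uu'.
have := H (val u); rewrite osv_eq0 => /(_ (valP u)).
have -> : osv (pair phi) (val u) = orient_sg F phi u'.
  exact: etrans (congr1 (osv (pair phi)) uu') (osv_val phi u').
by rewrite (osv_val psi) => /signr_inj/negb_inj->.
Qed.

Lemma OP_cell_poset : cell_poset (@isflow F G) (@sg_eqv F (edge G))
  (@OP_ge G) OP_rp.
Proof.
split=> [|p x []//||p q x y [fx xp] [fy yq]|p q].
- exact: osv_flow.
- exact: flow_osv.
- split=> [pq e|xy]; first by rewrite xp yq pq.
  by apply/val_inj/osv_inj; apply: funext => e; rewrite -xp -yq.
split=> [/OP_geP pq|[x [y [[fx xp] [fy yq] yx]]]].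
  have [x [fx xp]] := osv_flow p; have [y [fy yq]] := osv_flow q.
  by exists x, y; split=> // e ye; rewrite xp yq pq // -yq sgr_eq0.
apply/OP_geP => e; rewrite -yq -xp sgr_eq0; exact: yx.
Qed.

Lemma OP_equivP (p q : OP G) : OP_equiv p q <->
  (forall e, (osv (val p) e == 0) = (osv (val q) e == 0)) /\
  isflow (fun e => osv (val p) e - osv (val q) e).
Proof.
rewrite /OP_equiv; move: (val p) (val q) => {p q} [T phi] [T' psi] /=.
have netE (phi1 phi2 : orientation (delete T)) v :
    net (fun e => osv (pair phi1) e - osv (pair phi2) e) v =
    2 * ((out_degree phi2 v)%:R - (out_degree phi1 v)%:R).
  have -> : (fun e => osv (pair phi1) e - osv (pair phi2) e) =
      (fun e => 1 * osv (pair phi1) e + (-1) * osv (pair phi2) e).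
    by apply: funext => e; ring.
  have net_osv (phi0 : orientation (delete T)) :
      net (osv (pair phi0)) v = @net F (delete T) (orient_sg F phi0) v.
    rewrite /net -(sum_ext (orient_sg F phi0) (fun e => tgt e == v)).
    by rewrite -(sum_ext (orient_sg F phi0) (fun e => src e == v)).
  by rewrite net_lin !net_osv !net_orient_sg; ring.
split=> [/andP[/eqP E]|[supp fl]].
  case: _ / E in psi * => /forallP deg; split=> [e|v]; first by rewrite !osv_eq0.
  by rewrite netE (eqP (deg v)) subrr mulr0.
have E : T = T'.
  by apply/setP => e; have := supp e; rewrite !osv_eq0.
case: _ / E in psi supp fl *; rewrite eqxx /=; apply/forallP => v.
have /eqP := fl v; rewrite netE mulf_eq0 pnatr_eq0 /= subr_eq0 eqr_nat.
by rewrite eq_sym.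
Qed.

Lemma OP_equiv_sg (p q : OP G) x y : OP_rp p x -> OP_rp q y ->
  OP_equiv p q <-> flow_eqv (@isflow F G) x y.
Proof.
move=> [fx xp] [fy yq]; rewrite OP_equivP /flow_eqv.
have -> : (fun e => Num.sg (x e) - Num.sg (y e)) =
  (fun e => osv (val p) e - osv (val q) e) by apply: funext => e; rewrite xp yq.
by split=> -[h1 h2]; split=> // e; [rewrite -sgr_eq0 -(sgr_eq0 (y e)) xp yq |
  rewrite -xp -yq !sgr_eq0].
Qed.

Lemma OP_equiv_class (p q : OP G) : OP_equiv p q ->
  [set r | OP_equiv p r] = [set r | OP_equiv q r].
Proof.
have sym (a b : OP G) : OP_equiv a b -> OP_equiv b a.
  move=> /OP_equivP[h1 h2]; apply/OP_equivP; split=> [e|]; first by rewrite h1.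
  by apply: (subspace_scale (t := -1) (isflow_subspace F G) h2) => e; ring.
have trans (a b c : OP G) : OP_equiv a b -> OP_equiv b c -> OP_equiv a c.
  move=> /OP_equivP[h1 h2] /OP_equivP[h3 h4]; apply/OP_equivP.
  split=> [e|]; first by rewrite h1.
  by apply: (subspace_lin (a := 1) (b := 1) (isflow_subspace F G) h2 h4) => e; ring.
move=> pq; apply/setP => r; rewrite !inE; apply/idP/idP; apply: trans => //.
exact: sym.
Qed.

Lemma OP_equiv_refl (p : OP G) : OP_equiv p p.
Proof.
apply/OP_equivP; split=> // v.
have -> : (fun e => osv (val p) e - osv (val p) e) = fun=> 0.
  by apply: funext => e; rewrite subrr.
by rewrite (isflow_subspace F G).1.
Qed.

Definition OPbar_rp (C : OPbar G) (x : edge G -> F) :=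
  exists2 p, p \in val C & OP_rp p x.

Lemma OPbar_class (C : OPbar G) p : p \in val C -> val C = [set q | OP_equiv p q].
Proof.
have /existsP[r /eqP ->] := valP C; rewrite inE; exact: OP_equiv_class.
Qed.

Lemma OPbar_cell_poset : cell_poset (@isflow F G) (flow_eqv (@isflow F G))
  (@OPbar_ge G) OPbar_rp.
Proof.
have [rp_ex _ rp_cl _ geE] := OP_cell_poset.
split=> [C|C x [p _ []]//|x fx|C D x y [p pC px] [q qD qy]|C D].
- have /existsP[p /eqP CE] := valP C; have [x px] := rp_ex p.
  by exists x, p => //; rewrite CE inE OP_equiv_refl.
- have [p px] := rp_cl x fx.
  have H : [exists r, [set q | OP_equiv p q] == [set q | OP_equiv r q]].
    by apply/existsP; exists p.
  exists (exist (fun C : {set OP G} => [exists x, C == [set y | OP_equiv x y]]) _ H).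
  by exists p => //=; rewrite inE OP_equiv_refl.
- rewrite -(OP_equiv_sg px qy); split=> [CD|pq].
    by move: qD; rewrite -CD (OPbar_class pC) inE.
  by apply: val_inj; rewrite (OPbar_class pC) (OPbar_class qD); apply: OP_equiv_class.
split=> [/existsP[p /andP[pC /existsP[q /andP[qD /geE[x [y [px qy yx]]]]]]]|].
  by exists x, y; split=> //; [exists p | exists q].
move=> [x [y [[p pC px] [q qD qy] yx]]].
apply/existsP; exists p; rewrite pC; apply/existsP; exists q; rewrite qD /=.
by apply/geE; exists x, y.
Qed.

End OrientationPosets.

(** * Transport along a signed correspondence *)

Section Links.
Variables (F : realFieldType) (G G' : graph) (m : edge G -> edge G' -> F).
Hypothesis ml : sign_link m.

(** This dichotomy transports every property from [G] to [G']: a coordinate without a partner is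
    zero on all flows. *)
Lemma linked_coord e' : (exists e, m e e' != 0) \/
  forall x', @isflow F G' x' -> x' e' = 0.
Proof.
have [_ _ _ _ dead] := ml; have [ex|no] := pselect (exists e, m e e' != 0).
  by left.
by right=> x' fx'; apply/eqP/negPn/negP => xe; apply: no; apply: dead fx' xe.
Qed.

Lemma linked_supp x x' y y' : isflow x' -> isflow y' -> linked m x x' ->
  linked m y y' -> (forall e, x e = 0 -> y e = 0) ->
  forall e', x' e' = 0 -> y' e' = 0.
Proof.
move=> fx' fy' lx ly xy e' xe'; have [[e me]|->//] := linked_coord e'.
rewrite (ly e e' me) xy ?mulr0 //; have /eqP := lx e e' me.
by rewrite xe' eq_sym mulf_eq0 (negPf me) => /eqP.
Qed.

Lemma linked_sg x x' e e' : linked m x x' -> m e e' != 0 ->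
  Num.sg (x' e') = m e e' * Num.sg (x e).
Proof.
move=> lx me; rewrite (lx e e' me) sgrM; have [m1 _ _ _ _] := ml.
by case: (m1 e e') me => ->; rewrite ?eqxx // ?sgrN sgr1.
Qed.

Lemma linked_sg_eqv x x' y y' : isflow x' -> isflow y' -> linked m x x' ->
  linked m y y' -> sg_eqv x y -> sg_eqv x' y'.
Proof.
move=> fx' fy' lx ly xy e'; have [[e me]|z] := linked_coord e'.
  by rewrite (linked_sg lx me) (linked_sg ly me) xy.
by rewrite !z.
Qed.

Lemma linked_conf x x' y y' : isflow x' -> isflow y' -> linked m x x' ->
  linked m y y' -> conf y x -> conf y' x'.
Proof.
move=> fx' fy' lx ly yx e'; have [[e me]|z] := linked_coord e'; last by rewrite !z.
rewrite (ly e e' me) mulf_eq0 (negPf me) /= => ye.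
by rewrite -(ly e e' me) (linked_sg lx me) (linked_sg ly me) yx.
Qed.

Lemma linked_flow_eqv x x' y y' : isflow x' -> isflow y' -> linked m x x' ->
  linked m y y' -> flow_eqv (@isflow F G) x y -> flow_eqv (@isflow F G') x' y'.
Proof.
move=> fx' fy' lx ly [xy fl]; split=> [e'|].
  have xy0 e : x e = 0 -> y e = 0 by move=> /eqP; rewrite xy => /eqP.
  have yx0 e : y e = 0 -> x e = 0 by move=> /eqP; rewrite -xy => /eqP.
  apply/eqP/eqP; first exact: (linked_supp fx' fy' lx ly xy0).
  exact: (linked_supp fy' fx' ly lx yx0).
have [_ tot _ _ _] := ml; have [z' fz' lz] := tot _ fl.
suff -> : (fun e' => Num.sg (x' e') - Num.sg (y' e')) = z' by [].
apply: funext => e'; have [[e me]|z] := linked_coord e'.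
  by rewrite (lz e e' me) (linked_sg lx me) (linked_sg ly me) mulrBr.
by rewrite !z // sgr0 subrr.
Qed.

Lemma linked_sym x x' : linked m x x' -> linked (fun e' e => m e e') x' x.
Proof.
move=> lx e' e me; have [m1 _ _ _ _] := ml; rewrite (lx e e' me).
by case: (m1 e e') me => ->; rewrite ?eqxx // !(mul1r, mulN1r) ?opprK.
Qed.

End Links.

Lemma sign_link_sym (F : realFieldType) (G G' : graph)
  (m : edge G -> edge G' -> F) : sign_link m -> sign_link (fun e' e => m e e').
Proof.
move=> ml; have [m1 tot tot' dead dead'] := ml; split=> // [x' /tot'[x fx lx]|x /tot[x' fx' lx]].
  by exists x => //; apply: linked_sym.
by exists x' => // e' e me; apply: (linked_sym ml lx).
Qed.

Section CellIso.
Variables (F : realFieldType) (G G' : graph) (X X' : Type).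
Variables (ge : rel X) (ge' : rel X').
Variables (rp : X -> (edge G -> F) -> Prop) (rp' : X' -> (edge G' -> F) -> Prop).
Variables (eqv : (edge G -> F) -> (edge G -> F) -> Prop).
Variables (eqv' : (edge G' -> F) -> (edge G' -> F) -> Prop).
Hypotheses (cpX : cell_poset (@isflow F G) eqv ge rp) (tm : tame eqv).
Hypotheses (cpX' : cell_poset (@isflow F G') eqv' ge' rp') (tm' : tame eqv').

Lemma cell_poset_refl : reflexive ge.
Proof. by move=> C; have [x Cx] := rp_ex cpX C; apply: (ge_conf cpX Cx Cx). Qed.

Lemma cell_poset_anti : antisymmetric ge.
Proof.
move=> C D /andP[CD DC]; have [x Cx] := rp_ex cpX C; have [y Dy] := rp_ex cpX D.
apply/esym/(ge_eq cpX tm CD Cx Dy) => i.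
exact: (ge_supp cpX tm DC Dy Cx).
Qed.

Lemma supp_mono_SP (f : X -> X') (g : X' -> X) : cancel g f ->
  cancel f g -> supp_mono rp rp' f -> supp_mono rp' rp g ->
  order_iso (@SP_ge G) (@SP_ge G').
Proof.
move=> gK fK sf sg; pose r x x' := exists2 C, rp C x & rp' (f C) x'.
apply: (SP_iso_flows (r := r)) => [x /(rp_cl cpX)[C Cx]|x' /(rp_cl cpX')[C' Cx']|].
- have [x' Cx'] := rp_ex cpX' (f C); exists x'; last by exists C.
  exact: (rp_in cpX' Cx').
- have [x Cx] := rp_ex cpX (g C'); exists x; first exact: (rp_in cpX Cx).
  by exists (g C') => //; rewrite gK.
move=> x x' y y' _ _ _ _ [C Cx Cx'] [D Dy Dy']; split=> xy.
  exact: (sf D C y x y' x').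
by apply: (sg (f D) (f C) y' x' y x); rewrite ?fK.
Qed.

End CellIso.

Lemma cell_link_ge (F : realFieldType) (G G' : graph) (X X' : Type)
    (ge : rel X) (ge' : rel X') (rp : X -> (edge G -> F) -> Prop)
    (rp' : X' -> (edge G' -> F) -> Prop) eqv eqv' (m : edge G -> edge G' -> F) :
  cell_poset (@isflow F G) eqv ge rp -> cell_poset (@isflow F G') eqv' ge' rp' ->
  sign_link m ->
  (forall x x' y y', isflow x' -> isflow y' -> linked m x x' -> linked m y y' ->
     eqv x y -> eqv' x' y') ->
  forall C D C' D' x x' y y', rp C x -> rp' C' x' -> linked m x x' ->
    rp D y -> rp' D' y' -> linked m y y' -> ge C D -> ge' C' D'.
Proof.
move=> cpX cpX' ml eqvL C D C' D' x x' y y' Cx Cx' lx Dy Dy' ly.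
move=> /(ge_rp cpX)[x1 [y1 [Cx1 Dy1 yx1]]]; have [_ tot _ _ _] := ml.
have [x1' fx1' lx1] := tot x1 (rp_in cpX Cx1).
have [y1' fy1' ly1] := tot y1 (rp_in cpX Dy1).
have fx' := rp_in cpX' Cx'; have fy' := rp_in cpX' Dy'.
have Cx1' : rp' C' x1'.
  apply: (rp_transfer cpX' Cx' fx1'); apply: eqvL lx lx1 _ => //.
  exact/(rp_eq cpX Cx Cx1).
have Dy1' : rp' D' y1'.
  apply: (rp_transfer cpX' Dy' fy1'); apply: eqvL ly ly1 _ => //.
  exact/(rp_eq cpX Dy Dy1).
by apply: (ge_conf cpX' Cx1' Dy1'); apply: (linked_conf ml fx1' fy1' lx1 ly1).
Qed.

Lemma cell_link_iso (F : realFieldType) (G G' : graph) (X X' : Type)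
    (ge : rel X) (ge' : rel X') (rp : X -> (edge G -> F) -> Prop)
    (rp' : X' -> (edge G' -> F) -> Prop) eqv eqv' (m : edge G -> edge G' -> F) :
  cell_poset (@isflow F G) eqv ge rp -> cell_poset (@isflow F G') eqv' ge' rp' ->
  tame eqv -> tame eqv' -> sign_link m ->
  (forall x x' y y', isflow x' -> isflow y' -> linked m x x' -> linked m y y' ->
     eqv x y -> eqv' x' y') ->
  (forall x x' y y', isflow x -> isflow y -> linked m x x' -> linked m y y' ->
     eqv' x' y' -> eqv x y) ->
  order_iso ge ge'.
Proof.
move=> cpX cpX' tm tm' ml eqvL eqvR; have ml' := sign_link_sym ml.
have [_ tot tot' _ _] := ml.
pose r C C' := exists x x', [/\ rp C x, rp' C' x' & linked m x x'].
apply: (order_iso_rel (r := r)).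
- exact: (cell_poset_refl cpX).
- exact: (cell_poset_anti cpX tm).
- exact: (cell_poset_refl cpX').
- exact: (cell_poset_anti cpX' tm').
- move=> C; have [x Cx] := rp_ex cpX C; have [x' fx' lx] := tot x (rp_in cpX Cx).
  by have [C' Cx'] := rp_cl cpX' fx'; exists C', x, x'.
- move=> C'; have [x' Cx'] := rp_ex cpX' C'; have [x fx lx] := tot' x' (rp_in cpX' Cx').
  by have [C Cx] := rp_cl cpX fx; exists C, x, x'.
move=> C C' D D' [x [x' [Cx Cx' lx]]] [y [y' [Dy Dy' ly]]]; apply/idP/idP.
  exact: (cell_link_ge cpX cpX' ml eqvL Cx Cx' lx Dy Dy' ly).
apply: (cell_link_ge cpX' cpX ml' _ Cx' Cx _ Dy' Dy).
- move=> z z' w w' fz' fw' lz lw.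
  by apply: eqvR => //; [exact: (linked_sym ml' lz) | exact: (linked_sym ml' lw)].
- exact: (linked_sym ml lx).
- exact: (linked_sym ml ly).
Qed.

Section OrientationIso.
Variables (F : realFieldType) (G G' : graph).

Lemma sign_link_OP (m : edge G -> edge G' -> F) : sign_link m ->
  order_iso (@OP_ge G) (@OP_ge G').
Proof.
move=> ml; have ml' := sign_link_sym ml.
apply: (cell_link_iso (OP_cell_poset F G) (OP_cell_poset F G')
  (sg_eqv_tame _ _) (sg_eqv_tame _ _) ml) => x x' y y' fx fy lx ly.
  exact: (linked_sg_eqv ml).
exact: (linked_sg_eqv ml' fx fy (linked_sym ml lx) (linked_sym ml ly)).
Qed.

Lemma sign_link_OPbar (m : edge G -> edge G' -> F) : sign_link m ->
  order_iso (@OPbar_ge G) (@OPbar_ge G').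
Proof.
move=> ml; have ml' := sign_link_sym ml.
apply: (cell_link_iso (OPbar_cell_poset F G) (OPbar_cell_poset F G')
  (flow_eqv_tame (isflow_subspace F G)) (flow_eqv_tame (isflow_subspace F G')) ml)
  => x x' y y' fx fy lx ly.
  exact: (linked_flow_eqv ml).
exact: (linked_flow_eqv ml' fx fy (linked_sym ml lx) (linked_sym ml ly)).
Qed.

Lemma OP_SP : order_iso (@OP_ge G) (@OP_ge G') ->
  order_iso (@SP_ge G) (@SP_ge G').
Proof.
move=> [f [g fK gK] fge]; have gge := mono_inv gK fge.
have sP := isflow_subspace rat G; have sP' := isflow_subspace rat G'.
have cpX := OP_cell_poset rat G; have cpX' := OP_cell_poset rat G'.
apply: (supp_mono_SP cpX cpX' gK fK).
  exact: (sign_iso_supp sP sP' cpX cpX' fK gK fge).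
exact: (sign_iso_supp sP' sP cpX' cpX gK fK gge).
Qed.

Lemma OPbar_SP : order_iso (@OPbar_ge G) (@OPbar_ge G') ->
  order_iso (@SP_ge G) (@SP_ge G').
Proof.
move=> [f [g fK gK] fge]; have gge := mono_inv gK fge.
have sP := isflow_subspace rat G; have sP' := isflow_subspace rat G'.
have rP := @flow_regular rat G; have rP' := @flow_regular rat G'.
have cpX := OPbar_cell_poset rat G; have cpX' := OPbar_cell_poset rat G'.
apply: (supp_mono_SP cpX cpX' gK fK).
  exact: (flow_iso_supp sP rP sP' rP' cpX cpX' fK gK fge).
exact: (flow_iso_supp sP' rP' sP rP cpX' cpX gK fK gge).
Qed.

End OrientationIso.

(** * The Delaunay decomposition *)

Section Boxes.
Variable R : realType.
Implicit Types (b x y : R).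

(* [x] is between the floor and the ceiling of [b]. *)
Definition inbox b x := forall n : int,
  (n%:~R <= b -> n%:~R <= x) /\ (b <= n%:~R -> x <= n%:~R).

Lemma inbox_refl b : inbox b b. Proof. by []. Qed.

Lemma inbox_trans b x y : inbox b x -> inbox x y -> inbox b y.
Proof. by move=> bx xy n; split=> h; [apply/(xy n).1/(bx n).1|apply/(xy n).2/(bx n).2]. Qed.

Lemma inbox_int b x : b \is a Num.int -> inbox b x -> x = b.
Proof.
move=> /intrP[n ->] /(_ n)[h1 h2]; apply/eqP; rewrite eq_le.
by rewrite h1 // h2.
Qed.

Lemma nonint_floor b : b \isn't a Num.int ->
  exists n : int, n%:~R < b < (n + 1)%:~R.
Proof.
move=> bZ; exists (Num.floor b); rewrite lt_neqAle floor_le andbT floorD1_gt andbT.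
by apply: contraNneq bZ => <-; apply: intr_int.
Qed.

Lemma inbox_nonint (n : int) b x : n%:~R < b < (n + 1)%:~R ->
  inbox b x <-> n%:~R <= x <= (n + 1)%:~R.
Proof.
move=> /andP[nb bn]; split=> [bx|/andP[nx xn] k]; first by rewrite (bx n).1 ?(bx (n + 1)).2 // ltW.
split=> kb.
  have : (k%:~R : R) < (n + 1)%:~R by apply: le_lt_trans kb bn.
  rewrite ltr_int ltzD1 => kn; apply: le_trans nx; by rewrite ler_int.
have : n%:~R < (k%:~R : R) by apply: lt_le_trans nb kb.
rewrite ltr_int -lezD1 => kn; apply: le_trans xn _; by rewrite ler_int.
Qed.

(** [b] is in the box of [c] and can be passed when coming from [c], so it is not an end of a
    nondegenerate box. *)
Lemma inbox_eq b c (t : R) : inbox c b -> 0 < t -> inbox c (b + t * (b - c)) ->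
  forall x, inbox b x <-> inbox c x.
Proof.
move=> cb t0 ct x; split; first exact: inbox_trans.
move=> cx n; split=> h; [apply: (cx n).1 | apply: (cx n).2].
  rewrite leNgt; apply/negP => cn.
  have bn : b = n%:~R by apply/eqP; rewrite eq_le h (cb n).2 // ltW.
  have := (ct n).2 (ltW cn); rewrite leNgt => /negP; apply.
  by rewrite bn ltrDl mulr_gt0 // subr_gt0.
rewrite leNgt; apply/negP => cn.
have bn : b = n%:~R by apply/eqP; rewrite eq_le h (cb n).1 // ltW.
have := (ct n).1 (ltW cn); rewrite leNgt => /negP; apply.
by rewrite bn gtrDl pmulr_rlt0 // subr_lt0.
Qed.

Lemma inbox_opp b x : inbox b x -> inbox (- b) (- x).
Proof.
move=> bx n; split=> h.
  by rewrite lerNr -mulrNz; apply: (bx (- n)).2; rewrite mulrNz lerNr.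
by rewrite lerNl -mulrNz; apply: (bx (- n)).1; rewrite mulrNz lerNl.
Qed.

(* [p] is the centre of the box with the squared distance of its ends to it. *)
Lemma inbox_center b : exists p : R * R, forall k : int,
  p.2 <= (k%:~R - p.1) ^+ 2 /\ ((k%:~R - p.1) ^+ 2 = p.2 <-> inbox b k%:~R).
Proof.
have [bZ|bZ] := boolP (b \is a Num.int).
  exists (b, 0) => k /=; split; first exact: sqr_ge0.
  split=> [/eqP|/(inbox_int bZ)->]; last by rewrite subrr expr0n.
  by rewrite sqrf_eq0 subr_eq0 => /eqP->.
have [n nb] := nonint_floor bZ; exists (n%:~R + 2^-1, 4^-1) => k /=.
rewrite (inbox_nonint _ nb) !ler_int.
have -> : (k%:~R - (n%:~R + 2^-1)) ^+ 2 = 4^-1 + ((k - n) * (k - n - 1))%:~R :> R.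
  by rewrite intrM !intrB; field.
rewrite lerDl; have ge0 : (0 <= (k - n) * (k - n - 1))%R.
  have [kn|kn] := lerP k n; first by rewrite mulr_le0 // ?subr_le0 //; lia.
  by rewrite mulr_ge0 // subr_ge0 //; lia.
split; first by rewrite ler0z.
split=> [/eqP|].
  rewrite -subr_eq0 addrAC subrr add0r intr_eq0 mulf_eq0 => /orP[] /eqP; lia.
move=> kn; have [->|->] : k = n \/ k = n + 1 by lia.
  by rewrite subrr mul0r addr0.
by rewrite [n + 1]addrC addrK subrr mulr0 addr0.
Qed.

End Boxes.

(** * Boxes as lattice polytopes *)

Section LatticeCells.
Variables (R : realType) (G : graph).
Local Notation H := (H1 R G).
Implicit Types (a b x y z : H) (e : edge G).

Definition coords x (e : edge G) : R := (val x : chain1 R G) e.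

Lemma coords_flow x : isflow (coords x).
Proof. exact/cycle_spaceP/subvsP. Qed.

Lemma coords_inj x y : (forall e, coords x e = coords y e) -> x = y.
Proof. by move=> xy; apply: val_inj; apply/ffunP => e; apply: xy. Qed.

Lemma coords_onto (y : edge G -> R) : isflow y -> exists x, coords x = y.
Proof.
move=> fy; have yV : ([ffun e => y e] : chain1 R G) \in cycle_space R G.
  apply/cycle_spaceP; rewrite (_ : (fun e => _) = y) //.
  by apply: funext => e; rewrite ffunE.
exists (Subvs yV); apply: funext => e; by rewrite /coords /= ffunE.
Qed.

Lemma coordsD x y e : coords (x + y) e = coords x e + coords y e.
Proof. by rewrite /coords linearD /= ffunE. Qed.

Lemma coordsZ t x e : coords (t *: x) e = t * coords x e.
Proof. by rewrite /coords linearZ /= ffunE. Qed.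

Lemma coordsN x e : coords (- x) e = - coords x e.
Proof. by rewrite -scaleN1r coordsZ mulN1r. Qed.

Lemma coordsB x y e : coords (x - y) e = coords x e - coords y e.
Proof. by rewrite coordsD coordsN. Qed.

Lemma coords0 e : coords 0 e = 0.
Proof. by rewrite -(subrr (0 : H)) coordsB subrr. Qed.

Lemma coords_sum (J : finType) (p : J -> H) e :
  coords (\sum_j p j) e = \sum_j coords (p j) e.
Proof.
by elim/big_ind2: _ => [|x1 x2 y1 y2 E1 E2|//]; rewrite ?coords0 ?coordsD ?E1 ?E2.
Qed.

Definition box b : H -> Prop := fun x => forall e, inbox (coords b e) (coords x e).

Lemma box_trans b x y : box b x -> box x y -> box b y.
Proof. by move=> bx xy e; apply: inbox_trans (bx e) (xy e). Qed.

Lemma box_refl b : box b b. Proof. by move=> e; apply: inbox_refl. Qed.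

(** [b] is in the relative interior of its own box: its coordinates that are not integers have room
    on both sides, and the others are constant on the box. *)
Lemma box_relint b y : box b y -> exists2 t, 0 < t & box b (b + t *: (b - y)).
Proof.
move=> yb; pose frac e := coords b e \isn't a Num.int.
have flo e : exists n : int, frac e -> n%:~R < coords b e < (n + 1)%:~R.
  have [/nonint_floor[n nb]|bZ] := boolP (frac e); first by exists n.
  by exists 0.
have [n nP] := choice flo.
pose gap e := if frac e then Num.min (coords b e - (n e)%:~R)
  ((n e + 1)%:~R - coords b e) else 0.
have [t t0 tP] := small_scale gap (coords (b - y)).
exists t => // e; rewrite coordsD coordsZ.
have [fe|] := boolP (frac e); last first.
  rewrite negbK => bZ; have := inbox_int bZ (yb e).
  by rewrite coordsB => ->; rewrite subrr mulr0 addr0; apply: inbox_refl.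
have nb := nP e fe; apply/(inbox_nonint _ nb); have := tP e.
have /andP[n1 n2] := nb.
have g0 : 0 < gap e by rewrite /gap fe lt_min !subr_gt0 n1 n2.
rewrite gt_eqF // (gtr0_norm g0) => /(_ isT).
rewrite -[X in X * _](gtr0_norm t0) -normrM ltr_norml ltrNl /gap fe !lt_min.
move=> /andP[/andP[lo1 lo2] /andP[hi1 hi2]].
apply/andP; split; lra.
Qed.

Lemma box_eq b c t : box c b -> 0 < t -> box c (b + t *: (b - c)) ->
  forall x, box b x <-> box c x.
Proof.
move=> cb t0 ct x; have E e : forall r, inbox (coords b e) r <-> inbox (coords c e) r.
  by apply: (inbox_eq (cb e) t0); have := ct e; rewrite coordsD coordsZ coordsB.
by split=> bx e; apply/E.
Qed.

(** [t] brings [y] into the open unit cube, where only zero coordinates are integers; the box of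
    [t y] then allows small motions both ways exactly in the coordinates where [y] is nonzero. *)
Lemma box_supp x y : (forall e, coords y e = 0 -> coords x e = 0) <->
  exists t s, [/\ 0 < t, 0 < s, box (t *: y) (t *: y + s *: x) &
    box (t *: y) (t *: y - s *: x)].
Proof.
split=> [xy|[t [s [t0 s0 b1 b2]]] e ye]; last first.
  have Z0 : coords (t *: y) e \is a Num.int by rewrite coordsZ ye mulr0 rpred0.
  have := inbox_int Z0 (b1 e); rewrite coordsD (coordsZ s) => E.
  have /eqP : s * coords x e = 0 by lra.
  by rewrite mulf_eq0 (gt_eqF s0) => /eqP.
have [t t0 tP] := small_scale (fun=> 1 : R) (coords y).
have tP1 e : `|t * coords y e| < 1.
  by have := tP e (oner_neq0 _); rewrite normr1 normrM (gtr0_norm t0).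
pose gap e := if coords y e == 0 then 0 else
  Num.min `|t * coords y e| (1 - `|t * coords y e|).
have [s s0 sP] := small_scale gap (coords x).
suff inb e (c : R) : `|c| = s -> inbox (t * coords y e) (t * coords y e + c * coords x e).
  exists t, s; split=> // e; rewrite ?coordsB ?coordsD !coordsZ.
    by apply: inb; rewrite gtr0_norm.
  by rewrite -mulNr; apply: inb; rewrite normrN gtr0_norm.
move=> cs; have [ye|ye] := eqVneq (coords y e) 0.
  by rewrite (xy e ye) mulr0 addr0; apply: inbox_refl.
have ty0 : 0 < `|t * coords y e| by rewrite normr_gt0 mulf_neq0 // gt_eqF.
have g0 : 0 < gap e by rewrite /gap (negPf ye) lt_min ty0 subr_gt0 tP1.
have := sP e; rewrite gt_eqF // (gtr0_norm g0) => /(_ isT).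
rewrite -cs -normrM /gap (negPf ye) lt_min => /andP[lt1 lt2].
have := tP1 e; move: ty0 lt1 lt2; set u := t * _; set v := c * _ => u0 lt1 lt2 u1.
have pos (p q : R) : 0 < p -> `|q| < `|p| -> `|q| < 1 - `|p| -> p < 1 ->
    inbox p (p + q).
  move=> p0 qp qp1 p1; apply/(@inbox_nonint _ 0); first by rewrite p0 add0r.
  rewrite (gtr0_norm p0) in qp qp1; move: qp qp1; rewrite !ltr_norml.
  rewrite add0r => /andP[h1 h2] /andP[h3 h4]; apply/andP; split; lra.
have [un|up|ue] := ltrgtP u 0.
- have : inbox (- u) (- u - v).
    apply: pos; rewrite ?normrN ?oppr_gt0 //.
    by move: u1; rewrite ltr_norml => /andP[h1 h2]; lra.
  by move=> /inbox_opp; rewrite opprK opprD opprK opprK.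
- by apply: pos => //; move: u1; rewrite gtr0_norm.
by move: u0; rewrite ue normr0 ltxx.
Qed.

Lemma H1Z_coords x : H1Z x <-> forall e, coords x e \is a Num.int.
Proof. by []. Qed.

Lemma H1normE x : H1norm x = Num.sqrt (\sum_e coords x e ^+ 2).
Proof. by []. Qed.

Lemma coord_le_norm x e : `|coords x e| <= H1norm x.
Proof.
rewrite H1normE -sqrtr_sqr; apply: ler_wsqrtr.
rewrite (bigD1 e) //= lerDl; apply: sumr_ge0 => i _; exact: sqr_ge0.
Qed.

Lemma norm_le x y : H1norm x <= H1norm y <->
  \sum_e coords x e ^+ 2 <= \sum_e coords y e ^+ 2.
Proof.
have ge0 z : 0 <= \sum_e coords z e ^+ 2 by apply: sumr_ge0 => e _; apply: sqr_ge0.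
by rewrite !H1normE; split=> h; [rewrite -ler_sqrt | rewrite ler_sqrt].
Qed.

Lemma convex_hull_incl (A B : H -> Prop) x : (forall y, A y -> B y) ->
  convex_hull A x -> convex_hull B x.
Proof.
move=> AB [n [p [t [Ap t0 t1 xE]]]]; exists n, p, t; split=> // i; exact/AB.
Qed.

Lemma convex_hull_in (A : H -> Prop) x : A x -> convex_hull A x.
Proof.
move=> Ax; exists 1%N, (fun=> x), (fun=> 1).
by split=> //; rewrite big_ord1 ?scale1r.
Qed.

Lemma convex_hull_mid (A : H -> Prop) (s t : R) x y : 0 < s -> 0 < t ->
  convex_hull A x -> convex_hull A y ->
  convex_hull A ((s + t)^-1 *: (s *: x + t *: y)).
Proof.
move=> s0 t0 [n [p [c [Ap c0 c1 ->]]]] [n' [p' [c' [Ap' c'0 c'1 ->]]]].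
have st0 : 0 < s + t by rewrite addr_gt0.
exists (n + n')%N, (fun i => match split i with inl j => p j | inr j => p' j end).
exists (fun i => (s + t)^-1 * match split i with inl j => s * c j | inr j => t * c' j end).
have lE j : split (lshift n' j : 'I_(n + n')) = inl j := unsplitK (inl j).
have rE j : split (rshift n j : 'I_(n + n')) = inr j := unsplitK (inr j).
split.
- by move=> i; case: (split i).
- move=> i; apply: mulr_ge0; first by rewrite invr_ge0 ltW.
  by case: (split i) => j; rewrite mulr_ge0 // ltW.
- rewrite -mulr_sumr big_split_ord /= (eq_bigr (fun j => s * c j)) => [|j _].
    rewrite [X in _ * (_ + X)](eq_bigr (fun j => t * c' j)) => [|j _]; last by rewrite rE.
    by rewrite -!mulr_sumr c1 c'1 !mulr1 mulVf // gt_eqF.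
  by rewrite lE.
rewrite big_split_ord /=.
rewrite [X in _ = X + _](eq_bigr (fun j => ((s + t)^-1 * s) *: (c j *: p j))) => [|j _].
  rewrite [X in _ = _ + X](eq_bigr
    (fun j => ((s + t)^-1 * t) *: (c' j *: p' j))) => [|j _].
    by rewrite -!scaler_sumr -!scalerA -scalerDr.
  by rewrite rE !scalerA !mulrA.
by rewrite lE !scalerA !mulrA.
Qed.

Lemma convex_hull_affine (A : H -> Prop) (w : edge G -> R) (k : R) x :
  (forall y, A y -> 0 <= \sum_e coords y e * w e + k) -> convex_hull A x ->
  0 <= \sum_e coords x e * w e + k.
Proof.
move=> Aw [n [p [t [Ap t0 t1 ->]]]].
have -> : \sum_e coords (\sum_i t i *: p i) e * w e + k =
    \sum_i t i * (\sum_e coords (p i) e * w e + k).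
  under [RHS]eq_bigr do rewrite mulrDr.
  rewrite big_split /= -mulr_suml t1 mul1r; congr (_ + _).
  under [RHS]eq_bigr do rewrite mulr_sumr.
  rewrite exchange_big /=; apply: eq_bigr => e _.
  rewrite coords_sum mulr_suml; apply: eq_bigr => i _.
  by rewrite coordsZ mulrA.
by apply: sumr_ge0 => i _; rewrite mulr_ge0 ?t0 ?Aw.
Qed.

Lemma hull_in_box b x : convex_hull (fun y => H1Z y /\ box b y) x -> box b x.
Proof.
move=> hx e n; pose w f : R := (f == e)%:R.
have sumE y : \sum_f coords y f * w f = coords y e.
  rewrite (bigD1 e) //= /w eqxx mulr1 big1 ?addr0 // => f /negPf->.
  by rewrite mulr0.
have sumNE y : \sum_f coords y f * - w f = - coords y e.
  by rewrite -sumE -sumrN; apply: eq_bigr => f _; rewrite mulrN.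
split=> h.
  have := @convex_hull_affine _ w (- n%:~R) x _ hx; rewrite sumE subr_ge0; apply.
  by move=> y [_ yb]; rewrite sumE subr_ge0; apply: (yb e n).1.
have := @convex_hull_affine _ (fun f => - w f) n%:~R x _ hx.
rewrite sumNE addrC subr_ge0; apply.
by move=> y [_ yb]; rewrite sumNE addrC subr_ge0; apply: (yb e n).2.
Qed.

Definition nonint y : {set edge G} := [set e | coords y e \isn't a Num.int].

(** [y] moves along [c] until a first coordinate reaches an integer. With entries 0, 1, -1 all
    moving coordinates have the same speed, so the least [gap] is the time of arrival and no
    coordinate leaves its interval. *)
Lemma push (y c : H) e0 : unimodular (coords c) -> coords c e0 != 0 ->
    (forall e, coords y e \is a Num.int -> coords c e = 0) ->
  exists t, [/\ 0 < t, box y (y + t *: c) &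
    (#|nonint (y + t *: c)%R| < #|nonint y|)%N].
Proof.
move=> uc ce0 cZ.
have flo e : exists n : int, coords y e \isn't a Num.int ->
    n%:~R < coords y e < (n + 1)%:~R.
  have [/nonint_floor[n nb]|bZ] := boolP (coords y e \isn't a Num.int).
    by exists n.
  by exists 0 => h; case/negP: bZ.
have [n nP] := choice flo.
have nc e : coords c e != 0 -> (n e)%:~R < coords y e < (n e + 1)%:~R.
  by move=> ce; apply: nP; apply: contra ce => /cZ->.
pose gap e : R := if coords c e == 1 then (n e + 1)%:~R - coords y e
  else coords y e - (n e)%:~R.
have [j cj jmin] := @arg_minP _ R _ e0 (fun e => coords c e != 0) gap ce0.
have gap0 e : coords c e != 0 -> 0 < gap e.
  move=> /nc/andP[h1 h2]; rewrite /gap; case: ifP => _; rewrite subr_gt0 //.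
exists (gap j); split; first exact: gap0.
  move=> e; rewrite coordsD coordsZ; have [->|ce] := eqVneq (coords c e) 0.
    by rewrite mulr0 addr0; apply: inbox_refl.
  have /andP[h1 h2] := nc e ce; apply/(inbox_nonint _ (nc e ce)).
  have : gap j <= gap e := jmin e ce; have := gap0 j cj; rewrite [gap e]/gap.
  have [c0|->|->] := uc e; first by rewrite c0 eqxx in ce.
    by rewrite eqxx mulr1 => g1 g2; apply/andP; split; lra.
  rewrite eq_sym -subr_eq0 opprK (pnatr_eq0 _ 2) mulrN1 /= => g1 g2.
  by apply/andP; split; lra.
apply: proper_card; apply/properP; split.
  apply/subsetP => e; rewrite !inE; apply: contraNN => yZ.
  by rewrite coordsD coordsZ cZ // mulr0 addr0.
exists j; rewrite inE; first by apply: contra cj => /cZ->.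
rewrite negbK coordsD coordsZ /gap; have [c0|->|->] := uc j.
- by rewrite c0 eqxx in cj.
- by rewrite eqxx mulr1 addrCA subrr addr0 intr_int.
rewrite eq_sym -subr_eq0 opprK (pnatr_eq0 _ 2) mulrN1 /= opprB addrCA subrr addr0.
exact: intr_int.
Qed.

(* The constraint matrix is totally unimodular: while some coordinate of [y] is
   not an integer, [y] moves both ways inside its box along a circuit. *)
Lemma box_in_hull y : convex_hull (fun z => H1Z z /\ box y z) y.
Proof.
have [k] := ubnP #|nonint y|; elim: k y => // k IHk y /ltnSE ley.
have [[e ye]|no] := pselect (exists e, coords y e \isn't a Num.int); last first.
  apply: convex_hull_in; split; last exact: box_refl.
  by move=> e; apply/negPn/negP => ye; apply: no; exists e.
have [|||c' [fc' uc' ce cZ]] := @unimodular_avoid R G (coords y) e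
  (fun r => r \is a Num.int) (coords_flow y).
- exact: rpred0.
- by move=> r s rZ sZ; apply: rpredB.
- exact/negP.
have [c cE] := coords_onto fc'; rewrite -cE in uc' ce cZ.
have uNc : unimodular (coords (- c)).
  by move=> f; rewrite coordsN; case: (uc' f) => ->; rewrite ?oppr0 ?opprK;
    [constructor 1 | constructor 3 | constructor 2].
have [t [t0 bt lt]] := push uc' ce cZ.
have [||s [s0 bs ls]] := @push y (- c) e uNc.
- by rewrite coordsN oppr_eq0.
- by move=> f /cZ; rewrite coordsN => ->; rewrite oppr0.
have sub z : box y z -> (#|nonint z| < #|nonint y|)%N ->
    convex_hull (fun z => H1Z z /\ box y z) z.
  move=> bz lz; apply: convex_hull_incl (IHk z (leq_trans lz ley)).
  by move=> u [uZ zu]; split=> //; apply: box_trans bz zu.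
have yE : y = (s + t)^-1 *: (s *: (y + t *: c) + t *: (y + s *: - c)).
  apply: coords_inj => f; rewrite coordsZ coordsD !coordsZ !coordsD !coordsZ coordsN.
  by field; rewrite gt_eqF // addr_gt0.
by rewrite [X in convex_hull _ X]yE; apply: convex_hull_mid => //; apply: sub.
Qed.

Lemma hull_box b x : convex_hull (fun y => H1Z y /\ box b y) x <-> box b x.
Proof.
split=> [|bx]; first exact: hull_in_box.
apply: convex_hull_incl (box_in_hull x) => y [yZ xy]; split=> //.
exact: box_trans bx xy.
Qed.

Lemma norm_closure_box b x : norm_closure (box b) x <-> box b x.
Proof.
split=> [clx|bx eps eps0]; last first.
  exists x => //; rewrite subrr H1normE big1 ?sqrtr0 // => e _.
  by rewrite coords0 expr0n.
move=> e n; split=> h; rewrite leNgt; apply/negP => lt.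
  have [|y yb] := clx (n%:~R - coords x e); first by rewrite subr_gt0.
  rewrite ltNge => /negP; apply; apply: le_trans (coord_le_norm _ e).
  have := (yb e n).1 h; rewrite coordsB -normrN opprB => ny.
  by apply: le_trans (ler_norm _); rewrite lerD2r.
have [|y yb] := clx (coords x e - n%:~R); first by rewrite subr_gt0.
rewrite ltNge => /negP; apply; apply: le_trans (coord_le_norm _ e).
have := (yb e n).2 h; rewrite coordsB => ny.
by apply: le_trans (ler_norm _); rewrite lerD2l lerN2.
Qed.

End LatticeCells.

Section DelaunayCells.
Variables (R : realType) (G : graph).
Local Notation H := (H1 R G).
Implicit Types (a b x y z : H) (e : edge G).

Definition dist2 (h : edge G -> R) x := \sum_e (coords x e - h e) ^+ 2.

(** Orthogonal projection of an arbitrary chain [h] onto the flows, by Gram-Schmidt along a basis.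
    [spanned] is the linear span, stated through its closure properties. *)
Lemma projection (h : edge G -> R) : exists a, forall x,
  \sum_e (h e - coords a e) * coords x e = 0.
Proof.
pose spanned (s : seq H) a := forall Q : H -> Prop, Q 0 ->
  (forall t x y, Q x -> Q y -> Q (t *: x + y)) -> (forall b, b \in s -> Q b) -> Q a.
pose orth (k : edge G -> R) x := \sum_e k e * coords x e = 0.
have orth_lin k t x y : orth k x -> orth k y -> orth k (t *: x + y).
  rewrite /orth => kx ky; transitivity (t * (\sum_e k e * coords x e) +
    \sum_e k e * coords y e); last by rewrite kx ky mulr0 addr0.
  rewrite mulr_sumr -big_split; apply: eq_bigr => e _ /=.
  by rewrite coordsD coordsZ; ring.
have orth0 k : orth k 0 by rewrite /orth big1 // => e _; rewrite coords0 mulr0.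
have orth_span k s a : spanned s a -> (forall b, b \in s -> orth k b) -> orth k a.
  by move=> sa; apply: (sa (orth k)) => // t x y; apply: orth_lin.
have proj s : forall k, exists2 a, spanned s a &
    forall b, b \in s -> orth (fun e => k e - coords a e) b.
  elim: s => [|b s IHs] k; first by exists 0 => // Q Q0 _ _.
  have [a sa oa] := IHs k; have [b1 sb ob] := IHs (coords b).
  (* [d] is the component of [b] orthogonal to the vectors already treated; when [n] is zero so is
     [d], and the value of the quotient [t] is immaterial. *)
  pose d := b - b1; pose n := \sum_e coords d e ^+ 2.
  pose t := (\sum_e (k e - coords a e) * coords d e) / n.
  have od c : c \in s -> orth (coords d) c.
    move=> /ob; rewrite /orth => E; rewrite -[RHS]E; apply: eq_bigr => e _.
    by rewrite coordsB.
  have subE : (fun e => k e - coords (a + t *: d) e) =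
      (fun e => k e - coords a e - t * coords d e).
    by apply: funext => e; rewrite coordsD coordsZ opprD addrA.
  have os c : c \in s -> orth (fun e => k e - coords (a + t *: d) e) c.
    move=> cs; rewrite subE /orth.
    under eq_bigr do rewrite mulrBl -mulrA.
    by rewrite sumrB -mulr_sumr (oa c cs) (od c cs) mulr0 subr0.
  have odd : orth (fun e => k e - coords (a + t *: d) e) d.
    rewrite subE /orth; under eq_bigr do rewrite mulrBl -mulrA -expr2.
    rewrite sumrB -mulr_sumr -/n; have [n0|n0] := eqVneq n 0; last first.
      by rewrite /t divfK ?subrr.
    rewrite n0 mulr0 subr0 big1 // => e _.
    suff -> : coords d e = 0 by rewrite mulr0.
    apply/eqP; rewrite -sqrf_eq0; apply/eqP.
    by apply: (psumr_eq0P _ n0) => // i _; apply: sqr_ge0.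
  exists (a + t *: d).
    move=> Q Q0 Ql Qs; rewrite addrC; apply: (Ql); last first.
      by apply: sa => // c cs; apply: Qs; rewrite inE cs orbT.
    rewrite /d addrC -scaleN1r; apply: (Ql).
      by apply: sb => // c cs; apply: Qs; rewrite inE cs orbT.
    by apply: Qs; rewrite inE eqxx.
  move=> c; rewrite inE => /orP[/eqP->|/os//].
  have -> : b = 1 *: d + b1 by rewrite scale1r subrK.
  by apply: orth_lin => //; apply: (orth_span _ s) sb os.
have [a _ oa] := proj (vbasis (fullv : {vspace H})) h.
exists a => x; rewrite -/(orth (fun e => h e - coords a e) x).
rewrite (coord_vbasis (memvf x)).
elim/big_ind: _ => [|y z oy oz|i _]; first exact: orth0.
  by rewrite -[y]scale1r; apply: orth_lin.
by rewrite -[_ *: _]addr0; apply: orth_lin; [apply: oa; apply: mem_nth; rewrite size_tuple|].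
Qed.

Lemma nearestE a x : nearest a x <-> H1Z x /\ forall y, H1Z y ->
  dist2 (coords a) x <= dist2 (coords a) y.
Proof.
have dE y : dist2 (coords a) y = \sum_e coords (y - a) e ^+ 2.
  by apply: eq_bigr => e _; rewrite coordsB.
split=> -[xZ xmin]; (split; first exact: xZ) => y yZ.
  by rewrite !dE; exact: (norm_le (x - a) (y - a)).1 (xmin y yZ).
by have := xmin y yZ; rewrite !dE; exact: (norm_le (x - a) (y - a)).2.
Qed.

Lemma box_nearest b : exists a, forall x, nearest a x <-> H1Z x /\ box b x.
Proof.
have [p pP] := choice (fun e => inbox_center (coords b e)).
pose h e := (p e).1; pose mu := \sum_e (p e).2.
have [a aP] := projection h; exists a => x.
(* On flows the squared distances to the centre [h] of the box and to its projection [a] differ by a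
   constant, so they have the same minimizers. *)
have pyth y : dist2 h y = dist2 (coords a) y + \sum_e (h e - coords a e) ^+ 2.
  have E z := aP (y - z); have := E a.
  rewrite /dist2 => orth; rewrite -big_split /=.
  transitivity (\sum_e ((coords y e - coords a e) ^+ 2 + (h e - coords a e) ^+ 2) -
    2 * (\sum_e (h e - coords a e) * coords (y - a) e)); last first.
    by rewrite orth mulr0 subr0.
  rewrite mulr_sumr -sumrB; apply: eq_bigr => e _; rewrite coordsB; ring.
have lb y e : H1Z y -> (p e).2 <= (coords y e - h e) ^+ 2 /\
    ((coords y e - h e) ^+ 2 = (p e).2 <-> inbox (coords b e) (coords y e)).
  by move=> /H1Z_coords/(_ e)/intrP[k ->]; apply: pP.
have mule y : H1Z y -> mu <= dist2 h y.
  by move=> yZ; apply: ler_sum => e _; case: (lb y e yZ).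
have muE y : H1Z y -> dist2 h y = mu <-> box b y.
  move=> yZ; split=> [E e|yb].
    apply/(lb y e yZ).2; apply/eqP; rewrite -subr_eq0; apply/eqP.
    apply: (@psumr_eq0P _ _ predT (fun e => (coords y e - h e) ^+ 2 - (p e).2)) => //.
      by move=> i _; rewrite subr_ge0; case: (lb y i yZ).
    by rewrite sumrB -/(dist2 h y) -/mu E subrr.
  by apply: eq_bigr => e _; apply/(lb y e yZ).2.
(* The bound [mu] is attained: [b] is a convex combination of lattice points of its box, with
   weights of sum 1, so there is at least one. *)
have [y0 [y0Z y0b]] : exists y, H1Z y /\ box b y.
  have [n [q [t [qP _ t1 _]]]] := box_in_hull b.
  case: n q t qP t1 => [|n] q t qP; last by exists (q ord0).
  by rewrite big_ord0 => /esym/eqP; rewrite oner_eq0.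
rewrite nearestE; split=> [[xZ xmin]|[xZ xb]]; split=> //.
  apply/(muE x xZ)/eqP; rewrite eq_le mule // andbT.
  by rewrite -((muE y0 y0Z).2 y0b) !pyth lerD2r; apply: xmin.
move=> y yZ; rewrite -(lerD2r (\sum_e (h e - coords a e) ^+ 2)) -!pyth.
by rewrite ((muE x xZ).2 xb) mule.
Qed.

(** The lattice point 0 has squared distance [A] from [a], so only lattice points within this
    distance compete; their integer coordinates are bounded and are encoded as ordinals shifted by
    [M]. *)
Lemma nearest_finite a : exists (n : nat) (p : 'I_n.+1 -> H),
  (forall i, nearest a (p i)) /\ forall x, nearest a x -> exists i, x = p i.
Proof.
pose A := \sum_e coords a e ^+ 2.
have A0 : 0 <= A by apply: sumr_ge0 => e _; apply: sqr_ge0.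
(* A number of square at most [A] has absolute value at most [A + 1]; applied to the coordinates of
   [a] and of [y - a], this bounds those of [y] by [2 * (A + 1)]. *)
pose M := (Num.truncn (2 * (A + 1))).+1.
have MA : 2 * (A + 1) < M%:R by apply: truncnS_gt.
pose pt (k : {ffun edge G -> 'I_(M + M).+1}) e : R := (k e)%:R - M%:R.
pose K := [pred k : {ffun edge G -> 'I_(M + M).+1} | `[< isflow (pt k) >]].
have far y : dist2 (coords a) y <= A -> forall e, `|coords y e| < M%:R.
  move=> yA e; rewrite ltNge; apply/negP => Me.
  have le2 : (coords y e - coords a e) ^+ 2 <= A.
    apply: le_trans yA; rewrite /dist2 (bigD1 e) //= lerDl.
    by apply: sumr_ge0 => i _; apply: sqr_ge0.
  have lea : coords a e ^+ 2 <= A.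
    by rewrite /A (bigD1 e) //= lerDl; apply: sumr_ge0 => i _; apply: sqr_ge0.
  have sq (r : R) : r ^+ 2 <= A -> `|r| <= A + 1.
    move=> rA; rewrite leNgt; apply/negP => lt.
    have : `|r| ^+ 2 <= A by rewrite real_normK ?num_real.
    rewrite expr2 leNgt => /negP; apply.
    by apply: lt_le_trans (ler_pM _ _ (ltW lt) (ltW lt)); rewrite ?addr_ge0 //; nra.
  have := ler_normD (coords y e - coords a e) (coords a e); rewrite subrK.
  have := sq _ le2; have := sq _ lea; lra.
have lattice y : H1Z y -> dist2 (coords a) y <= A ->
    exists2 k, k \in K & coords y = pt k.
  move=> yZ yA; have ex e : exists i : 'I_(M + M).+1, coords y e = i%:R - M%:R.
    have /intrP[z zE] := (H1Z_coords y).1 yZ e.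
    have := far y yA e; rewrite zE ltr_norml => /andP[h1 h2].
    have {h1} : - (M%:Z) < z by move: h1; rewrite -[M%:R]/(M%:Z%:~R) -mulrNz ltr_int.
    have {h2} : z < M%:Z by move: h2; rewrite -[M%:R]/(M%:Z%:~R) ltr_int.
    move=> h2 h1; pose i := absz (z + M%:Z).
    have iE : i%:Z = z + M%:Z by rewrite /i; lia.
    have lt : (i < (M + M).+1)%N by rewrite /i; lia.
    exists (Ordinal lt) => /=.
    by rewrite -[i%:R]/(i%:Z%:~R) iE intrD addrK.
  have [k kP] := choice ex; exists [ffun e => k e].
    rewrite inE; apply/asboolP; rewrite (_ : pt _ = coords y); first exact: coords_flow.
    by apply: funext => e; rewrite /pt ffunE.
  by apply: funext => e; rewrite /pt ffunE.
have [lift liftP] : exists lift, forall k, k \in K -> coords (lift k) = pt k.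
  have ex k : exists y, k \in K -> coords y = pt k.
    have [|kK] := boolP (k \in K); last by exists 0.
    by rewrite inE => /asboolP/coords_onto[y yE]; exists y.
  by have [l lP] := choice ex; exists l.
have liftZ k : k \in K -> H1Z (lift k).
  move=> kK; apply/H1Z_coords => e; rewrite (liftP k kK) /pt.
  by apply: rpredB; apply: rpred_nat.
have Z0 : H1Z (0 : H) by apply/H1Z_coords => e; rewrite coords0 rpred0.
have A0E : dist2 (coords a) 0 = A.
  by apply: eq_bigr => e _; rewrite coords0 sub0r sqrrN.
have A0le : dist2 (coords a) 0 <= A by rewrite A0E.
have [k0 k0K _] := lattice 0 Z0 A0le.
have [k kK kmin] := @arg_minP _ R _ k0 (mem K) (fun k => dist2 (coords a) (lift k)) k0K.
have lE y (yZ : H1Z y) (yA : dist2 (coords a) y <= A) : exists2 i, i \in K & y = lift i.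
  have [i iK yE] := lattice y yZ yA; exists i => //.
  by apply: coords_inj => e; rewrite liftP // yE.
have kA : dist2 (coords a) (lift k) <= A.
  have [i iK iE] := lE 0 Z0 A0le; rewrite -A0E iE; exact: kmin.
have knear : nearest a (lift k).
  apply/nearestE; split=> [|y yZ]; first exact: liftZ.
  have [yA|yA] := lerP (dist2 (coords a) y) A; last exact: le_trans kA (ltW yA).
  by have [i iK ->] := lE y yZ yA; apply: kmin.
pose S := [seq i <- enum K | `[< nearest a (lift i) >]].
have kS : k \in S.
  by rewrite mem_filter mem_enum; apply/andP; split; [exact/asboolP | exact: kK].
have sS : (size S).-1.+1 = size S by rewrite prednK //; case: (S) kS.
exists (size S).-1, (fun i => lift (nth k S i)); split=> [i|x xn].
  have : nth k S i \in S by apply: mem_nth; rewrite -[X in (_ < X)%N]sS.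
  by rewrite mem_filter => /andP[/asboolP].
have /nearestE[xZ xmin] := xn.
have [i iK xE] : exists2 i, i \in K & x = lift i.
  by apply: lE => //; rewrite -A0E; apply: xmin.
have iS : i \in S by rewrite mem_filter mem_enum iK andbT; apply/asboolP; rewrite -xE.
have lt : (index i S < (size S).-1.+1)%N by rewrite sS index_mem.
by exists (Ordinal lt); rewrite /= nth_index.
Qed.

End DelaunayCells.

Section DelaunayBoxes.
Variables (R : realType) (G : graph).
Local Notation H := (H1 R G).
Implicit Types (a b x y : H).

(* Let [b] be the average of the nearest points to [a], and let [a2] be the centre
   of a sphere around the box of [b].  The difference of the two empty spheres
   is an affine function, nonnegative on the box and nonpositive at [b], which
   lies inside the box: it vanishes on the box. *)
Lemma nearest_box a : exists b, forall x, nearest a x <-> H1Z x /\ box b x.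
Proof.
have [n [p [pa ap]]] := nearest_finite a.
pose b : H := n.+1%:R^-1 *: \sum_i p i.
have [a2 a2P] := box_nearest b.
have [q qa2] : exists q, nearest a2 q.
  have [k [q [t [qP _ t1 _]]]] := box_in_hull b.
  case: k q t qP t1 => [|k] q t qP; last by exists (q ord0); apply/a2P.
  by rewrite big_ord0 => /esym/eqP; rewrite oner_eq0.
pose m := dist2 (coords a) (p ord0); pose m2 := dist2 (coords a2) q.
pose w e := 2 * (coords a2 e - coords a e).
pose k := \sum_e (coords a e ^+ 2 - coords a2 e ^+ 2) - m + m2.
pose l y := \sum_e coords y e * w e + k.
have lE y : l y = (dist2 (coords a) y - m) - (dist2 (coords a2) y - m2).
  have sqE : dist2 (coords a) y - dist2 (coords a2) y =
      \sum_e coords y e * w e + \sum_e (coords a e ^+ 2 - coords a2 e ^+ 2).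
    rewrite /dist2 -sumrB -big_split; apply: eq_bigr => e _ /=; rewrite /w; ring.
  by rewrite /l /k; lra.
have l_lin (c d : R) x y : c + d = 1 -> l (c *: x + d *: y) = c * l x + d * l y.
  move=> cd; have -> : l (c *: x + d *: y) =
      (c * (\sum_e coords x e * w e) + d * (\sum_e coords y e * w e)) + (c + d) * k.
    rewrite cd mul1r /l; congr (_ + _); rewrite !mulr_sumr -big_split.
    by apply: eq_bigr => e _ /=; rewrite coordsD !coordsZ; ring.
  by rewrite /l; ring.
have am x : nearest a x -> dist2 (coords a) x = m.
  move=> /nearestE[xZ xm]; have /nearestE[pZ pm] := pa ord0.
  by apply/eqP; rewrite eq_le xm // pm.
have mle y : H1Z y -> m <= dist2 (coords a) y.
  by move=> yZ; have /nearestE[_] := pa ord0; apply.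
have am2 x : nearest a2 x -> dist2 (coords a2) x = m2.
  move=> /nearestE[xZ xm]; have /nearestE[qZ qm] := qa2.
  by apply/eqP; rewrite eq_le xm // qm.
have m2le y : H1Z y -> m2 <= dist2 (coords a2) y.
  by move=> yZ; have /nearestE[_] := qa2; apply.
have l_ge0 y : box b y -> 0 <= l y.
  move=> /hull_box; apply: convex_hull_affine => z /a2P za2.
  have [zZ _] := (nearestE _ _).1 za2.
  by rewrite -/(l z) lE (am2 z za2) subrr subr0 subr_ge0 mle.
have l_le0 i : l (p i) <= 0.
  have [pZ _] := (nearestE _ _).1 (pa i).
  by rewrite lE (am (p i) (pa i)) subrr sub0r oppr_le0 subr_ge0 m2le.
have sum_l : \sum_i l (p i) = n.+1%:R * l b.
  have sumw : \sum_i \sum_e coords (p i) e * w e = n.+1%:R * \sum_e coords b e * w e.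
    rewrite exchange_big mulr_sumr; apply: eq_bigr => e _ /=.
    rewrite -mulr_suml -coords_sum mulrA; congr (_ * _).
    by rewrite /b coordsZ mulVKf // pnatr_eq0.
  by rewrite /l big_split /= sumr_const card_ord sumw mulrDr -[k *+ _]mulr_natl.
have sum0 : \sum_i - l (p i) = 0.
  apply/eqP; rewrite eq_le; apply/andP; split.
    by rewrite sumrN sum_l oppr_le0 mulr_ge0 ?ler0n // l_ge0 //; apply: box_refl.
  by apply: sumr_ge0 => i _; rewrite oppr_ge0.
have lb0 : l b = 0.
  move/eqP: sum0; rewrite sumrN oppr_eq0 sum_l mulf_eq0 pnatr_eq0 /=.
  by move/eqP.
have lp0 i : l (p i) = 0.
  apply/eqP; rewrite -oppr_eq0; apply/eqP.
  by apply: (psumr_eq0P _ sum0) => // j _; rewrite oppr_ge0.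
exists b => x; split=> [/ap[i ->]|[xZ xb]].
  apply/a2P/nearestE; have [pZ _] := (nearestE _ _).1 (pa i); split; first exact: pZ.
  move=> y yZ; have := lp0 i; rewrite lE (am _ (pa i)) subrr sub0r => /eqP.
  by rewrite oppr_eq0 subr_eq0 => /eqP ->; apply: m2le.
have [t t0 bt] := box_relint xb.
have lt : l (b + t *: (b - x)) = - t * l x.
  have -> : b + t *: (b - x) = (1 + t) *: b + (- t) *: x.
    by rewrite scalerBr scalerDl scale1r scaleNr addrA.
  by rewrite l_lin ?addrK // lb0 mulr0 add0r.
have lx : l x = 0.
  apply/eqP; rewrite eq_le l_ge0 // andbT.
  by have := l_ge0 _ bt; rewrite lt mulNr oppr_ge0 pmulr_rle0.
have xa2 : nearest a2 x by apply/a2P.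
apply/nearestE; split; first exact: xZ.
move=> y yZ; have := lx; rewrite lE (am2 x xa2) subrr subr0 => /eqP.
by rewrite subr_eq0 => /eqP ->; apply: mle.
Qed.

Lemma Delaunay_cellP (D : H -> Prop) : Delaunay_cell D <-> exists b, D = box b.
Proof.
have cell a b : (forall x, nearest a x <-> H1Z x /\ box b x) ->
    norm_closure (convex_hull (nearest a)) = box b.
  move=> ab; have -> : convex_hull (nearest a) = box b.
    apply: funext => x; apply: propext; rewrite -hull_box.
    by split; apply: convex_hull_incl => y /ab.
  by apply: funext => x; apply: propext; apply: norm_closure_box.
split=> [[a ->]|[b ->]].
  by have [b ab] := nearest_box a; exists b; apply: cell.
by have [a ab] := box_nearest b; exists a; rewrite (cell a b).
Qed.

End DelaunayBoxes.

(** * Isomorphisms of Delaunay decompositions *)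

Section DelaunayIso.
Variables (R : realType) (G G' : graph).

Lemma Del_SP : Del_iso R G G' -> order_iso (@SP_ge G) (@SP_ge G').
Proof.
move=> [f [[g fK gK] _ fD]].
have boxE b x : box b x <-> box (f b) (f x).
  have /fD/Delaunay_cellP[b' imE] : Delaunay_cell (box b).
    by apply/Delaunay_cellP; exists b.
  have imP z : box b z -> box b' (f z) by move=> bz; rewrite -imE; exists z.
  have [y yb yb'] : exists2 y, box b y & f y = b'.
    by have := @box_refl R G' b'; rewrite -{1}imE => -[y yb <-]; exists y.
  (* The image of the box of [b] is the box of some [b']. The segment from the preimage [y] of [b']
     can be prolonged beyond [b] inside the box, so its image passes [f b] when coming from [b'],
     and [f b] has the same box as [b']. *)
  have [t t0 bt] := box_relint yb.
  have E := @box_eq R G' (f b) b' t (imP _ (box_refl b)) t0.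
  have {}E : forall z, box (f b) z <-> box b' z.
    by apply: E; have := imP _ bt; rewrite linearD linearZ linearB yb'.
  split=> [/imP/E//|/E].
  by rewrite -imE => -[z bz /(can_inj fK) <-].
have suppE x y : (forall e, coords y e = 0 -> coords x e = 0) <->
    (forall e, coords (f y) e = 0 -> coords (f x) e = 0).
  rewrite !box_supp; split=> -[t [s [t0 s0 b1 b2]]]; exists t, s; split=> //.
  - by move/boxE: b1; rewrite linearD !linearZ.
  - by move/boxE: b2; rewrite linearB !linearZ.
  - by apply: (boxE _ _).2; rewrite linearD !linearZ /=; exact: b1.
  - by apply: (boxE _ _).2; rewrite linearB !linearZ ?scalerN /= ?scalerN; exact: b2.
pose r x x' := exists2 h, coords h = x & coords (f h) = x'.
apply: (SP_iso_flows (r := r)) => [x /coords_onto[h <-]|x' /coords_onto[h' <-]|].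
- by exists (coords (f h)); [exact: coords_flow | exists h].
- exists (coords (g h')); first exact: coords_flow.
  by exists (g h') => //; rewrite gK.
by move=> x x' y y' _ _ _ _ [h <- <-] [h' <- <-]; apply: suppE.
Qed.

(** A link determines the image of a flow uniquely, since coordinates without a partner vanish;
    linearity and inverse of the map follow from this. Integers and boxes are preserved by changes
    of sign. *)
Lemma sign_link_Del (m : edge G -> edge G' -> R) : sign_link m -> Del_iso R G G'.
Proof.
move=> ml; have ml' := sign_link_sym ml; have [m1 tot _ _ _] := ml.
have [_ tot' _ _ _] := ml'.
have uniq_link (K K' : graph) (n : edge K -> edge K' -> R) (x : edge K -> R) h h' :
    sign_link n -> linked n x (coords h) -> linked n x (coords h') -> h = h'.
  move=> nl lh lh'; apply: coords_inj => e'.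
  have [[e ne]|z] := linked_coord nl e'; first by rewrite (lh e e' ne) (lh' e e' ne).
  by rewrite !z //; apply: coords_flow.
have exf h : exists h', linked m (coords h) (coords h').
  by have [x' /coords_onto[h' <-] l] := tot _ (coords_flow h); exists h'.
have exg h' : exists h, linked (fun e' e => m e e') (coords h') (coords h).
  by have [x /coords_onto[h <-] l] := tot' _ (coords_flow h'); exists h.
have [f fP] := choice exf; have [g gP] := choice exg.
have flin : linear f.
  move=> t x y; apply: (uniq_link _ _ m (coords (t *: x + y)) _ _ ml) => //.
  move=> e e' me; rewrite !coordsD !coordsZ (fP x e e' me) (fP y e e' me); ring.
have fK : cancel f g.
  by move=> x; apply: (uniq_link _ _ _ (coords (f x)) _ _ ml') => //; apply: linked_sym.
have gK : cancel g f.
  move=> x'; apply: (uniq_link _ _ _ (coords (g x')) _ _ ml) => //.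
  exact: (linked_sym ml' (gP x')).
have box_link (K K' : graph) (n : edge K -> edge K' -> R) (k : H1 R K -> H1 R K') :
    sign_link n -> (forall h, linked n (coords h) (coords (k h))) ->
    forall b x, box b x -> box (k b) (k x).
  move=> nl kP b x bx e'; have [[e ne]|z] := linked_coord nl e'; last first.
    by rewrite !z //; apply: coords_flow.
  rewrite (kP b e e' ne) (kP x e e' ne); have [n1 _ _ _ _] := nl.
  have [n0|->|->] := n1 e e'; first by rewrite n0 eqxx in ne.
    by rewrite !mul1r.
  by rewrite !mulN1r; apply: inbox_opp.
pose lf : {linear H1 R G -> H1 R G'} :=
  HB.pack f (GRing.isLinear.Build R (H1 R G) (H1 R G') _ f flin).
exists lf; split; first by exists g.
- move=> x /H1Z_coords xZ; apply/H1Z_coords => e'.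
  have [[e me]|z] := linked_coord ml e'; last first.
    by rewrite (z _ (coords_flow _)) rpred0.
  rewrite (fP x e e' me); have [->|->|->] := m1 e e'.
  + by rewrite mul0r rpred0.
  + by rewrite mul1r.
  + by rewrite mulN1r rpredN.
move=> D /Delaunay_cellP[b ->]; apply/Delaunay_cellP; exists (f b).
apply: funext => y; apply: propext; split=> [[x bx <-]|by_].
  exact: (box_link _ _ m f ml fP).
exists (g y); last exact: gK.
by have := box_link _ _ _ g ml' gP _ _ by_; rewrite fK.
Qed.

End DelaunayIso.

Theorem theorem5p3p2 (R : realType) (G G' : graph) :
  [<-> same_cyc_class3 G G';
       Del_iso R G G';
       order_iso (@SP_ge G) (@SP_ge G');
       order_iso (@OP_ge G) (@OP_ge G');
       order_iso (@OPbar_ge G) (@OPbar_ge G')].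
Proof.
(* The poset of supports is the hub: each implication passes through it, and the signs are recovered
   from it where they are needed. *)
tfae.
- by move=> /same_cyc_class3_SP/(SP_sign_iso R)[m]; apply: sign_link_Del.
- exact: Del_SP.
- by move=> /(SP_sign_iso R)[m]; apply: sign_link_OP.
- by move=> /OP_SP/(SP_sign_iso R)[m]; apply: sign_link_OPbar.
- by move=> /OPbar_SP/same_cyc_class3_SP.
Qed.
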